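(* Let $W\in C^1(\mathbb{R})$ satisfy $W(-1)=W(1)=0$ and $W(s)>0$ for $s\neq\pm1$. Let $a:\mathbb{R}\to\mathbb{R}$ be measurable and such that there exist $a_1,a_2\in\mathbb{R}$ with $0<a_1\le a(t)\le a_2$ for all $t\in\mathbb{R}$. In addition, suppose that there exists $b\in L^\infty(\mathbb{R})$, $T$-periodic for some $T>0$, such that $a(t)\le b(t)$ for every $t\in\mathbb{R}$, $\lim_{|t|\to+\infty}\big(b(t)-a(t)\big)=0$, and $\inf_{\mathcal{X}_1}\mathcal{L}_b$ is attained. Then $\mathcal{L}_a$ attains its infimum over $\mathcal{X}_1$ at some $u_a\in\mathcal{X}_1$. Moreover, $u_a$ is a heteroclinic $C^1\cap W^{2,2}_{\mathrm{loc}}$ solution of $$\left(\frac{u'}{\sqrt{1-|u'|^2}}\right)'=a(t)W'(u)\quad\text{in }\mathbb{R},\qquad \lim_{t\to\pm\infty}\big(u(t),u'(t)\big)=(\pm1,0),$$ and $\|u_a'\|_{L^\infty}<1$.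
   Context: The space is $$\mathcal{X}_1=\Big\{u\in W^{1,\infty}(\mathbb{R})\ :\ \|u'\|_{L^\infty}\le1\ \text{ and }\ \lim_{t\to\pm\infty}u(t)=\pm1\Big\}.$$ For a weight $c:\mathbb{R}\to\mathbb{R}$ (here $c=a$ or $c=b$), the functional $\mathcal{L}_c$ is $$\mathcal{L}_c(u)=\int_{-\infty}^{+\infty}\Big(1-\sqrt{1-|u'|^2}+c(t)W(u)\Big)\,\mathrm{d}t .$$ *)

(* Defs.v *)
From HB Require Import structures.
From mathcomp Require Import all_boot all_order all_algebra.
From mathcomp Require Import all_classical all_reals all_analysis.

Set Implicit Arguments.
Unset Strict Implicit.
Unset Printing Implicit Defensive.

Import Order.TTheory GRing.Theory Num.Theory.
Import numFieldNormedType.Exports.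

Local Open Scope classical_set_scope.
Local Open Scope ring_scope.

(* All the measure theory below is relative to the complete Lebesgue measure.
   [Leb R] is [R] with the sigma-algebra of the Lebesgue (Caratheodory)
   measurable sets, whereas the canonical one on [R] is the Borel one. *)
Notation Leb R := (caratheodory_type ((@wlength R idfun)^*)%mu).

Section Sobolev.
Context {R : realType}.
Implicit Types (f g u phi : R -> R) (p : \bar R).

Local Notation mu := (@completed_lebesgue_measure R).

Definition lebesgue_measurable f := measurable_fun [set: Leb R] (f : Leb R -> R).

Definition Lp p f := (f : Leb R -> R) \in Lfun mu p.

Definition Lploc p f := forall K : set R, compact K -> Lp p (f \_ K).

Definition Linfty_norm f : \bar R := 'N[mu]_+oo[EFin \o f]%E.

Definition C1 f := (forall x, derivable f x 1) /\ continuous (derive1 f).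

Definition test_function phi :=
  (forall n x, derivable (derive1n n phi) x 1) /\
  compact (closure [set x | phi x != 0]).

Definition is_weak_derivative u g :=
  [/\ Lploc 1 u, Lploc 1 g &
    forall phi, test_function phi ->
      \int[mu]_x (u x * derive1 phi x) = - \int[mu]_x (g x * phi x)].

(* The weak derivative is unique only up to a null set; [weakD u] is one choice
   of it (and [0] if there is none).  It is used only in expressions which are
   invariant under almost everywhere equality. *)
Definition weakD u : R -> R := xget (cst 0) [set g | is_weak_derivative u g].

Definition W1infty u :=
  Lp +oo%E u /\ exists2 g, is_weak_derivative u g & Lp +oo%E g.

Definition W22loc u :=
  Lploc 2%:E u /\ exists g h,
    [/\ is_weak_derivative u g, Lploc 2%:E g,
        is_weak_derivative g h & Lploc 2%:E h].

(* An element of W^{1,oo}(R) is represented by its continuous representative,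
   whence the first clause. *)
Definition X1 : set (R -> R) := [set u |
  [/\ continuous u, W1infty u, (Linfty_norm (weakD u) <= 1)%E,
      u t @[t --> +oo] --> (1 : R) & u t @[t --> -oo] --> (-1 : R)]].

Definition energy (W c u : R -> R) : \bar R :=
  (\int[mu]_t (1 - Num.sqrt (1 - `|weakD u t| ^+ 2) + c t * W (u t))%:E)%E.

Definition attains_inf {U : Type} (F : U -> \bar R) (X : set U) (u : U) :=
  X u /\ F u = ereal_inf (F @` X).

(* [(u' / sqrt (1 - |u'| ^ 2))' = a W'(u)], where [u'] is classical and the outer
   derivative is weak, i.e. the equation holds almost everywhere. *)
Definition solves_equation (a W u : R -> R) :=
  is_weak_derivative
    (fun t => derive1 u t / Num.sqrt (1 - `|derive1 u t| ^+ 2))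
    (fun t => a t * derive1 W (u t)).

End Sobolev.

(* Main.v *)
From HB Require Import structures.
Require Import Defs.
From mathcomp Require Import all_boot all_order all_algebra.
From mathcomp Require Import all_classical all_reals all_analysis.
From mathcomp Require Import measurable_realfun ess_sup_inf.
From mathcomp Require Import ring lra.
Import Order.TTheory GRing.Theory Num.Theory.
Import numFieldNormedType.Exports.
Local Open Scope classical_set_scope.
Local Open Scope ring_scope.

(** The direct method of the calculus of variations.

    By Rademacher's theorem and the fundamental theorem of calculus for weak
    derivatives, the functions of [X1] are the 1-Lipschitz functions with limits [-1]
    and [1] ([X1P]), and the energy is the supremum over bounded intervals of the
    integrals of an energy density ([energy_leP]).

    Existence. A minimizing sequence for the weight [a] can be truncated and modified
    so that, up to some time [tau], it stays away from the well [1], and after [tau]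
    from the well [-1] ([normalization]).  If the times [tau] are bounded along a
    subsequence, a pointwise limit, which exists by equicontinuity ([lip_selection]), is
    a minimizer: the energy is lower semicontinuous ([energy_limit]) and the limits at
    infinity are recovered from its finiteness ([admissible_of_energy]).  If the times
    escape to infinity, translations by multiples of the period [T] bring them back,
    and the translated weights converge to [b]; so the minimal energy for [b] is at most
    that for [a].  As [a <= b], the minimizer for [b] then minimizes the energy for [a]
    too ([exists_minimizer]).

    Regularity. The kinetic term [lagr q = 1 - sqrt (1 - q ^ 2)] is convex, but its
    derivative blows up at [|q| = 1], and a minimizer could a priori have slope 1.  Its
    conjugate function [p |-> sqrt (1 + p ^ 2) - 1] is smooth, with derivative [psi].
    On a bounded interval the minimizer [u] is compared with the function [v] that has
    the same boundary values and slope [psi (k + H)], where [H] is a primitive of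
    [a W'(u)]: this slope is what the equation prescribes, up to the constant [k].
    Moving from [u] towards [v] does not lower the energy; by convexity of [lagr] and
    integration by parts, the integral of the gap in the Fenchel-Young inequality
    between [u'] and [k + H] is at most [0].  Hence there is no gap, and
    [u' = psi (k + H)] ([euler_lagrange_local]).  Thus [u'] is Lipschitz and [|u'| < 1];
    as the energy is finite, [u'] vanishes at infinity ([derivative_vanishes]), so its
    supremum is less than 1. *)

(** * Lebesgue measurability and Borel measurability *)

Section lebesgue_borel.
Context {R : realType}.
Local Notation mu := (@completed_lebesgue_measure R).
Local Notation leb := (@lebesgue_measure R).
Local Notation BR := (measurableTypeR R).
Local Open Scope ereal_scope.

Lemma borel_leb (A : set R) :
  measurable (A : set BR) -> measurable (A : set (Leb R)).
Proof. by move=> mA; exact: sub_caratheodory. Qed.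

Lemma measurable_id_leb : measurable_fun [set: Leb R] (idfun : Leb R -> BR).
Proof. by move=> _ B mB; rewrite setTI; exact: borel_leb. Qed.

Lemma borel_fun_leb d (T : measurableType d) (f : BR -> T) :
  measurable_fun [set: BR] f -> measurable_fun [set: Leb R] (f : Leb R -> T).
Proof. by move=> mf; apply: (measurableT_comp mf measurable_id_leb). Qed.

Lemma leb_measurable_itv (i : interval R) : measurable ([set` i] : set (Leb R)).
Proof. by apply: borel_leb; exact: measurable_itv. Qed.

Lemma mu_leb (A : set R) : mu A = leb A.
Proof. by []. Qed.

(** The identity is measurable from the completed sigma-algebra to the Borel one, and
    maps one measure to the other. *)
Lemma ge0_integral_leb (D : set BR) (f : BR -> \bar R) :
  measurable D -> measurable_fun D f -> (forall x, D x -> 0 <= f x) ->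
  \int[mu]_(x in D) f x = \int[leb]_(x in D) f x.
Proof.
move=> mD mf f0.
rewrite -(@ge0_integral_pushforward _ _ (Leb R) BR R idfun
  measurable_id_leb mu D f mD mf (fun y yD => f0 _ (set_mem yD))).
by apply: eq_measure_integral => [|mid A _ _]; [exact: measurable_id_leb|].
Qed.

Lemma integral_leb (D : set BR) (f : BR -> R) :
  measurable D -> measurable_fun D f ->
  \int[mu]_(x in D) (f x)%:E = \int[leb]_(x in D) (f x)%:E.
Proof.
move=> mD mf; rewrite integralE [RHS]integralE.
by congr (_ - _); apply: ge0_integral_leb => //;
  [apply: measurable_funepos|apply: measurable_funeneg]; exact/measurable_EFinP.
Qed.

(** A null set of the completion is contained in a Borel null set. *)
Lemma ae_leb (P : R -> Prop) :
  {ae leb, forall x, P x} <-> {ae mu, forall x, P x}.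
Proof.
split.
  by move=> [A [mA A0 PA]]; exists A; split => //; exact: borel_leb.
move=> [A [mA A0 PA]].
have : (completed_algebra_gen leb).-sigma.-measurable A.
  by rewrite completed_caratheodory_measurable.
rewrite g_sigma_completed_algebra_genE => -[B mB [N [M [mM M0 NM]] BNA]].
exists (B `|` M); split; first exact: measurableU.
  apply/eqP; rewrite eq_le measure_ge0 andbT.
  apply: (@le_trans _ _ (leb B + leb M)); first exact: measureU2.
  rewrite M0 adde0 -A0.
  rewrite -mu_leb; apply: le_measure; rewrite ?inE//; first exact: borel_leb.
  by rewrite -BNA; exact: subsetUl.
move=> x /PA; rewrite -BNA => -[Bx|Nx]; [by left|by right; exact: NM].
Qed.

Lemma aeS (P Q : R -> Prop) : {ae mu, forall x, P x} ->
  (forall x, P x -> Q x) -> {ae mu, forall x, Q x}.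
Proof.
by move=> aP PQ; apply: filterS aP => //; exact: (ae_filter_ringOfSetsType mu).
Qed.

Lemma aeI (P Q : R -> Prop) : {ae mu, forall x, P x} -> {ae mu, forall x, Q x} ->
  {ae mu, forall x, P x /\ Q x}.
Proof.
move=> aP aQ; apply: (@filterI _ _ _ P Q) => //.
exact: (ae_filter_ringOfSetsType mu).
Qed.

Lemma aeT (P : R -> Prop) : (forall x, P x) -> {ae mu, forall x, P x}.
Proof.
by move=> PT; exists set0; split => // x; move/(_ (PT x)).
Qed.

Lemma aeA (P : nat -> R -> Prop) : (forall n, {ae mu, forall x, P n x}) ->
  {ae mu, forall x, forall n, P n x}.
Proof. by move=> aP; exact: ae_foralln. Qed.

(** A Lebesgue measurable set differs from a Borel set by a null set; doing this
    for the countably many sublevel sets of [f] at rational levels, and setting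
    [f] to [0] on the union of the null sets, gives a Borel function. *)
Lemma leb_ae_borel (f : Leb R -> R) : measurable_fun [set: Leb R] f ->
  exists g : BR -> R, [/\ measurable_fun [set: BR] g,
    {ae mu, forall x, f x = g x} & forall x, g x = f x \/ g x = 0%R].
Proof.
move=> mf.
have H (q : rat) : exists BM : set BR * set BR,
  [/\ measurable BM.1, measurable BM.2, leb BM.2 = 0 &
      forall x, ~ BM.2 x -> (BM.1 x <-> (ratr q < f x)%R)].
  pose A := f @^-1` `](ratr q), +oo[%classic.
  have mA : measurable (A : set (Leb R)).
    by rewrite /A -[X in measurable X]setTI; apply: mf => //; exact: measurable_itv.
  have : (completed_algebra_gen leb).-sigma.-measurable A.
    by rewrite completed_caratheodory_measurable.
  rewrite g_sigma_completed_algebra_genE => -[B mB [N [M [mM M0 NM]] BNA]].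
  exists (B, M); split => //= x Mx.
  have <- : A x <-> (ratr q < f x)%R by rewrite /A /= in_itv/= andbT.
  rewrite -BNA; split; [by left|by case => // /NM].
have {H} [BM HBM] := choice H.
pose rn (n : nat) : rat := odflt 0%R (unpickle n).
have rnK q : rn (pickle q) = q by rewrite /rn pickleK.
pose M : set BR := \bigcup_n (BM (rn n)).2.
have MM q x : (BM q).2 x -> M x by move=> Bx; exists (pickle q); rewrite ?rnK.
have mM : measurable M.
  by apply: bigcupT_measurable => n; have [] := HBM (rn n).
pose g x := if x \in M then 0%R else f x.
have mg : measurable_fun [set: BR] (g : BR -> R).
  apply: (measurability _ (RGenOInfty.measurableE R)) => _ [_ [r ->] <-].
  rewrite setTI.
  have -> : g @^-1` `]r, +oo[ =
    \bigcup_(q in [set: rat]) (if (r < ratr q)%R then (BM q).1 `\` M else set0)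
      `|` (if (r < 0)%R then M else set0).
    apply/seteqP; split => x; rewrite /= in_itv/= andbT /g.
      case: ifPn => [/set_mem Mx r0|Mx rf]; first by rewrite r0; right.
      left; have [q] := rat_in_itvoo rf; rewrite in_itv/= => /andP[rq qf].
      exists q => //; rewrite rq; split; last by move/mem_set; exact/negP.
      by case: (HBM q) => _ _ _ -> // Mqx; move/negP: Mx; apply; apply: mem_set; exact: MM Mqx.
    move=> [[q _]|]; case: ifPn => // r0.
      move=> [Bx Mx]; rewrite memNset//; apply: (lt_trans r0).
      by case: (HBM q) => _ _ _ <- // Mqx; apply: Mx; exact: MM Mqx.
    by move=> Mx; rewrite mem_set.
  apply: measurableU; last by case: ifP.
  apply: bigcupT_measurable_rat => q; case: ifP => // _.
  by apply: measurableD => //; have [] := HBM q.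
exists g; split => //.
- apply/ae_leb.
  have : leb.-negligible M.
    apply: negligible_bigcup => n; exists (BM (rn n)).2.
    by have [? ? ? ?] := HBM (rn n); split.
  apply: negligibleS => x /=; rewrite /g; case: ifPn => [/set_mem//|//].
- by move=> x; rewrite /g; case: ifP => _; [right|left].
Qed.

End lebesgue_borel.

(** * Local integrability and differentiation of primitives *)

Section lebesgue_points.
Context {R : realType}.
Local Notation mu := (@completed_lebesgue_measure R).
Local Notation leb := (@lebesgue_measure R).
Local Notation BR := (measurableTypeR R).

Lemma integrable_leb (D : set BR) (f : BR -> R) : measurable D ->
  measurable_fun [set: BR] f -> mu.-integrable D (EFin \o f) ->
  leb.-integrable D (EFin \o f).
Proof.
move=> mD mf /integrableP[_ foo]; apply/integrableP; split.
  by apply/measurable_EFinP; exact: measurable_funTS.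
rewrite -ge0_integral_leb//.
by apply: measurableT_comp => //; apply/measurable_EFinP; exact: measurable_funTS.
Qed.

(** Every compact set of reals lies in an interval, so intervals suffice here; see
    [locint_Lploc1]. *)
Definition locint (f : R -> R) := measurable_fun [set: Leb R] f /\
  forall x y, mu.-integrable `[x, y] (EFin \o f).

(** Gives access to the theorems on Borel functions and the Borel measure, such as
    Lebesgue's differentiation theorem. *)
Lemma locint_ae_borel (f : R -> R) : locint f -> exists g : R -> R,
  [/\ {ae mu, forall x, f x = g x}, locally_integrable [set: R] g,
  forall x y, leb.-integrable `[x, y] (EFin \o g) &
  forall x y, \int[mu]_(t in `[x, y]) f t = \int[leb]_(t in `[x, y]) g t].
Proof.
move=> [mf intf]; have [g [mg fg gf]] := leb_ae_borel _ mf.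
have intg x y : leb.-integrable `[x, y] (EFin \o g).
  apply: integrable_leb => //.
  apply: (le_integrable _ _ _ (intf x y)) => //.
  - exact: leb_measurable_itv.
  - by apply/measurable_EFinP; apply: measurable_funTS; exact: borel_fun_leb.
  - by move=> z _ /=; rewrite lee_fin; case: (gf z) => ->; rewrite ?normr0.
exists g; split => //.
- split => //; first exact: openT.
  move=> K _ cK; have [M [Mr HM]] := compact_bounded cK.
  have KM : K `<=` `[- (`|M| + 1), `|M| + 1].
    move=> x Kx; rewrite /= in_itv/= -ler_norml; apply: (HM (`|M| + 1)) => //.
    by rewrite (le_lt_trans (ler_norm _))// ltrDl.
  have /integrableP[_] := intg (- (`|M| + 1)) (`|M| + 1).
  apply: le_lt_trans; apply: ge0_subset_integral => //.
  + exact: compact_measurable.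
  + by apply/measurable_EFinP; apply: measurableT_comp => //; exact: measurable_funTS mg.
- move=> x y; rewrite /Rintegral; congr fine.
  rewrite -integral_leb//; last exact: measurable_funTS.
  apply: (@ae_eq_integral _ (Leb R) R mu `[x, y]%classic
    (EFin \o g) (EFin \o f)).
  + exact: leb_measurable_itv.
  + by apply/measurable_EFinP; exact: measurable_funTS.
  + by apply/measurable_EFinP; apply: measurable_funTS; exact: borel_fun_leb.
  + by apply: filterS fg => z /= -> _.
Qed.

(** Lebesgue's theorem applies to a Borel representative of [f], whose primitives
    differ from [F] by a constant near each point. *)
Lemma ae_derive_primitive (f F : R -> R) : locint f ->
  (forall x y, x <= y -> F y - F x = \int[mu]_(t in `[x, y]) f t) ->
  {ae mu, forall x : R, is_derive x 1 F (f x)}.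
Proof.
move=> lf FE; have [g [fg locg intg fgE]] := locint_ae_borel f lf.
have H (n : nat) : {ae mu, forall x : R, - n%:R < x -> is_derive x 1 F (g x)}.
  apply/ae_leb; have := FTC1 (a := BLeft (- n%:R)) (fun y => intg _ _) locg.
  apply: filterS; first exact: (ae_filter_ringOfSetsType leb).
  move=> x /= + nx; rewrite lte_fin => /(_ nx)[dG GE].
  set G := (fun _ => _) in dG GE.
  have FG : \forall y \near x, F y = G y + F (- n%:R).
    near=> y; have ny : - n%:R <= y by apply/ltW; near: y; exact: lt_nbhsr.
    by rewrite /G -fgE -FE// subrK.
  apply: (near_eq_is_derive (f := fun y => G y + F (- n%:R))).
    by near=> y; apply/esym; near: y.
  have iG : is_derive x 1 G (g x).
    by clearbody G; split; [exact: dG|rewrite -derive1E; exact: GE].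
  by rewrite -[g x]addr0; exact: is_deriveD.
have {}H := aeA _ H.
have {fg}H := aeI _ _ fg H; apply: (aeS _ _ H) => x [-> {}H].
apply: (H (Num.truncn (`|x|)).+1).
rewrite ltrNl (le_lt_trans (ler_norm _))// normrN.
by rewrite truncnS_gt.
Unshelve. all: by end_near. Qed.

End lebesgue_points.

(** * Integrals over bounded intervals *)

Section interval_integrals.
Context {R : realType}.
Local Notation mu := (@completed_lebesgue_measure R).
Implicit Types (f g u v e : R -> R) (x y z t s : R).

Lemma int_add f x y z : locint f -> x <= y -> y <= z ->
  \int[mu]_(t in `[x, z]) f t =
  \int[mu]_(t in `[x, y]) f t + \int[mu]_(t in `[y, z]) f t.
Proof.
move=> /locint_ae_borel[g [_ _ ig E]] xy yz; rewrite !E; apply/eqP.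
rewrite addrC -subr_eq Rintegral_itvB ?bnd_simp//.
by rewrite Rintegral_itv_obnd_cbnd//; apply: integrableS (ig y z) => //;
  exact: subset_itv_oc_cc.
Qed.

Lemma int_xx f x : locint f -> \int[mu]_(t in `[x, x]) f t = 0.
Proof.
by move=> /locint_ae_borel[g [_ _ ig E]]; rewrite E set_itv1 Rintegral_set1.
Qed.

Lemma ex_primitive f : locint f -> exists F : R -> R,
  forall x y, x <= y -> F y - F x = \int[mu]_(t in `[x, y]) f t.
Proof.
move=> lf.
(* one of the two intervals is empty, or reduced to a point *)
pose F x := \int[mu]_(t in `[0, x]) f t - \int[mu]_(t in `[x, 0]) f t.
have z a b : b < a -> \int[mu]_(t in `[a, b]) f t = 0.
  by move=> ab; rewrite set_itv_ge ?bnd_simp -?ltNge// /Rintegral integral_set0.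
have Fp x : 0 <= x -> F x = \int[mu]_(t in `[0, x]) f t.
  rewrite le_eqVlt => /predU1P[<-|x0]; first by rewrite /F subrr int_xx.
  by rewrite /F (z x 0)// subr0.
have Fn x : x <= 0 -> F x = - \int[mu]_(t in `[x, 0]) f t.
  rewrite le_eqVlt => /predU1P[->|x0]; first by rewrite /F subrr int_xx// oppr0.
  by rewrite /F (z 0 x)// sub0r.
exists F => x y xy; have [x0|/ltW x0] := leP 0 x.
  by rewrite !Fp ?(le_trans x0)// (int_add f 0 x y)// addrC addKr.
rewrite (Fn x)//; have [y0|/ltW y0] := leP 0 y.
  by rewrite Fp// opprK (int_add f x 0 y)// addrC.
by rewrite Fn// opprK addrC (int_add f x y 0)// addrK.
Qed.

Lemma mu_itv x y : x <= y ->
  (mu : {measure set (Leb R) -> \bar R}) `[x, y]%classic = (y - x)%:E.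
Proof.
move=> xy; rewrite [LHS]mu_leb lebesgue_measure_itv/= lte_fin.
by case: ltgtP xy => // -> _; rewrite subrr.
Qed.

Lemma ae_neq x : {ae mu, forall t, t != x}.
Proof.
exists [set x]; split; first exact: borel_leb (measurable_set1 x).
  by rewrite [LHS]mu_leb lebesgue_measure_set1.
by move=> t /= /negP; rewrite negbK => /eqP.
Qed.

Lemma integrable_itv_bd f x y (M : R) : lebesgue_measurable f ->
  (forall t, x <= t <= y -> `|f t| <= M) -> mu.-integrable `[x, y] (EFin \o f).
Proof.
move=> mf fM; apply: (le_integrable (leb_measurable_itv _) _ _
  (g := EFin \o cst M)).
- by apply/measurable_EFinP; exact: measurable_funTS.
- move=> t; rewrite /= in_itv/= => /fM ftM; rewrite lee_fin.
  by rewrite (le_trans ftM)// ler_norm.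
- apply/integrableP; split; first by apply/measurable_EFinP; exact: measurable_cst.
  rewrite [X in (X < _)%E](@integral_cst _ (Leb R) R mu `[x, y]%classic
    (leb_measurable_itv _) (`|M|%:E)).
  have [xy|yx] := leP x y; first by rewrite mu_itv// ltry.
  by rewrite set_itv_ge ?bnd_simp -?ltNge// measure0 mule0 ltry.
Qed.

Lemma locint_bd f : lebesgue_measurable f ->
  (forall n : nat, exists M : R, forall t, `|t| <= n%:R -> `|f t| <= M) -> locint f.
Proof.
move=> mf fM; split=> // x y.
have [M HM] := fM (Num.truncn (`|x| + `|y|)).+1.
apply: (integrable_itv_bd f x y M) => // t /andP[xt ty]; apply: HM.
apply: (@le_trans _ _ (`|x| + `|y|)); last exact/ltW/truncnS_gt.
by have := ler_norm x; have := ler_norm y; have := ler_norm (- x);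
  have := ler_norm (- y); rewrite !normrN ler_norml => *; apply/andP; split; lra.
Qed.

Lemma continuous_bounded (f : R -> R) (M : R) : continuous f ->
  exists2 K : R, 0 <= K & forall s, `|s| <= M -> `|f s| <= K.
Proof.
move=> cf.
have cK : compact (f @` `[- M, M]).
  apply: continuous_compact; last exact: segment_compact.
  exact: continuous_subspaceT.
have [K [_ HK]] := compact_bounded cK.
exists (`|K| + 1); first by rewrite addr_ge0.
move=> s sM; apply: (HK (`|K| + 1)); first by rewrite (le_lt_trans (ler_norm _))// ltrDl.
by exists s => //; rewrite /= in_itv/= -ler_norml.
Qed.

Lemma leb_measurable_cont f : continuous f -> lebesgue_measurable f.
Proof.
by move=> cf; apply: borel_fun_leb; exact: continuous_measurable_fun.
Qed.

Lemma leb_measurable_cst (c : R) : lebesgue_measurable (fun=> c).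
Proof. by apply: leb_measurable_cont; exact: cst_continuous. Qed.

Lemma locint_cont f : continuous f -> locint f.
Proof.
move=> cf; apply: locint_bd; first exact: leb_measurable_cont.
by move=> n; have [K _ HK] := continuous_bounded f n%:R cf; exists K.
Qed.

Lemma locint_cst (c : R) : locint (fun=> c).
Proof. by apply: locint_cont; exact: cst_continuous. Qed.

Lemma leb_measurable_ae f g : lebesgue_measurable f ->
  {ae mu, forall t, f t = g t} -> lebesgue_measurable g.
Proof.
move=> mf fg; have cmu := @completed_lebesgue_measure_is_complete R.
move=> _ B mB; rewrite setTI.
pose N := [set t | f t != g t].
have negN : mu.-negligible N.
  by move: fg; apply: negligibleS => t /= /eqP.
have mN : measurable (N : set (Leb R)) by exact: cmu.
have -> : g @^-1` B = (f @^-1` B `\` N) `|` (g @^-1` B `&` N).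
  apply/seteqP; split => t /=.
    have [/eqP E|Nt] := boolP (f t == g t); [left|by right].
    by rewrite E; split => //; rewrite /N /= E eqxx.
  by move=> [[+ /negP]|[]//]; rewrite negbK => + /eqP <-.
apply: measurableU; first apply: measurableD => //.
  by rewrite -[X in measurable X]setTI; exact: mf.
by apply: cmu; apply: negligibleS negN; exact: subIsetr.
Qed.

Lemma locint_ae f g : locint f ->
  {ae mu, forall t, f t = g t} -> locint g.
Proof.
move=> [mf fi] fg; have mg := leb_measurable_ae f g mf fg.
split => // x y; have /integrableP[_ foo] := fi x y.
apply/integrableP; split; first by apply/measurable_EFinP; exact: measurable_funTS.
rewrite -(@ae_eq_integral _ (Leb R) R mu `[x, y]%classic
  (fun t => `|(g t)%:E|)%E (fun t => `|(f t)%:E|)%E).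
- exact: foo.
- exact: leb_measurable_itv.
- by apply/measurable_EFinP; apply: measurableT_comp => //; exact: measurable_funTS mf.
- by apply/measurable_EFinP; apply: measurableT_comp => //; exact: measurable_funTS mg.
- by apply: (aeS _ _ fg) => t /= ->.
Qed.

Lemma locintD f g : locint f -> locint g -> locint (f \+ g).
Proof.
move=> [mf fi] [mg gi]; split; first exact: measurable_funD.
move=> x y.
exact: (integrableD (leb_measurable_itv _) (fi x y) (gi x y)).
Qed.

Lemma locintZ k f : locint f -> locint (k \*o f).
Proof.
move=> [mf fi]; split; first exact: measurable_funM.
by move=> x y; exact: (integrableZl (leb_measurable_itv _) k (fi x y)).
Qed.

Lemma locintN f : locint f -> locint (\- f).
Proof.
by move=> /(locintZ (-1)); congr locint; apply/funext => t /=; rewrite mulN1r.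
Qed.

Lemma locintB f g : locint f -> locint g -> locint (f \- g).
Proof. by move=> lf lg; exact: (locintD f (\- g) lf (locintN g lg)). Qed.

Lemma locintM_cont f g : locint f -> continuous g -> locint (fun t => f t * g t).
Proof.
move=> [mf fi] cg; have mg := leb_measurable_cont g cg.
split; first exact: measurable_funM.
move=> x y; have [_] := locint_cont g cg.
have cK : compact (g @` `[x, y]).
  apply: continuous_compact; last exact: segment_compact.
  exact: continuous_subspaceT.
have [M [_ HM]] := compact_bounded cK => _.
apply: (le_integrable (leb_measurable_itv _) _ _
  (g := EFin \o (fun t => (M + 1) * f t))).
- by apply/measurable_EFinP; apply: measurable_funTS; exact: measurable_funM.
- move=> t txy; rewrite lee_fin !normrM mulrC ler_wpM2r//.
  rewrite (le_trans _ (ler_norm _))//; apply: (HM (M + 1)); first by rewrite ltrDl.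
  by exists t.
- exact: ((locintZ (M + 1) f (conj mf fi)).2 x y).
Qed.

Lemma locint_dom f g : lebesgue_measurable f -> locint g ->
  (forall t, `|f t| <= `|g t|) -> locint f.
Proof.
move=> mf [mg gi] fg; split => // x y.
apply: (le_integrable (leb_measurable_itv _) _ _ (gi x y)).
  by apply/measurable_EFinP; exact: measurable_funTS mf.
by move=> t _; rewrite lee_fin.
Qed.

Lemma intD f g x y : locint f -> locint g ->
  \int[mu]_(t in `[x, y]) (f t + g t) =
  \int[mu]_(t in `[x, y]) f t + \int[mu]_(t in `[x, y]) g t.
Proof.
by move=> [mf fi] [mg gi]; apply: RintegralD => //; exact: leb_measurable_itv.
Qed.

Lemma intZ k f x y : locint f ->
  \int[mu]_(t in `[x, y]) (k * f t) = k * \int[mu]_(t in `[x, y]) f t.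
Proof.
by move=> [mf fi]; apply: RintegralZl => //; exact: leb_measurable_itv.
Qed.

Lemma intB f g x y : locint f -> locint g ->
  \int[mu]_(t in `[x, y]) (f t - g t) =
  \int[mu]_(t in `[x, y]) f t - \int[mu]_(t in `[x, y]) g t.
Proof.
by move=> [mf fi] [mg gi]; apply: RintegralB => //; exact: leb_measurable_itv.
Qed.

Lemma int_ae f g x y : locint f ->
  {ae mu, forall t, x <= t <= y -> f t = g t} -> lebesgue_measurable g ->
  \int[mu]_(t in `[x, y]) f t = \int[mu]_(t in `[x, y]) g t.
Proof.
move=> [mf _] fg mg; rewrite /Rintegral; congr fine.
apply: (@ae_eq_integral _ (Leb R) R mu `[x, y]%classic
  (EFin \o g) (EFin \o f)).
- exact: leb_measurable_itv.
- by apply/measurable_EFinP; exact: measurable_funTS.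
- by apply/measurable_EFinP; exact: measurable_funTS.
- by apply: (aeS _ _ fg) => t /= H; rewrite in_itv/= => /H ->.
Qed.

Lemma int_ge0 f x y : (forall t, x <= t <= y -> 0 <= f t) ->
  0 <= \int[mu]_(t in `[x, y]) f t.
Proof.
by move=> f0; apply: Rintegral_ge0 => t /=; rewrite in_itv/=; exact: f0.
Qed.

Lemma int_cst k x y : x <= y -> \int[mu]_(t in `[x, y]) k = k * (y - x).
Proof.
move=> xy; rewrite /Rintegral integral_cst; last exact: leb_measurable_itv.
by rewrite mu_itv.
Qed.

Lemma int_le f g x y : locint f -> locint g ->
  (forall t, x <= t <= y -> f t <= g t) ->
  \int[mu]_(t in `[x, y]) f t <= \int[mu]_(t in `[x, y]) g t.
Proof.
move=> lf lg fg; rewrite -subr_ge0 -intB//; apply: int_ge0 => t /fg.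
by rewrite subr_ge0.
Qed.

(** The pointwise comparison applies to [g] and the minimum of [f] and [g], which is
    almost everywhere equal to [f]. *)
Lemma int_le_ae f g x y : locint f -> locint g ->
  {ae mu, forall t, x <= t <= y -> f t <= g t} ->
  \int[mu]_(t in `[x, y]) f t <= \int[mu]_(t in `[x, y]) g t.
Proof.
move=> lf lg fg; pose h t := Num.min (f t) (g t).
have mh : lebesgue_measurable h.
  by case: lf lg => mf _ [mg _]; exact: (measurable_minr mf mg).
have hf : {ae mu, forall t, x <= t <= y -> f t = h t}.
  by apply: (aeS _ _ fg) => t H /H; rewrite /h /Num.min; case: ltgtP.
rewrite (int_ae f h)//; apply: int_le => //; last first.
  by move=> t _; rewrite /h ge_min lexx orbT.
split => // a b; apply: (le_integrable (leb_measurable_itv _) _ _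
   (g := EFin \o ((fun t => `|f t|) \+ (fun t => `|g t|)))).
- by apply/measurable_EFinP; exact: measurable_funTS.
- move=> t _ /=; rewrite lee_fin [leRHS]ger0_norm ?addr_ge0//.
  by rewrite /h /Num.min; case: ifP => _; rewrite ?lerDl ?lerDr.
- exact: (integrableD (leb_measurable_itv _) (integrable_norm (lf.2 a b))
    (integrable_norm (lg.2 a b))).
Qed.

Lemma int_norm_le f x y (M : R) : locint f -> x <= y ->
  (forall t, x <= t <= y -> `|f t| <= M) ->
  `|\int[mu]_(t in `[x, y]) f t| <= M * (y - x).
Proof.
move=> lf xy fM.
have lM (k : R) : locint (fun=> k) by apply: locint_cont; exact: cst_continuous.
rewrite ler_norml -mulNr -!int_cst//; apply/andP; split; apply: int_le => //.
  by move=> t /fM; rewrite ler_norml => /andP[].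
by move=> t /fM; rewrite ler_norml => /andP[].
Qed.

Lemma int_subset e x y x' y' : locint e -> (forall t, 0 <= e t) ->
  x' <= x -> x <= y -> y <= y' ->
  \int[mu]_(t in `[x, y]) e t <= \int[mu]_(t in `[x', y']) e t.
Proof.
move=> le e0 xx xy yy.
rewrite (int_add _ x' x y')//; last exact: le_trans yy.
rewrite (int_add _ x y y')// addrCA lerDl addr_ge0//; exact: int_ge0.
Qed.

Lemma int_support f x y : (forall t, ~~ (x <= t <= y) -> f t = 0) ->
  \int[mu]_t f t = \int[mu]_(t in `[x, y]) f t.
Proof.
move=> f0; rewrite [RHS]Rintegral_mkcond; congr Rintegral.
apply/funext => t; rewrite patchE; case: ifPn => // /negP tn.
by apply: f0; apply/negP => txy; apply: tn; rewrite inE /= in_itv.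
Qed.

Lemma int_dominated (F : nat -> R -> R) f g x y :
  (forall n, lebesgue_measurable (F n)) -> lebesgue_measurable f ->
  mu.-integrable `[x, y] (EFin \o g) ->
  {ae mu, forall t, x <= t <= y -> F ^~ t @ \oo --> f t} ->
  (forall n t, x <= t <= y -> `|F n t| <= g t) ->
  \int[mu]_(t in `[x, y]) F n t @[n --> \oo] --> \int[mu]_(t in `[x, y]) f t.
Proof.
move=> mF mf ig Ff Fg.
have mI := leb_measurable_itv `[x, y].
have mFn n : measurable_fun (`[x, y]%classic : set (Leb R)) (EFin \o F n).
  by apply/measurable_EFinP; exact: measurable_funTS (mF n).
have mf' : measurable_fun (`[x, y]%classic : set (Leb R)) (EFin \o f).
  by apply/measurable_EFinP; exact: measurable_funTS mf.
have Ff' : {ae mu, forall t, `[x, y]%classic t ->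
    (fun n => (F n t)%:E) @ \oo --> (f t)%:E}.
  apply: (aeS _ _ Ff) => t /= H; rewrite in_itv/= => /H.
  by move=> ?; apply: cvg_EFin => //; exact: nearW.
have Fg' : {ae mu, forall t n, `[x, y]%classic t -> (`|(F n t)%:E| <= (g t)%:E)%E}.
  by apply: aeT => t n /=; rewrite in_itv/= => ?; rewrite lee_fin; exact: Fg.
have [fi _ H] := @dominated_convergence _ (Leb R) R mu `[x, y]%classic mI
  (fun n => EFin \o F n) (EFin \o f) (EFin \o g) mFn mf' Ff' ig Fg'.
apply: (@cvg_comp _ _ _ _ fine _ _ _ H).
have : (\int[mu]_(t in `[x, y]) (f t)%:E)%E \is a fin_num.
  exact: (integrable_fin_num mI fi).
by move=> /fineK <-; exact: fine_cvg.
Qed.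

End interval_integrals.

(** * Lipschitz functions are differentiable almost everywhere *)

Section rademacher.
Context {R : realType}.
Local Notation mu := (@completed_lebesgue_measure R).
Local Notation leb := (@lebesgue_measure R).
Local Notation BR := (measurableTypeR R).
Implicit Types (f g u : R -> R) (x y z L : R).

Definition lip L f :=
  forall x y, `|f x - f y| <= L * `|x - y|.

Lemma lip_continuous L f : lip L f -> continuous f.
Proof.
move=> Lf x; apply/(@cvgrPdist_le _ R^o) => e e0.
have L0 : 0 < `|L| + 1 by rewrite ltr_pwDr.
near=> t; rewrite (le_trans (Lf _ _))//.
rewrite (@le_trans _ _ ((`|L| + 1) * `|x - t|))//.
  by rewrite ler_wpM2r// (le_trans (ler_norm _))// lerDl.
rewrite -ler_pdivlMl// mulrC; near: t; apply: cvgr_dist_le; first exact: cvg_id.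
exact: divr_gt0.
Unshelve. all: by end_near. Qed.

Lemma lip_ge0 L f : lip L f -> 0 <= L.
Proof. by move=> /(_ 0 1); rewrite sub0r normrN1 mulr1; exact: le_trans. Qed.

Lemma lip_primitive (f F : R -> R) (K : R) : locint f -> (forall t, `|f t| <= K) ->
  (forall x y, x <= y -> F y - F x = \int[mu]_(t in `[x, y]) f t) -> lip K F.
Proof.
move=> lf fK HF.
suff H x y : x <= y -> `|F x - F y| <= K * `|x - y|.
  move=> x y; have [xy|/ltW xy] := leP x y; first exact: H.
  by rewrite distrC [`|x - y|]distrC; exact: H.
move=> xy; rewrite distrC HF// [`|x - y|]distrC (ger0_norm (_ : 0 <= y - x)) ?subr_ge0//.
by apply: (int_norm_le _ _ _ _ lf xy) => t _; exact: fK.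
Qed.

Lemma ex_cumulative (F : R -> R) : nondecreasing F -> continuous F ->
  exists c : cumulative R R, c = F :> (R -> R).
Proof.
move=> ndF cF; have rcF := right_continuousW cF.
pose c : cumulative R R := HB.pack F (isCumulative.Build R _ R F ndF rcF).
by exists c.
Qed.

Lemma lebesgue_stieltjes_itv (F : cumulative R R) x y : x <= y ->
  lebesgue_stieltjes_measure F `]x, y]%classic = (F y - F x)%:E.
Proof.
move=> xy; rewrite /lebesgue_stieltjes_measure /measure_extension.
rewrite measurable_mu_extE/=; last exact: is_ocitv.
by rewrite wlength_itv_bnd.
Qed.

(** The Stieltjes measures of [F] and [G] add up to [L] times the Lebesgue measure, so
    that both are absolutely continuous. For a [K]-Lipschitz function [f], this applies
    to the nondecreasing functions [K x + f x] and [K x - f x]. *)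
Lemma stieltjes_le_lebesgue L (F G : cumulative R R) : 0 < L ->
  (forall x, F x + G x = L * x) ->
  forall A : set BR, measurable A ->
    (lebesgue_stieltjes_measure F A <= L%:E * leb A)%E.
Proof.
move=> L0 FG A mA.
have Li0 : 0 <= L^-1 by rewrite invr_ge0 ltW.
pose m := measure_add (lebesgue_stieltjes_measure F) (lebesgue_stieltjes_measure G).
have lebE : leb A = mscale (NngNum Li0) m A.
  apply: lebesgue_measure_unique => // X /ocitvP[->|[[x y]/= xy ->]].
    by rewrite !measure0.
  have mE : m `]x, y]%classic = (L * (y - x))%:E.
    rewrite /m measure_addE; transitivity ((F y - F x)%:E + (G y - G x)%:E)%E.
      by congr (_ + _)%E; apply: lebesgue_stieltjes_itv; exact: ltW.
    by rewrite -EFinD; congr EFin; rewrite mulrBr -!FG; lra.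
  transitivity ((y - x)%:E); first exact: (lebesgue_stieltjes_itv idfun x y (ltW xy)).
  transitivity (L^-1%:E * (L * (y - x))%:E)%E; last by congr (_ * _)%E.
  by rewrite -EFinM mulKf// gt_eqF.
rewrite lebE /mscale/= muleA -EFinM divff ?gt_eqF// mul1e.
by rewrite [leRHS]measure_addE leeDl.
Qed.

(** The Radon-Nikodym density of the Stieltjes measure of [f x + K x], restricted
    to a bounded interval to make it finite, minus [K]. *)
Lemma lip_local_density L f (n : nat) : lip L f -> exists2 h : R -> R, locint h &
  forall a b, - n%:R < a -> a <= b -> b < n%:R ->
    f b - f a = \int[mu]_(t in `[a, b]) h t.
Proof.
move=> Lf0; pose K : R := `|L| + 1; have K0 : 0 < K by rewrite ltr_pwDr.
have Lf : lip K f.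
  move=> x y; rewrite (le_trans (Lf0 x y))// ler_wpM2r// /K.
  by rewrite (le_trans (ler_norm _))// lerDl.
pose F x := f x + K * x; pose G x := K * x - f x.
have cf := lip_continuous _ _ Lf.
have cF : continuous F.
  by move=> x; apply: cvgD; [exact: cf|apply: cvgM; [exact: cvg_cst|exact: cvg_id]].
have cG : continuous G.
  by move=> x; apply: cvgB; [apply: cvgM; [exact: cvg_cst|exact: cvg_id]|exact: cf].
have ndF : nondecreasing F.
  move=> x y xy; have := Lf y x.
  by rewrite (ger0_norm (_ : 0 <= y - x)) ?subr_ge0// ler_norml /F => /andP[]; lra.
have ndG : nondecreasing G.
  move=> x y xy; have := Lf y x.
  by rewrite (ger0_norm (_ : 0 <= y - x)) ?subr_ge0// ler_norml /G => /andP[]; lra.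
have [cuF cuFE] := ex_cumulative F ndF cF.
have [cuG cuGE] := ex_cumulative G ndG cG.
have nuL := @stieltjes_le_lebesgue (2 * K) cuF cuG _ _.
have {}nuL A : measurable A -> (lebesgue_stieltjes_measure cuF A <= (2 * K)%:E * leb A)%E.
  by apply: nuL; [rewrite mulr_gt0|move=> x; rewrite cuFE cuGE /F /G; lra].
pose D : set BR := `](- n%:R), n%:R]%classic.
have mD : measurable D by exact: measurable_itv.
have Doo : (lebesgue_stieltjes_measure cuF D < +oo)%E.
  by rewrite /D lebesgue_stieltjes_itv ?ltry// ?cuFE -subr_ge0 opprK -natrD.
pose nu := mfrestr mD Doo.
have dom : nu `<< leb.
  apply/null_content_dominatesP => A mA A0; apply/eqP; rewrite eq_le measure_ge0 andbT.
  rewrite /nu /mfrestr /mrestr (le_trans (nuL _ _))//; first exact: measurableI.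
  have -> : leb (A `&` D) = 0%E.
    by apply: (subset_measure0 _ _ _ A0) => //; exact: measurableI.
  by rewrite mule0.
have [h [h0 hfin hint hE]] := radon_nikodym_sigma_finite dom.
pose hR t := fine (h t).
have hRE : EFin \o hR = h by apply/funext => t /=; rewrite fineK.
have mhR : measurable_fun [set: BR] (hR : BR -> R).
  by apply/measurable_EFinP; rewrite hRE; exact: measurable_int hint.
have lh : locint hR.
  split=> [|x y]; first exact: borel_fun_leb.
  apply/integrableP; split.
    by apply/measurable_EFinP; apply: measurable_funTS; exact: borel_fun_leb.
  have /integrableP[_] := hint; apply: le_lt_trans.
  rewrite (ge0_integral_leb `[x, y]%classic (fun t => `|(hR t)%:E|%E))//; last first.
    by apply/measurable_EFinP; apply: measurableT_comp => //; exact: measurable_funTS mhR.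
  rewrite -hRE; apply: ge0_subset_integral => //.
  by apply/measurable_EFinP; apply: measurableT_comp => //; exact: mhR.
exists (fun t => hR t - K).
  by apply: (locintB hR (fun=> K)) => //; apply/locint_cont/cst_continuous.
move=> a b na ab bn.
rewrite (intB hR (fun=> K))//; last by apply/locint_cont/cst_continuous.
rewrite int_cst//; suff : F b - F a = \int[mu]_(t in `[a, b]) hR t.
  by rewrite /F => <-; lra.
  have E : (\int[leb]_(t in `]a, b]) (hR t)%:E = (F b - F a)%:E)%E.
    have <- : nu `]a, b]%classic = (\int[leb]_(t in `]a, b]) (hR t)%:E)%E.
      transitivity (\int[leb]_(t in `]a, b]) h t)%E.
        exact: hE `]a, b]%classic (measurable_itv _).
      by rewrite -hRE.
    rewrite -cuFE -(lebesgue_stieltjes_itv cuF a b ab) /nu /mfrestr /mrestr.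
    congr (lebesgue_stieltjes_measure _ _); apply/setIidl => t.
    rewrite /D /= !in_itv/= => /andP[at_ tb].
    by rewrite (lt_trans na)//= ltW// (le_lt_trans tb).
  apply: EFin_inj; rewrite -E /Rintegral.
  rewrite (integral_leb `[a, b]%classic)//; last exact: measurable_funTS.
  rewrite -integral_itv_obnd_cbnd; last first.
    by apply/measurable_EFinP; exact: measurable_funTS.
  by rewrite E.
Qed.

Lemma is_deriveP f x (d : R) : is_derive x 1 f d <->
  forall e : R, 0 < e -> exists2 r : R, 0 < r &
    forall h : R, h != 0 -> `|h| < r -> `|(f (x + h) - f x) / h - d| <= e.
Proof.
split.
  move=> [df <-] e e0; move/cvgrPdist_le : df => /(_ _ e0).
  move=> [r /= r0 H]; exists r => // h h0 hr.
  have := H h; rewrite /= sub0r normrN => /(_ hr h0).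
  by rewrite distrC mulrC [x + h]addrC [h *: 1]mulr1.
move=> H; have : h^-1 *: (f (h *: 1 + x) - f x) @[h --> 0^'] --> d.
  apply/cvgrPdist_le => e e0; have [r r0 {}H] := H _ e0.
  exists r => //= h /=; rewrite /ball_ sub0r normrN => hr h0.
  have -> : h^-1 *: (f (h%:A + x) - f x) = (f (x + h) - f x) / h.
    by rewrite [h%:A]mulr1 [h + x]addrC [LHS]mulrC.
  by rewrite distrC; exact: H.
move=> cd; split; first by apply/cvg_ex; exists d.
by apply/cvg_lim.
Qed.

(** The derivative, set to [0] where it does not exist, so that the derivative
    of a Lipschitz function is bounded everywhere. *)
Definition der f x : R := if `[< derivable f x 1 >] then 'D_1 f x else 0.

Lemma derivable_der f x : derivable f x 1 -> is_derive x 1 f (der f x).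
Proof. by move=> df; rewrite /der asboolT//; exact: derivableP. Qed.

Lemma derE f x (d : R) : is_derive x 1 f d -> der f x = d.
Proof. by move=> [df <-]; rewrite /der asboolT. Qed.

Lemma der_nderivable f x : ~ derivable f x 1 -> der f x = 0.
Proof. by move=> ndf; rewrite /der asboolF. Qed.

Lemma near_der f g x : (\forall t \near x, f t = g t) -> der f x = der g x.
Proof.
move=> fg; have gf : \forall t \near x, g t = f t.
  by apply: filterS fg => t ->.
have [df|ndf] := pselect (derivable f x 1).
  apply/esym/derE; apply: near_eq_is_derive fg _; exact: derivable_der.
have ndg : ~ derivable g x 1.
  by apply: contra_not ndf => dg; exact: near_eq_derivable gf dg.
by rewrite (der_nderivable _ _ ndf) (der_nderivable _ _ ndg).
Qed.

Lemma le_norm_der f x (M : R) : 0 <= M -> (forall y, `|f y - f x| <= M * `|y - x|) ->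
  `|der f x| <= M.
Proof.
move=> M0 fM; have [df|ndf] := pselect (derivable f x 1); last first.
  by rewrite der_nderivable// normr0.
apply/ler_addgt0Pr => e e0.
have /is_deriveP/(_ _ e0)[r r0 H] := derivable_der _ _ df.
have r20 : r / 2 != 0 by rewrite gt_eqF// divr_gt0.
have /(H _ r20) : `|r / 2| < r by rewrite gtr0_norm ?divr_gt0//; lra.
have : `|(f (x + r / 2) - f x) / (r / 2)| <= M.
  rewrite normrM normfV ler_pdivrMr ?normr_gt0//.
  by rewrite (le_trans (fM _))// addrAC subrr add0r.
move: (_ / _) => q qM qe.
have -> : der f x = q - (q - der f x) by lra.
by rewrite (le_trans (ler_normB _ _))// lerD.
Qed.

Lemma ae_is_derive_local f (n : nat) (h : R -> R) : locint h ->
  (forall a b, - n%:R < a -> a <= b -> b < n%:R ->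
    f b - f a = \int[mu]_(t in `[a, b]) h t) ->
  {ae mu, forall x : R, - n%:R < x < n%:R -> is_derive x 1 f (h x)}.
Proof.
move=> lh hE; have [P PE] := ex_primitive _ lh.
apply: (aeS _ _ (ae_derive_primitive _ _ lh PE)) => x dP /andP[nx xn].
have FPx : \forall t \near x, P t + (f x - P x) = f t.
  near=> t.
  have nt : - n%:R < t by near: t; exact: lt_nbhsr.
  have tn : t < n%:R by near: t; exact: lt_nbhsl.
  by have [xt|/ltW tx] := leP x t;
    [have := hE x t nx xt tn|have := hE t x nt tx xn]; rewrite -PE//; lra.
apply: (near_eq_is_derive FPx).
by rewrite -[h x]addr0; exact: is_deriveD.
Unshelve. all: by end_near. Qed.

(** Rademacher's theorem on the line: [f] is locally a primitive. *)
Lemma lip_ae_der L f : lip L f -> {ae mu, forall x : R, is_derive x 1 f (der f x)}.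
Proof.
move=> Lf; have H (n : nat) : {ae mu, forall x : R, - n%:R < x < n%:R ->
    is_derive x 1 f (der f x)}.
  have [h lh hE] := lip_local_density L f n Lf.
  apply: (aeS _ _ (ae_is_derive_local _ _ _ lh hE)) => x dx nx.
  by rewrite (derE _ _ _ (dx nx)); exact: dx.
apply: (aeS _ _ (aeA _ H)) => x /(_ (Num.truncn `|x|).+1); apply.
by rewrite -ltr_norml truncnS_gt.
Qed.

(** The derivative is a limit of difference quotients, which have to be cut off where
    they do not converge to it. *)
Lemma leb_measurable_der L f : lip L f -> lebesgue_measurable (der f).
Proof.
move=> Lf; have cf := lip_continuous _ _ Lf.
pose E := [set x | derivable f x 1].
have mE : measurable (E : set (Leb R)).
  rewrite -[X in measurable X]setCK; apply: measurableC.
  apply: completed_lebesgue_measure_is_complete.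
  by apply: negligibleS (lip_ae_der L f Lf) => x Ex /= [? _]; exact: Ex.
pose q (n : nat) x : R := n.+1%:R * (f (x + n.+1%:R^-1) - f x) * \1_E x.
apply: (@measurable_fun_cvg _ (Leb R) R setT q).
  move=> n; apply: measurable_funM; last exact: measurable_indic.
  apply: leb_measurable_cont => x; apply: cvgM; first exact: cvg_cst.
  apply: cvgB; last exact: cf.
  apply: (@continuous_comp _ _ _ (fun x => x + n.+1%:R^-1) f); last exact: cf.
  by apply: cvgD; [exact: cvg_id|exact: cvg_cst].
move=> x _; rewrite /q indicE; case: (boolP (x \in E)) => [/set_mem dx|]; last first.
  move=> nE; rewrite der_nderivable; last by move=> dx; move/negP: nE; apply; rewrite inE.
  under eq_fun do rewrite mulr0; exact: cvg_cst.
under eq_fun do rewrite mulr1.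
apply/cvgrPdist_le => e e0.
have /is_deriveP/(_ _ e0)[r r0 H] := derivable_der _ _ dx.
near=> n.
have -> : n.+1%:R * (f (x + n.+1%:R^-1) - f x) =
    (f (x + n.+1%:R^-1) - f x) / n.+1%:R^-1 by rewrite invrK mulrC.
rewrite distrC; apply: H.
  by rewrite invr_eq0 pnatr_eq0.
rewrite ger0_norm ?invr_ge0//; near: n; exact: near_infty_natSinv_lt (PosNum r0).
Unshelve. all: by end_near. Qed.

Lemma le_norm_der_lip L f x : lip L f -> `|der f x| <= L.
Proof. by move=> Lf; apply: le_norm_der; [exact: lip_ge0 Lf|move=> y; exact: Lf]. Qed.

Lemma locint_der L f : lip L f -> locint (der f).
Proof.
move=> Lf; apply: locint_bd; first exact: leb_measurable_der Lf.
by move=> n; exists L => t _; exact: le_norm_der_lip.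
Qed.

Lemma int_der L f a b : lip L f -> a <= b ->
  \int[mu]_(t in `[a, b]) der f t = f b - f a.
Proof.
move=> Lf ab; pose n := (Num.truncn (`|a| + `|b|)).+1.
have [h lh hE] := lip_local_density L f n Lf.
have na : `|a| + `|b| < n%:R by exact: truncnS_gt.
have := ler_norm a; have := ler_norm b; have := ler_norm (- a);
  have := ler_norm (- b); rewrite !normrN => *.
rewrite hE//; [|lra|lra].
apply/esym/int_ae => //; last exact: leb_measurable_der Lf.
apply: (aeS _ _ (ae_is_derive_local _ _ _ lh hE)) => x dx xab.
by apply/esym/derE/dx; apply/andP; split; lra.
Qed.

End rademacher.

(** * Differentiation *)

Section differentiation.
Context {R : realType}.
Local Notation mu := (@completed_lebesgue_measure R).
Implicit Types (f g : R -> R) (x t a b : R).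

Lemma is_derive_add f g x a b : is_derive x 1 f a -> is_derive x 1 g b ->
  is_derive x 1 (fun t => f t + g t) (a + b).
Proof. by move=> df dg; exact: is_deriveD. Qed.

Lemma is_derive_sub f g x a b : is_derive x 1 f a -> is_derive x 1 g b ->
  is_derive x 1 (fun t => f t - g t) (a - b).
Proof. by move=> df dg; exact: is_deriveB. Qed.

Lemma is_derive_mul f g x a b : is_derive x 1 f a -> is_derive x 1 g b ->
  is_derive x 1 (fun t => f t * g t) (a * g x + f x * b).
Proof.
move=> df dg; apply: (is_derive_eq (is_deriveM df dg)).
by rewrite addrC [f x *: _]/(_ * _) [g x *: _]mulrC.
Qed.

Lemma is_derive_scale (f : R -> R) (k x d : R) : is_derive x 1 f d ->
  is_derive x 1 (fun t => k * f t) (k * d).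
Proof.
move=> df; have := is_derive_mul (cst k) f x 0 d (is_derive_cst k x (1 : R)) df.
by have -> : 0 * f x + cst k x * d = k * d by rewrite /cst; ring.
Qed.

Lemma is_derive_comp f g x a b : is_derive x 1 g b -> is_derive (g x) 1 f a ->
  is_derive x 1 (fun t => f (g t)) (a * b).
Proof. by move=> dg df; exact: is_derive1_comp. Qed.

Lemma is_derive_exp f x a n : is_derive x 1 f a ->
  is_derive x 1 (fun t => f t ^+ n) (n%:R * f x ^+ n.-1 * a).
Proof.
move=> df; elim: n => [|n IHn]; first by rewrite !mul0r; exact: is_derive_cst.
have := is_derive_mul _ _ _ _ _ df IHn.
rewrite (_ : (fun t => _) = (fun t => f t ^+ n.+1)); last first.
  by apply/funext => t; rewrite exprS.
move=> /is_derive_eq; apply.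
case: n {IHn} => [|n] /=; first by rewrite !expr0; ring.
by rewrite -[n.+2%:R]natr1 [f x ^+ n.+1]exprS; ring.
Qed.

Lemma is_derive_shift s u x (d : R) : is_derive (x + s) 1 u d ->
  is_derive x 1 (fun t => u (t + s)) d.
Proof.
move=> /is_deriveP H; apply/is_deriveP => e /H[r r0 {}H]; exists r => // h h0 hr.
by rewrite addrAC; exact: H.
Qed.

Lemma derivable_continuous f : (forall x, derivable f x 1) -> continuous f.
Proof. by move=> df x; apply/differentiable_continuous/derivable1_diffP. Qed.

(** The continuity of [f] gives the derivative at every point, instead of almost
    everywhere as in [ae_derive_primitive]. *)
Lemma is_derive_primitive f F : continuous f ->
  (forall x y, x <= y -> F y - F x = \int[mu]_(t in `[x, y]) f t) ->
  forall x, is_derive x 1 F (f x).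
Proof.
move=> cf FE x; apply/is_deriveP => e e0.
have /cvgrPdist_le/(_ _ e0)[r /= r0 H] := cf x.
have lf := locint_cont _ cf.
have lc := @locint_cst R.
have B a b : a <= b -> (forall t, a <= t <= b -> `|f x - f t| <= e) ->
    `|F b - F a - f x * (b - a)| <= e * (b - a).
  move=> ab He; rewrite FE// -int_cst// -(intB f (fun=> f x))//.
  apply: (int_norm_le (fun t => f t - f x) a b e _ ab).
    exact: (locintB f (fun=> f x)).
  by move=> t /He; rewrite distrC.
exists r => // h h0 hr; have nh0 : 0 < `|h| by rewrite normr_gt0.
have -> : (F (x + h) - F x) / h - f x = (F (x + h) - F x - f x * h) / h.
  by rewrite [RHS]mulrBl mulfK.
rewrite normrM normfV ler_pdivrMr//.
have [hp|hn] := leP 0 h.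
  have := B x (x + h); rewrite (_ : x + h - x = h) ?(ger0_norm hp); last by ring.
  apply.
    by rewrite lerDl.
  move=> t /andP[xt th]; apply: H; rewrite /ball_/= ltr_norml.
  by move: hr; rewrite ger0_norm// => hr; apply/andP; split; lra.
have := B (x + h) x; rewrite (_ : x - (x + h) = - h) ?(ltr0_norm hn); last by ring.
have -> : F x - F (x + h) - f x * - h = - (F (x + h) - F x - f x * h) by lra.
rewrite normrN; apply; first by rewrite gerDl ltW.
move=> t /andP[xt th]; apply: H; rewrite /ball_/= ltr_norml.
by move: hr; rewrite ltr0_norm// => hr; apply/andP; split; lra.
Qed.

Lemma nondecreasing_is_derive (f : R -> R) x (d : R) : (forall y z, y <= z -> f y <= f z) ->
  is_derive x 1 f d -> 0 <= d.
Proof.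
move=> fnd /is_deriveP df; apply/ler_addgt0Pr => e e0.
have [r r0 /(_ (r / 2))] := df e e0.
have r20 : 0 < r / 2 by rewrite divr_gt0.
have rn : r / 2 != 0 by rewrite gt_eqF.
have rr : `|r / 2| < r by rewrite gtr0_norm//; lra.
move=> /(_ rn rr).
have : 0 <= (f (x + r / 2) - f x) / (r / 2).
  by rewrite divr_ge0 ?(ltW r20)// subr_ge0 fnd// lerDl ltW.
move: (_ / _) => q q0; rewrite ler_norml => /andP[_]; lra.
Qed.

Lemma le_norm_is_derive f g x (p q : R) : is_derive x 1 f p -> is_derive x 1 g q ->
  (forall y, `|f y - f x| <= `|g y - g x|) -> `|p| <= `|q|.
Proof.
move=> /is_deriveP df /is_deriveP dg fg.
apply/ler_addgt0Pr => e e0.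
have e20 : 0 < e / 2 by rewrite divr_gt0.
have [r r0 Hf] := df _ e20; have [s s0 Hg] := dg _ e20.
pose h := Num.min r s / 2.
have m0 : 0 < Num.min r s by rewrite lt_min r0.
have h0 : h != 0 by rewrite gt_eqF// divr_gt0.
have hm : `|h| < Num.min r s by rewrite /h gtr0_norm ?divr_gt0//; lra.
move: hm; rewrite lt_min => /andP[/(Hf _ h0) {}Hf /(Hg _ h0) {}Hg].
have : `|(f (x + h) - f x) / h| <= `|(g (x + h) - g x) / h|.
  by rewrite !normrM ler_wpM2r.
move: (_ / h) ((g _ - _) / h) Hf Hg => A B HA HB AB.
have -> : p = A - (A - p) by ring.
have : `|B| <= `|q| + e / 2.
  have -> : B = q + (B - q) by ring.
  by rewrite (le_trans (ler_normD _ _))// lerD2l.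
by have := ler_normB A (A - p); lra.
Qed.

Lemma C1_local_lip (f df : R -> R) (M : R) : (forall t, is_derive t 1 f (df t)) ->
  continuous df -> exists2 C : R, 0 <= C & forall p q, `|p| <= M -> `|q| <= M ->
    `|f p - f q| <= C * `|p - q|.
Proof.
move=> fdf cdf; have cf : continuous f.
  by apply: derivable_continuous => t; have [] := fdf t.
have [C C0 HC] := continuous_bounded df M cdf; exists C => //.
suff H p q : p < q -> `|p| <= M -> `|q| <= M -> `|f p - f q| <= C * `|p - q|.
  move=> p q; have [pq|qp|->] := ltgtP p q => pM qM; first exact: H.
    by rewrite distrC [`|p - q|]distrC; exact: H.
  by rewrite !subrr normr0 mulr0.
move=> pq; rewrite ler_norml => /andP[pM _]; rewrite ler_norml => /andP[_ qM].
rewrite distrC [`|p - q|]distrC.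
have [z] := MVT pq (fun z _ => fdf z) (continuous_subspaceT cf).
rewrite in_itv/= => /andP[pz zq] ->.
rewrite normrM ler_wpM2r//; apply: HC; rewrite ler_norml; apply/andP; split.
  exact: le_trans pM (ltW pz).
exact: le_trans (ltW zq) qM.
Qed.

Lemma C1_lip f (df : R -> R) M : (forall x, is_derive x 1 f (df x)) ->
  (forall x, `|df x| <= M) -> lip M f.
Proof.
move=> fdf dfM.
have cf : continuous f.
  by apply: derivable_continuous => x; have [] := fdf x.
suff H x y : x < y -> `|f x - f y| <= M * `|x - y|.
  move=> x y; have [xy|yx|->] := ltgtP x y; first exact: H.
    by rewrite distrC [`|x - y|]distrC; exact: H.
  by rewrite !subrr normr0 mulr0.
move=> xy; rewrite distrC [`|x - y|]distrC.
have [c _ ->] := MVT xy (fun z _ => fdf z) (continuous_subspaceT cf).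
by rewrite normrM ler_wpM2r.
Qed.

Lemma difference_quotient (f : R -> R) x (d k : R) : is_derive x 1 f d ->
  (f (x + n.+1%:R^-1 * k) - f x) / n.+1%:R^-1 @[n --> \oo] --> d * k.
Proof.
move=> /is_deriveP df; have [->|k0] := eqVneq k 0.
  by apply: cvg_near_cst; apply: nearW => n; rewrite !mulr0 addr0 subrr mul0r.
suff H (e : R) : 0 < e ->
    \forall n \near \oo, `|d * k - (f (x + n.+1%:R^-1 * k) - f x) / n.+1%:R^-1| < e.
  by apply/cvgrPdist_lt => e; exact: H.
move=> e0; have k1 : 0 < `|k| by rewrite normr_gt0.
have ek0 : 0 < e / 2 / `|k| by rewrite !divr_gt0.
have [r r0 Hr] := df _ ek0.
have rk0 : 0 < r / `|k| by rewrite divr_gt0.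
have [N _ HN] := near_infty_natSinv_lt (PosNum rk0).
exists N => // n /= /HN /=; rewrite ltr_pdivlMr// => nr.
have n0 : 0 < n.+1%:R^-1 :> R by rewrite invr_gt0 ltr0n.
have nk0 : n.+1%:R^-1 * k != 0 by rewrite mulf_neq0// (gt_eqF n0).
have := Hr _ nk0.
rewrite normrM (gtr0_norm n0) => /(_ nr) H.
rewrite distrC.
have E (z y : R) : z != 0 -> y / z - d * k = (y / (z * k) - d) * k.
  by move=> z0; field; rewrite k0.
rewrite E ?gt_eqF//.
rewrite normrM (le_lt_trans (ler_wpM2r (ltW k1) H))// divfK ?gt_eqF//.
by rewrite ltr_pdivrMr//; lra.
Qed.

(** A primitive of [f] is constant on the interval, so its derivative vanishes. *)
Lemma int_ge0_le0_ae f x y : locint f -> (forall t, x <= t <= y -> 0 <= f t) ->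
  \int[mu]_(t in `[x, y]) f t <= 0 -> {ae mu, forall t, x <= t <= y -> f t = 0}.
Proof.
move=> lf f0 If; have [F HF] := ex_primitive _ lf.
have F0 p q : x <= p -> p <= q -> q <= y -> F p = F q.
  move=> xp pq qy; apply/esym/eqP; rewrite -subr_eq0 HF//.
  have int0 z z' : x <= z -> z' <= y -> 0 <= \int[mu]_(t in `[z, z']) f t.
    move=> xz zy; apply: int_ge0 => t /andP[zt tz]; apply: f0.
    by rewrite (le_trans xz zt) (le_trans tz zy).
  have := If; rewrite (int_add _ x p y lf xp (le_trans pq qy)) (int_add _ p q y lf pq qy).
  have := int0 x p (lexx _) (le_trans pq qy); have := int0 p q xp qy.
  have := int0 q y (le_trans xp pq) (lexx _).
  by move=> ? ? ? ?; apply/eqP; lra.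
apply: (aeS _ _ (aeI _ _ (ae_derive_primitive _ _ lf HF) (aeI _ _ (ae_neq x) (ae_neq y)))).
move=> t [dF [tx ty]] /andP[xt ty'].
have {}xt : x < t by rewrite lt_neqAle eq_sym tx.
have {}ty : t < y by rewrite lt_neqAle ty.
rewrite -(derE _ _ _ dF) (near_der _ (cst (F t))).
  exact: (derE _ _ _ (is_derive_cst (F t : R) t (1 : R))).
near=> s.
have xs : x < s by near: s; exact: lt_nbhsr.
have sy : s < y by near: s; exact: lt_nbhsl.
have [st|ts] := leP s t; first by apply: F0 => //; exact: ltW.
by apply/esym/F0; exact: ltW.
Unshelve. all: by end_near. Qed.

End differentiation.

(** * A smooth step *)

Section smooth_step.
Context {R : realType}.
Local Notation mu := (@completed_lebesgue_measure R).
Implicit Types (f g : R -> R) (t x : R).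

Definition smooth f := forall n x, derivable (derive1n n f) x 1.

Lemma smooth_closed (S : set (R -> R)) :
  (forall f, S f -> exists2 g, S g & forall x, is_derive x 1 f (g x)) ->
  forall f, S f -> smooth f.
Proof.
move=> SP f Sf; have Sn n : S (derive1n n f).
  elim: n => [|n /SP[g Sg dg]]; first by rewrite derive1n0.
  rewrite derive1nS (_ : derive1 _ = g)//; apply/funext => x.
  by rewrite derive1E; case: (dg x).
by move=> n x; have [g _ dg] := SP _ (Sn n); have [] := dg x.
Qed.

Let q t := t * (1 - t).

(** This family is stable under differentiation, see [is_derive_bump], whence the
    smoothness of all its members. The usual bump function on [(0, 1)] is [bump 1 0]. *)
Definition bump (P : {poly R}) (k : nat) t : R :=
  if 0 < t < 1 then P.[t] * (q t)^-1 ^+ k * expR (- (q t)^-1) else 0.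

Definition dbump (P : {poly R}) (k : nat) : {poly R} :=
  let Q := 'X * (1 - 'X) in
  P^`() * Q ^+ 2 - k%:R *: (P * Q^`() * Q) + P * Q^`().

Let q_gt0 t : 0 < t < 1 -> 0 < q t.
Proof. by move=> /andP[t0 t1]; rewrite mulr_gt0// subr_gt0. Qed.

(** The exponential decays faster than any power of [q]; the quadratic decay suffices for
    the derivative to vanish outside of [(0, 1)], end points included. *)
Lemma bump_quadratic P k : exists2 C : R, 0 <= C &
  forall t x, ~~ (0 < x < 1) -> `|bump P k t| <= C * `|t - x| ^+ 2.
Proof.
have cK : compact (horner P @` `[(0:R), 1]).
  apply: continuous_compact; last exact: segment_compact.
  by apply: continuous_subspaceT => x; exact: continuous_horner.
have [M [_ HM]] := compact_bounded cK.
pose M1 : R := `|M| + 1; have M10 : 0 <= M1 by rewrite addr_ge0.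
have PM t : 0 < t < 1 -> `|P.[t]| <= M1.
  move=> /andP[t0 t1]; apply: (HM M1).
    by rewrite (le_lt_trans (ler_norm _))// ltrDl.
  by exists t => //; rewrite /= in_itv/= !ltW.
exists (M1 * (k.+2)`!%:R) => [|t x nx]; first by rewrite mulr_ge0.
rewrite /bump; case: ifPn => t01; last first.
  by rewrite normr0 !mulr_ge0// exprn_ge0.
have q0 := q_gt0 t t01.
have qtx : q t <= `|t - x|.
  have /andP[t0 t1] := t01; move: nx; rewrite negb_and -!leNgt => /orP[x0|x1].
    rewrite (le_trans _ (ler_norm _))// /q; nra.
  rewrite distrC (le_trans _ (ler_norm _))// /q; nra.
rewrite !normrM (ger0_norm (expR_ge0 _)) (ger0_norm (_ : 0 <= (q t)^-1 ^+ k)); last first.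
  by rewrite exprn_ge0// invr_ge0 ltW.
have eq2 : (q t)^-1 ^+ k * expR (- (q t)^-1) <= (k.+2)`!%:R * q t ^+ 2.
  have := @expR_ge1Dxn _ (q t)^-1 k.+1; rewrite invr_ge0 ltW// => /(_ isT) H.
  rewrite expRN ler_pdivrMr ?expR_gt0//.
  have : (q t)^-1 ^+ k.+2 / (k.+2)`!%:R <= expR (q t)^-1 by lra.
  rewrite ler_pdivrMr ?ltr0n ?fact_gt0// => H2.
  have -> : (q t)^-1 ^+ k = (q t)^-1 ^+ k.+2 * q t ^+ 2.
    by rewrite -addn2 exprD -mulrA -exprMn mulVf ?expr1n ?mulr1// gt_eqF.
  have q2 : 0 <= q t ^+ 2 by rewrite exprn_ge0// ltW.
  by rewrite [leRHS]mulrAC ler_wpM2r// mulrC.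
rewrite -mulrA -[leRHS]mulrA; apply: ler_pM => //.
- by rewrite mulr_ge0 ?expR_ge0// exprn_ge0// invr_ge0 ltW.
- exact: PM.
- rewrite (le_trans eq2)// ler_wpM2l// ler_pXn2r// ?nnegrE ?ltW//.
Qed.

Lemma is_derive_bump P k x :
  is_derive x 1 (bump P k) (bump (dbump P k) k.+2 x).
Proof.
have [x01|x01] := boolP (0 < x < 1); last first.
  rewrite {2}/bump (negbTE x01); apply/is_deriveP => e e0.
  have [C C0 HC] := bump_quadratic P k.
  have C10 : 0 < C + 1 by rewrite ltr_pwDr.
  exists (e / (C + 1)); first by rewrite divr_gt0.
  move=> h h0 hr; rewrite {2}/bump (negbTE x01) !subr0 normrM normfV.
  rewrite ler_pdivrMr ?normr_gt0//.
  rewrite (le_trans (HC _ x x01))// addrAC subrr add0r expr2 mulrA.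
  rewrite ler_wpM2r//.
  have : `|h| * (C + 1) <= e by rewrite -ler_pdivlMr// ltW.
  by have := normr_ge0 h; nra.
have q0 := q_gt0 x x01; have /andP[x0 x1] := x01.
apply: (near_eq_is_derive
  (f := fun t => P.[t] * (q t)^-1 ^+ k * expR (- (q t)^-1))).
  near=> t; rewrite /bump ifT//; apply/andP; split; near: t;
    [exact: lt_nbhsr|exact: lt_nbhsl].
pose Q : {poly R} := 'X * (1 - 'X).
have QE t : q t = Q.[t] by rewrite /Q !hornerE.
have dq : is_derive x 1 q Q^`().[x].
  by rewrite (_ : q = horner Q); [exact: is_derive_poly|apply/funext].
have qn0 : q x != 0 by rewrite gt_eqF.
have dqV : is_derive x 1 (fun t => (q t)^-1) (- (q x)^-1 ^+ 2 * Q^`().[x]).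
  apply: is_derive_eq (is_deriveV qn0 dq) _.
  by rewrite exprVn [_ *: _]/(_ * _) -exprVn.
have dE : is_derive x 1 (fun t => expR (- (q t)^-1))
    (expR (- (q x)^-1) * ((q x)^-1 ^+ 2 * Q^`().[x])).
  have dN : is_derive x 1 (fun t => - (q t)^-1) ((q x)^-1 ^+ 2 * Q^`().[x]).
    by rewrite -[_ * _]opprK -mulNr; exact: is_deriveN.
  exact: (is_derive_comp _ _ _ _ _ dN (is_derive_expR _)).
have dqk : is_derive x 1 (fun t => (q t)^-1 ^+ k)
    (- (k%:R * (q x)^-1 ^+ k.+1 * Q^`().[x])).
  apply: is_derive_eq (is_derive_exp _ _ _ k dqV) _.
  case: (k) => [|j] /=; first by rewrite !mul0r oppr0.
  by move: (q x)^-1 (Q^`().[x]) => r d; rewrite -[j.+2]addn2 exprD; ring.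
apply: (is_derive_eq (is_derive_mul _ _ _ _ _
  (is_derive_mul _ _ _ _ _ (is_derive_poly P x) dqk) dE)).
rewrite /bump x01 /dbump -/Q; clearbody Q.
rewrite !(hornerD, hornerN, hornerZ, hornerM, horner_exp) -QE.
rewrite -[k.+2]addn2 exprD exprS !exprVn.
move: (q x) qn0 (Q^`().[x]) (expR _) => r r0 d E.
have rk0 : r ^+ k != 0 by rewrite expf_neq0.
by move: (r ^+ k) rk0 => A A0; field; rewrite r0 A0.
Unshelve. all: by end_near. Qed.

Lemma smooth_bump P k : smooth (bump P k).
Proof.
apply: (@smooth_closed [set f | exists P k, f = bump P k]); last by exists P, k.
move=> _ [P' [k' ->]]; exists (bump (dbump P' k') k'.+2); first by exists (dbump P' k'), k'.+2.
exact: is_derive_bump.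
Qed.

Lemma smooth_primitive f g : smooth g -> (forall x, is_derive x 1 f (g x)) -> smooth f.
Proof.
move=> sg fg; have dE : derive1 f = g.
  by apply/funext => x; rewrite derive1E; have [] := fg x.
move=> [|n] x; first by rewrite derive1n0; have [] := fg x.
suff -> : derive1n n.+1 f = derive1n n g by exact: sg.
by rewrite /derive1n iterSr dE.
Qed.

(** [S] is the primitive of [bump 1 0], normalized to have total increment 1. *)
Lemma ex_smooth_step : exists S s : R -> R, [/\ smooth S /\ continuous s,
  forall x, is_derive x 1 S (s x), forall x, 0 <= s x /\ (~~ (0 < x < 1) -> s x = 0),
  forall x, x <= 0 -> S x = 0 & forall x, 1 <= x -> S x = 1].
Proof.
pose s0 := bump 1 0.
have cs0 : continuous s0.
  by apply: derivable_continuous => x; have [] := is_derive_bump 1 0 x.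
have ls0 := locint_cont _ cs0.
have s00 x : 0 <= s0 x.
  rewrite /s0 /bump; case: ifP => // _.
  by rewrite hornerC expr0 !mul1r expR_ge0.
have s0z x : ~~ (0 < x < 1) -> s0 x = 0 by rewrite /s0 /bump => /negbTE ->.
have [S0 S0E] := ex_primitive _ ls0.
have dS0 := is_derive_primitive _ _ cs0 S0E.
have S0l x : x <= 0 -> S0 x = S0 0.
  move=> x0; apply/eqP; rewrite eq_sym -subr_eq0 S0E//.
  rewrite (int_ae s0 (fun=> 0))//; first by rewrite int_cst// mul0r.
    by apply: aeT => t /andP[_ t0]; apply: s0z; rewrite negb_and -!leNgt t0.
  exact: leb_measurable_cst.
have S0r x : 1 <= x -> S0 x = S0 1.
  move=> x0; apply/eqP; rewrite -subr_eq0 S0E//.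
  rewrite (int_ae s0 (fun=> 0))//; first by rewrite int_cst// mul0r.
    by apply: aeT => t /andP[t0 _]; apply: s0z; rewrite negb_and -!leNgt t0 orbT.
  exact: leb_measurable_cst.
have m0 : 0 < S0 1 - S0 0.
  have [c0 c1] : exists2 c : R, 0 < c & forall t, 4^-1 <= t <= 3 / 4 -> c <= s0 t.
    exists (expR (- 16)); first exact: expR_gt0.
    move=> t /andP[t1 t2]; rewrite /s0 /bump ifT; last by apply/andP; split; lra.
    rewrite hornerC expr0 !mul1r ler_expR lerN2 -[leRHS]invrK lef_pV2 ?posrE//.
      by rewrite /q; nra.
    by rewrite /q; nra.
  move=> c1t.
  have -> : S0 1 - S0 0 = (S0 4^-1 - S0 0) + (S0 (3 / 4) - S0 4^-1) + (S0 1 - S0 (3/4)).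
    by lra.
  rewrite !S0E; [|lra..].
  have i1 : 0 <= \int[mu]_(t in `[0, 4^-1]) s0 t by apply: int_ge0.
  have i2 : 0 <= \int[mu]_(t in `[3/4, 1]) s0 t by apply: int_ge0.
  have : c0 * (3 / 4 - 4^-1) <= \int[mu]_(t in `[4^-1, 3 / 4]) s0 t.
    rewrite -int_cst; last by lra.
    by apply: int_le => //; exact: locint_cst.
  nra.
pose m := S0 1 - S0 0.
exists (fun x => (S0 x - S0 0) * m^-1), (fun x => s0 x * m^-1).
have dS x : is_derive x 1 (fun x => (S0 x - S0 0) * m^-1) (s0 x * m^-1).
  apply: is_derive_eq (is_derive_mul _ _ _ _ _ (is_derive_sub _ _ _ _ _ (dS0 x)
    (is_derive_cst (S0 0) x 1)) (is_derive_cst m^-1 x 1)) _.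
  by rewrite subr0 mulr0 addr0.
split => //.
- split; last by move=> x; apply: cvgM; [exact: cs0|exact: cvg_cst].
  apply: smooth_primitive dS.
  have -> : (fun x => s0 x * m^-1) = bump (m^-1)%:P 0.
    apply/funext => x; rewrite /s0 /bump; case: ifP => _; last by rewrite mul0r.
    by rewrite !hornerC expr0 !mulr1 mul1r mulrC.
  exact: smooth_bump.
- move=> x; split; first by rewrite mulr_ge0 ?s00// invr_ge0 ltW.
  by move/s0z => ->; rewrite mul0r.
- by move=> x /S0l ->; rewrite subrr mul0r.
- by move=> x /S0r ->; rewrite mulfV// gt_eqF.
Qed.

End smooth_step.

(** * Calculus of Lipschitz functions *)

Section lipschitz_calculus.
Context {R : realType}.
Local Notation mu := (@completed_lebesgue_measure R).
Implicit Types (f g u v e : R -> R) (x y z t s : R).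

Lemma lipD (L M : R) f g : lip L f -> lip M g -> lip (L + M) (fun t => f t + g t).
Proof.
move=> Lf Mg x y; rewrite opprD addrACA (le_trans (ler_normD _ _))// mulrDl.
by rewrite lerD.
Qed.

Lemma lipZ (L k : R) f : lip L f -> lip (`|k| * L) (fun t => k * f t).
Proof. by move=> Lf x y; rewrite -mulrBr normrM -mulrA ler_wpM2l. Qed.

Lemma lipM (L M A B : R) f g : lip L f -> lip M g ->
  (forall t, `|f t| <= A) -> (forall t, `|g t| <= B) ->
  lip (L * B + A * M) (fun t => f t * g t).
Proof.
move=> Lf Mg fA gB x y.
have -> : f x * g x - f y * g y = (f x - f y) * g x + f y * (g x - g y) by ring.
rewrite (le_trans (ler_normD _ _))// !normrM mulrDl lerD//.
  by rewrite mulrAC ler_pM.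
by rewrite -mulrA ler_pM.
Qed.

Lemma lip_comp (L M : R) f g : lip L f -> lip M g -> lip (L * M) (f \o g).
Proof.
move=> Lf Mg x y; rewrite (le_trans (Lf _ _))// -mulrA ler_wpM2l//.
exact: lip_ge0 Lf.
Qed.

Definition clamp x y t : R := Num.max x (Num.min y t).

Lemma lip_clamp x y : lip 1 (clamp x y).
Proof.
have H s t : s <= t -> clamp x y s <= clamp x y t <= clamp x y s + (t - s).
  move=> st; rewrite /clamp /Num.max /Num.min; apply/andP.
  by case: (ltP y s) => ?; case: (ltP y t) => ?; do ?[case: ltP => ?]; split; lra.
move=> s t; rewrite mul1r; have [st|/ltW st] := leP s t.
  have /andP[? ?] := H s t st; rewrite !ler0_norm ?subr_le0//; lra.
have /andP[? ?] := H t s st; rewrite !ger0_norm ?subr_ge0//; lra.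
Qed.

Lemma clampE x y t : x <= t <= y -> clamp x y t = t.
Proof.
by move=> /andP[xt ty]; rewrite /clamp (min_idPr ty) (max_idPr xt).
Qed.

Lemma clamp_itv x y t : x <= y -> x <= clamp x y t <= y.
Proof. by move=> xy; rewrite /clamp le_max lexx/= ge_max xy ge_min lexx. Qed.

(** The product rule and [int_der] for the product of the two functions, first made
    constant outside of the interval, since the product of unbounded Lipschitz functions
    need not be Lipschitz. *)
Lemma int_by_parts (L M : R) f g x y : lip L f -> lip M g -> x <= y ->
  \int[mu]_(t in `[x, y]) (der f t * g t + f t * der g t) =
    f y * g y - f x * g x.
Proof.
move=> Lf Mg xy; pose c := clamp x y.
have Lfc : lip (L * 1) (f \o c) by apply: lip_comp => //; exact: lip_clamp.
have Mgc : lip (M * 1) (g \o c) by apply: lip_comp => //; exact: lip_clamp.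
have bnd (h : R -> R) K : lip K h -> forall t, `|(h \o c) t| <= `|h x| + K * (y - x).
  move=> Kh t; have -> : (h \o c) t = h x - (h x - h (c t)) by rewrite /=; ring.
  rewrite (le_trans (ler_normB _ _))// lerD2l (le_trans (Kh _ _))//.
  rewrite ler_wpM2l ?(lip_ge0 _ _ Kh)//.
  have /andP[a b] := clamp_itv x y t xy.
  by rewrite ler0_norm; [rewrite /c; lra|rewrite subr_le0].
have Lfg := lipM _ _ _ _ _ _ Lfc Mgc (bnd f L Lf) (bnd g M Mg).
have := int_der _ _ _ _ Lfg xy; rewrite /= /c !clampE ?lexx ?xy//= => <-.
apply/esym/int_ae.
- exact: locint_der Lfg.
- have H := aeI _ _ (aeI _ _ (ae_neq x) (ae_neq y))
    (aeI _ _ (lip_ae_der _ _ Lf) (lip_ae_der _ _ Mg)).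
  apply: (aeS _ _ H) => t [[tx ty] [df dg]] /andP[xt ty'].
  have {}xt : x < t by rewrite lt_neqAle eq_sym tx.
  have {}ty : t < y by rewrite lt_neqAle ty.
  rewrite -(derE _ _ _ (is_derive_mul _ _ _ _ _ df dg)); apply: near_der.
  near=> s; rewrite /= clampE//; apply/andP; split; apply/ltW; near: s;
    [exact: lt_nbhsr|exact: lt_nbhsl].
- apply: measurable_funD; apply: measurable_funM.
  + exact: leb_measurable_der Lf.
  + exact: leb_measurable_cont (lip_continuous _ _ Mg).
  + exact: leb_measurable_cont (lip_continuous _ _ Lf).
  + exact: leb_measurable_der Mg.
Unshelve. all: by end_near. Qed.

Definition glue (tau : R) u v t : R := if t <= tau then u t else v t.

Lemma lip_glue (tau : R) u v : lip 1 u -> lip 1 v -> u tau = v tau -> lip 1 (glue tau u v).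
Proof.
move=> Lu Lv uv.
suff H x y : x <= y -> `|glue tau u v x - glue tau u v y| <= `|x - y|.
  move=> x y; rewrite mul1r; have [xy|/ltW xy] := leP x y; first exact: H.
  by rewrite distrC [`|x - y|]distrC; exact: H.
move=> xy; rewrite /glue; have [xt|tx] := leP x tau; have [yt|ty] := leP y tau.
- by have := Lu x y; rewrite mul1r.
- have -> : u x - v y = (u x - u tau) + (v tau - v y) by rewrite uv; ring.
  rewrite (le_trans (ler_normD _ _))//.
  have := Lu x tau; have := Lv tau y; rewrite !mul1r.
  have xt0 : x - tau <= 0 by rewrite subr_le0.
  have ty1 : tau - y <= 0 by rewrite subr_le0 ltW.
  have xy0 : x - y <= 0 by rewrite subr_le0.
  rewrite (ler0_norm xt0) (ler0_norm ty1) (ler0_norm xy0).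
  lra.
- by have := lt_le_trans tx xy; rewrite ltNge yt.
- by have := Lv x y; rewrite mul1r.
Qed.

Lemma der_glue_l (tau : R) u v t : t < tau -> der (glue tau u v) t = der u t.
Proof.
move=> tt; apply: near_der; near=> s; rewrite /glue ifT//.
by apply: ltW; near: s; exact: lt_nbhsl.
Unshelve. all: by end_near. Qed.

Lemma der_glue_r (tau : R) u v t : tau < t -> der (glue tau u v) t = der v t.
Proof.
move=> tt; apply: near_der; near=> s; rewrite /glue ifF//.
by apply/negbTE; rewrite -ltNge; near: s; exact: lt_nbhsr.
Unshelve. all: by end_near. Qed.

End lipschitz_calculus.

(** * Translations *)

Section translations.
Context {R : realType}.
Local Notation mu := (@completed_lebesgue_measure R).
Local Notation leb := (@lebesgue_measure R).
Local Notation BR := (measurableTypeR R).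
Implicit Types (f g u v e : R -> R) (x y z t s : R).

Lemma measurable_shift s : measurable_fun [set: BR] (fun t : BR => (t + s : BR)).
Proof.
apply: measurable_funD; first exact: measurable_id.
exact: measurable_cst.
Qed.

Lemma leb_shift s (A : set BR) : measurable A -> leb ((fun t => t + s) @^-1` A) = leb A.
Proof.
move=> mA; apply/esym.
have mm : measurable_fun [set: BR] (fun t : BR => (t + s : BR)) := measurable_shift s.
apply: (@lebesgue_measure_unique R (pushforward leb (fun t : BR => (t + s : BR)))) => //.
move=> X [[a b] _ <-] /=; rewrite /pushforward.
have -> : (fun t => t + s) @^-1` `]a, b] = `](a - s), (b - s)]%classic.
  by apply/seteqP; split => t /=; rewrite !in_itv/= ltrBlDr lerBrDr.
rewrite !lebesgue_measure_itv/= !lte_fin ltrD2r; case: ifP => // _.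
by congr EFin; ring.
Qed.

Lemma ae_shift s (P : R -> Prop) : {ae mu, forall t, P t} ->
  {ae mu, forall t, P (t + s)}.
Proof.
move=> /ae_leb[A [mA A0 PA]]; apply/ae_leb.
exists ((fun t => t + s) @^-1` A); split.
- by rewrite -[X in measurable X]setTI; exact: measurable_shift.
- by rewrite -[RHS]A0; exact: leb_shift.
- by move=> t /= Pt; exact: PA.
Qed.

Lemma leb_measurable_shift s f : lebesgue_measurable f ->
  lebesgue_measurable (fun t => f (t + s)).
Proof.
move=> /leb_ae_borel[g [mg fg _]].
apply: (leb_measurable_ae (fun t => g (t + s))).
  by apply: borel_fun_leb; apply: (measurableT_comp mg); exact: measurable_shift.
by apply: (aeS _ _ (ae_shift s _ fg)) => t ->.
Qed.

Lemma der_shift s u x : der (fun t => u (t + s)) x = der u (x + s).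
Proof.
have [d|nd] := pselect (derivable u (x + s) 1).
  by apply: derE; apply: is_derive_shift; exact: derivable_der.
have nd' : ~ derivable (fun t => u (t + s)) x 1.
  apply: contra_not nd => d; have := derivable_der _ _ d.
  rewrite -{1}[x](addrK s) => /(is_derive_shift (- s)).
  by rewrite (_ : (fun t => u (t - s + s)) = u); [case|apply/funext => t; rewrite subrK].
by rewrite (der_nderivable _ _ nd) (der_nderivable _ _ nd').
Qed.

Lemma lip_shift (L : R) s u : lip L u -> lip L (fun t => u (t + s)).
Proof. by move=> Lu x y; rewrite (le_trans (Lu _ _))// opprD addrACA subrr addr0. Qed.

(** By [int_der], as both sides are increments of a primitive of [f]. *)
Lemma int_shift s f (M : R) x y : lebesgue_measurable f -> (forall t, `|f t| <= M) ->
  x <= y -> \int[mu]_(t in `[x, y]) f (t + s) = \int[mu]_(t in `[x + s, y + s]) f t.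
Proof.
move=> mf fM xy; have lf : locint f by apply: locint_bd => // n; exists M => t _.
have [P PE] := ex_primitive _ lf.
have LP := lip_primitive _ _ _ lf fM PE.
rewrite -PE ?lerD2r// -(int_der _ _ _ _ (lip_shift _ s _ LP) xy).
apply/esym/int_ae.
- exact: locint_der (lip_shift _ s _ LP).
- apply: (aeS _ _ (ae_shift s _ (ae_derive_primitive _ _ lf PE))) => t dP _.
  by rewrite der_shift (derE _ _ _ dP).
- exact: leb_measurable_shift.
Qed.

End translations.

(** * Weak derivatives *)

Section weak_derivatives.
Context {R : realType}.
Local Notation mu := (@completed_lebesgue_measure R).
Implicit Types (f g u v e : R -> R) (x y z t s : R).

Lemma compact_itv (K : set R) : compact K -> exists n : nat,
  K `<=` `[(- n%:R : R), n%:R].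
Proof.
move=> /compact_bounded[M [_ HM]]; exists (Num.truncn `|M|).+1 => t Kt.
rewrite /= in_itv/= -ler_norml; apply: (HM _ _ t Kt).
by rewrite (le_lt_trans (ler_norm M))// truncnS_gt.
Qed.

Lemma locint_Lploc1 f : locint f <-> Lploc 1 f.
Proof.
split.
  move=> [mf fi] K cK; have [n Kn] := compact_itv K cK.
  have mK : measurable (K : set (Leb R)) by exact: borel_leb (compact_measurable cK).
  apply/Lfun1_integrable; rewrite -restrict_EFin -integrable_mkcond//.
  by apply: integrableS (fi (- n%:R) n%:R) => //; exact: leb_measurable_itv.
move=> H.
have iK x y : mu.-integrable setT (EFin \o f \_ `[x, y]).
  apply/Lfun1_integrable.
  exact: (H `[x, y]%classic (@segment_compact _ x y)).
have mf : lebesgue_measurable f.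
  apply: (@measurable_fun_cvg _ (Leb R) R setT (fun n => f \_ `[- n%:R, n%:R])).
    by move=> n; apply/measurable_EFinP; exact: measurable_int (iK _ _).
  move=> t _; apply: cvg_near_cst; near=> n.
  rewrite patchE ifT// inE /= in_itv/= -ler_norml.
  by apply: ltW; near: n; exact: nbhs_infty_gtr.
split => // x y; rewrite (integrable_mkcond _ (leb_measurable_itv _)).
by rewrite restrict_EFin; exact: iK.
Unshelve. all: by end_near. Qed.

Lemma Lploc2_bd f : lebesgue_measurable f ->
  (forall n : nat, exists M : R, forall t, `|t| <= n%:R -> `|f t| <= M) ->
  Lploc 2%:E f.
Proof.
move=> mf fM K cK; have [n Kn] := compact_itv K cK.
have mK : measurable (K : set (Leb R)) by exact: borel_leb (compact_measurable cK).
have [M HM] := fM n.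
have mfK : measurable_fun [set: Leb R] (f \_ K : Leb R -> R).
  apply/(measurable_restrictT _ mK); exact: measurable_funTS mf.
set g := f \_ K; have gM t : `|g t| <= `|M|.
  rewrite /g patchE; case: ifPn => [/set_mem Kt|_]; last by rewrite normr0.
  rewrite (le_trans _ (ler_norm M))// HM//.
  by have := Kn _ Kt; rewrite /= in_itv/= -ler_norml.
have mg2 : lebesgue_measurable (fun t => g t ^+ 2) by exact: measurable_funX.
have := integrable_itv_bd (fun t => g t ^+ 2) (- n%:R) n%:R (`|M| ^+ 2) mg2.
move=> /(_ (fun t _ => _)) H.
have {H} /integrableP[_] : mu.-integrable `[(- n%:R : R), n%:R]
    (EFin \o (fun t => g t ^+ 2)).
  by apply: H => t; rewrite normrX ler_pXn2r// ?nnegrE.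
move=> foo; rewrite /Lp inE /Lfun; apply/andP; split; first by rewrite inE.
rewrite inE /= /finite_norm unlock /=; apply: poweR_lty.
apply: le_lt_trans foo; rewrite [leRHS]integral_mkcond.
rewrite le_eqVlt; apply/orP; left; apply/eqP; apply: eq_integral => x _.
rewrite patchE /=; case: ifPn => [_|xn].
  by rewrite powR_mulrn// -normrX.
have -> : g x = 0.
  rewrite /g patchE; case: ifPn => // /set_mem/Kn xn'.
  by move/negP: xn; case; apply: mem_set.
by rewrite normr0 powR0// pnatr_eq0.
Qed.

Lemma test_functionP (phi : R -> R) : test_function phi -> exists (n : nat) (M : R),
  [/\ forall t, ~~ (- n%:R < t < n%:R) -> phi t = 0, lip M phi,
      forall t, is_derive t 1 phi (derive1 phi t),
      forall t, ~~ (- n%:R < t < n%:R) -> derive1 phi t = 0 &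
      continuous (derive1 phi)].
Proof.
move=> [sphi /compact_itv[n Kn]].
have supp t : n%:R < `|t| -> phi t = 0.
  move=> nt; apply/eqP; apply: contraPT nt => pt.
  have /Kn : closure [set x | phi x != 0] t by apply: subset_closure.
  by rewrite /= in_itv/= -ler_norml => tn; apply/negP; rewrite -leNgt.
have dphi t : is_derive t 1 phi (derive1 phi t).
  by rewrite derive1E; apply: derivableP; have := sphi 0%N t; rewrite derive1n0.
have cd : continuous (derive1 phi).
  by apply: derivable_continuous => t; have := sphi 1%N t; rewrite derive1n1.
have dsupp t : n%:R < `|t| -> derive1 phi t = 0.
  move=> nt; rewrite derive1E (near_eq_derive (g := cst 0)) ?derive_cst//.
  near=> s; apply: supp; near: s.
  by apply: (cvgr_norm_gt t); [exact: cvg_id|].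
have out t : ~~ (- n.+1%:R < t < n.+1%:R) -> n%:R < `|t| :> R.
  by rewrite -ltr_norml -leNgt; apply: lt_le_trans; rewrite ltr_nat.
have cK : compact (derive1 phi @` `[(- n%:R : R), n%:R]).
  apply: continuous_compact; last exact: segment_compact.
  exact: continuous_subspaceT.
have [M [_ HM]] := compact_bounded cK.
exists n.+1, (`|M| + 1); split => //.
- by move=> t /out/supp.
- apply: C1_lip dphi _ => t; have [nt|tn] := ltP n%:R `|t|.
    by rewrite dsupp// normr0 addr_ge0.
  apply: (HM (`|M| + 1)); first by rewrite (le_lt_trans (ler_norm _))// ltrDl.
  by exists t => //; rewrite /= in_itv/= -ler_norml.
- by move=> t /out/dsupp.
Unshelve. all: by end_near. Qed.

(** Integration by parts on an interval that contains the support of the test function. *)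
Lemma lip_weak_derivative (L : R) f g : lip L f ->
  {ae mu, forall t, der f t = g t} -> is_weak_derivative f g.
Proof.
move=> Lf fg; have lg := locint_ae _ _ (locint_der _ _ Lf) fg.
have cf := lip_continuous _ _ Lf.
split; [exact/locint_Lploc1/locint_cont|exact/locint_Lploc1|].
move=> phi /test_functionP[n [M [supp Lp dp dsupp cd]]].
have nn : - n%:R <= n%:R :> R by rewrite -subr_ge0 opprK -natrD.
have cp := lip_continuous _ _ Lp.
have out (a t : R) : ~~ (- a <= t <= a) -> ~~ (- a < t < a).
  by apply: contra => /andP[/ltW -> /ltW ->].
rewrite (int_support (fun t => f t * derive1 phi t) (- n%:R) n%:R); last first.
  by move=> t /out/dsupp ->; rewrite mulr0.
rewrite (int_support (fun t => g t * phi t) (- n%:R) n%:R); last first.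
  by move=> t /out/supp ->; rewrite mulr0.
have ld := locint_der _ _ Lf.
have <- : \int[mu]_(t in `[- n%:R, n%:R]) (der f t * phi t) =
    \int[mu]_(t in `[- n%:R, n%:R]) (g t * phi t).
  apply: int_ae; first exact: locintM_cont.
    by apply: (aeS _ _ fg) => t ->.
  by apply: measurable_funM; [exact: lg.1|exact: leb_measurable_cont].
have := int_by_parts _ _ _ _ _ _ Lf Lp nn.
rewrite (intD (fun t => der f t * phi t)); last 2 first.
- exact: locintM_cont.
- have := locintM_cont _ _ (locint_der _ _ Lp) cf.
  by congr locint; apply/funext => t; rewrite mulrC.
rewrite !supp ?mulr0 ?subr0 ?ltxx ?andbF//.
have -> : der phi = derive1 phi by apply/funext => t; exact: derE (dp t).
by move/eqP; rewrite addr_eq0 => /eqP ->; rewrite opprK.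
Qed.

Lemma seq_cvg_unique (a_ : R^nat) (l m : R) :
  a_ @ \oo --> l -> a_ @ \oo --> m -> l = m.
Proof. by move=> al am; exact: (cvg_unique (@Rhausdorff R) al am). Qed.

Lemma approximate_identity u (K : R -> R) x y z (r e : R) :
  continuous u -> continuous K -> (forall t, 0 <= K t) -> x <= y ->
  (forall t, ~~ (`|z - t| < r) -> K t = 0) ->
  (forall t, `|z - t| < r -> `|u z - u t| <= e) ->
  \int[mu]_(t in `[x, y]) K t = 1 ->
  `|u z - \int[mu]_(t in `[x, y]) (u t * K t)| <= e.
Proof.
move=> cu cK K0 xy Kr ur mass; have lK := locint_cont _ cK.
have luK : locint (fun t => u t * K t).
  by apply: locint_cont => t; apply: cvgM; [exact: cu|exact: cK].
have luzK : locint (fun t => u z * K t) := locintZ (u z) K lK.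
have leK : locint (fun t => e * K t) := locintZ e K lK.
have bd t : `|u z * K t - u t * K t| <= e * K t.
  rewrite -mulrBl normrM (ger0_norm (K0 t)).
  have [tr|/Kr ->] := boolP (`|z - t| < r); last by rewrite !mulr0.
  by rewrite ler_wpM2r// ur.
have -> : u z = \int[mu]_(t in `[x, y]) (u z * K t).
  by rewrite (intZ _ _ _ _ lK) mass mulr1.
rewrite -(intB _ _ _ _ luzK luK) -[leRHS]mulr1 -mass -(intZ _ _ _ _ lK).
have ld := locintB _ _ luzK luK.
rewrite ler_norml -mulN1r -(intZ _ _ _ _ leK); apply/andP; split.
  apply: (int_le _ _ _ _ (locintZ (-1) _ leK) ld) => t _.
  by have := bd t; rewrite ler_norml /= mulN1r => /andP[].
apply: (int_le _ _ _ _ ld leK) => t _.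
by have := bd t; rewrite ler_norml => /andP[].
Qed.

(** Tested against [S(k (t - x)) - S(k (t - y))], where [S] is a smooth step,
    the definition of the weak derivative becomes in the limit of large [k] the
    fundamental theorem of calculus on [x, y]. *)
Lemma weak_derivative_int u g : continuous u -> is_weak_derivative u g ->
  locint g /\ forall x y, x <= y -> u y - u x = \int[mu]_(t in `[x, y]) g t.
Proof.
move=> cu [_ /locint_Lploc1 lg H]; split => // x y.
rewrite le_eqVlt => /predU1P[->|xy]; first by rewrite subrr int_xx.
have [S [s [[sS cs] dS s0 S0 S1]]] := @ex_smooth_step R.
have cS : continuous S by apply: derivable_continuous => t; have [] := dS t.
pose k (n : nat) : R := n.+1%:R.
have k0 n : 0 < k n by rewrite ltr0n.
have dSk n z t : is_derive t 1 (fun t => S (k n * (t - z))) (k n * s (k n * (t - z))).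
  have d1 : is_derive t 1 (fun t => k n * (t - z)) (k n).
    apply: is_derive_eq (is_derive_mul _ _ _ _ _ (is_derive_cst (k n) t 1)
      (is_derive_sub _ _ _ _ _ (is_derive_id t 1) (is_derive_cst z t 1))) _.
    by rewrite mul0r add0r subr0 mulr1.
  by rewrite mulrC; exact: (is_derive_comp S _ _ _ _ d1 (dS _)).
pose phi n t := S (k n * (t - x)) - S (k n * (t - y)).
pose dphi n t := k n * s (k n * (t - x)) - k n * s (k n * (t - y)).
have dphiE n t : is_derive t 1 (phi n) (dphi n t) by apply: is_derive_sub; exact: dSk.
have k1 n : (k n)^-1 <= 1 by rewrite invf_le1// ler1n.
have knk n z : z + (k n)^-1 <= z + 1 by rewrite lerD2l.
have out n t : ~~ (x <= t <= y + 1) -> phi n t = 0.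
  rewrite /phi negb_and -!ltNge => /orP[tx|yt].
    by rewrite !S0 ?subrr// pmulr_rle0// subr_le0 ltW// (lt_trans tx).
  have kt z : z <= y -> 1 <= k n * (t - z).
    by move=> zy; rewrite -ler_pdivrMl// mulr1 (le_trans (k1 n))//; lra.
  by rewrite !S1 ?subrr// kt// ltW.
have tphi n : test_function (phi n).
  split; last first.
    apply: (subclosed_compact _ (@segment_compact _ x (y + 1))).
      exact: closed_closure.
    rewrite [X in _ `<=` X](closure_id _).1; last exact: interval_closed.
    apply: closure_subset => t /eqP pt; rewrite /= in_itv/=.
    by apply: contrapT => /negP/(out n).
  pose F := [set f : R -> R | exists (c : R) h, smooth h /\
    f = fun t => c * (h (k n * (t - x)) - h (k n * (t - y)))].
  apply: (@smooth_closed _ F); last first.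
    by exists 1, S; split => //; apply/funext => t; rewrite mul1r.
  move=> _ [c [h [sh ->]]].
  have dh t : is_derive t 1 h (derive1 h t).
    by rewrite derive1E; apply: derivableP; have := sh 0%N t; rewrite derive1n0.
  exists (fun t => (c * k n) * (derive1 h (k n * (t - x)) - derive1 h (k n * (t - y)))).
    exists (c * k n), (derive1 h); split; last exact: erefl.
    by move=> m t; have := sh m.+1 t; rewrite /derive1n iterSr.
  move=> t; have d1 z : is_derive t 1 (fun t => k n * (t - z)) (k n).
    apply: is_derive_eq (is_derive_mul _ _ _ _ _ (is_derive_cst (k n) t 1)
      (is_derive_sub _ _ _ _ _ (is_derive_id t 1) (is_derive_cst z t 1))) _.
    by rewrite mul0r add0r subr0 mulr1.
  have d2 z := is_derive_comp h _ _ _ _ (d1 z) (dh _).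
  apply: is_derive_eq (is_derive_mul _ _ _ _ _ (is_derive_cst c t 1)
      (is_derive_sub _ _ _ _ _ (d2 x) (d2 y))) _.
  by rewrite mul0r add0r -mulrBl -mulrA; congr (_ * _); rewrite mulrC.
have csk n z : continuous (fun t => k n * s (k n * (t - z))).
  move=> t; apply: cvgM; first exact: cvg_cst.
  apply: (@continuous_comp _ _ _ (fun t => k n * (t - z)) s); last exact: cs.
  by apply: cvgM; [exact: cvg_cst|apply: cvgB; [exact: cvg_id|exact: cvg_cst]].
have usk n z : locint (fun t => u t * (k n * s (k n * (t - z)))).
  by apply: locint_cont => t; apply: cvgM; [exact: cu|exact: csk].
(* [k s (k (t - z))] has mass 1, concentrated at [z] as [k] grows *)
have conc z : x <= z <= y -> (fun n => \int[mu]_(t in `[x, y + 1])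
    (u t * (k n * s (k n * (t - z))))) @ \oo --> u z.
  move=> /andP[xz zy]; apply/cvgrPdist_le => e e0.
  have /cvgrPdist_le/(_ _ e0)[r /= r0 Hr] := cu z.
  near=> n.
  have zn : z <= z + (k n)^-1 by rewrite lerDl invr_ge0 ltW.
  have mass : \int[mu]_(t in `[x, y + 1]) (k n * s (k n * (t - z))) = 1.
    have [P PE] := ex_primitive _ (locint_cont _ (csk n z)).
    have dP := is_derive_primitive _ _ (csk n z) PE.
    rewrite -PE; last by lra.
    have xy1 : x < y + 1 by lra.
    pose D t := P t - S (k n * (t - z)).
    have dD t : is_derive t 1 D 0.
      by rewrite -[0](subrr (k n * s (k n * (t - z)))); exact: is_derive_sub.
    have cD : continuous D by apply: derivable_continuous => t; have [] := dD t.
    have [c _] := MVT xy1 (fun t _ => dD t) (continuous_subspaceT cD).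
    rewrite mul0r /D (S0 (k n * (x - z))); last by rewrite pmulr_rle0// subr_le0.
    rewrite S1; first by move/eqP; rewrite subr0 => /eqP; lra.
    by rewrite -ler_pdivrMl// mulr1 (le_trans (k1 n))//; lra.
  apply: (approximate_identity _ _ _ _ _ r e cu (csk n z)) => //.
  - by move=> t; have [ss0 _] := s0 (k n * (t - z)); rewrite mulr_ge0// ltW.
  - by rewrite (le_trans (ltW xy))// lerDl.
  - move=> t tr; have [_ ->] := s0 (k n * (t - z)); rewrite ?mulr0//.
    apply: contra tr => /andP[]; rewrite pmulr_rgt0// -ltr_pdivlMl// mulr1 subr_gt0.
    move=> zt tz; rewrite distrC gtr0_norm ?subr_gt0//; apply: lt_trans tz _.
    by near: n; exact: near_infty_natSinv_lt (PosNum r0).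
have lhs : (fun n => \int[mu]_t (u t * derive1 (phi n) t)) @ \oo --> u x - u y.
  have -> : (fun n => \int[mu]_t (u t * derive1 (phi n) t)) = (fun n =>
     \int[mu]_(t in `[x, y + 1]) (u t * (k n * s (k n * (t - x)))) -
     \int[mu]_(t in `[x, y + 1]) (u t * (k n * s (k n * (t - y))))).
    apply/funext => n.
    have -> : derive1 (phi n) = dphi n.
      by apply/funext => t; rewrite derive1E; have [] := dphiE n t.
    rewrite (int_support _ x (y + 1)).
      by rewrite -intB//; congr Rintegral; apply/funext => t; rewrite /dphi mulrBr.
    move=> t xty; have sz z : x <= z <= y -> s (k n * (t - z)) = 0.
      move=> /andP[xz zy]; have [_] := s0 (k n * (t - z)); apply.
      rewrite pmulr_rgt0// -ltr_pdivlMl// mulr1 subr_gt0.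
      apply: contra xty => /andP[zt /lt_le_trans/(_ (k1 n)) tz].
      by apply/andP; split; lra.
    by rewrite /dphi !sz ?lexx ?(ltW xy)// !mulr0 subr0 mulr0.
  by apply: cvgB; apply: conc; rewrite ?lexx ?(ltW xy).
pose ind : R -> R := \1_(`]x, y]%classic).
have indE t : ind t = (x < t <= y)%R%:R by rewrite /ind indicE mem_setE in_itv.
have mind : lebesgue_measurable ind.
  by apply: measurable_indic; exact: leb_measurable_itv.
have mgi : lebesgue_measurable (fun t => g t * ind t).
  by apply: measurable_funM => //; exact: lg.1.
have cphi n : continuous (phi n).
  by apply: derivable_continuous => t; have [] := dphiE n t.
have phi1 n t : `|phi n t| <= 1.
  have ndS a b : a <= b -> S a <= S b.
    move=> ab; have [c _ SE] := MVT_segment ab (fun t _ => dS t) (continuous_subspaceT cS).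
    by rewrite -subr_ge0 SE mulr_ge0 ?subr_ge0//; have [] := s0 c.
  have S01 a : 0 <= S a <= 1.
    apply/andP; split.
      by have [a0|/ltW a0] := leP a 0; [rewrite S0|rewrite -(S0 0)// ndS].
    by have [a0|/ltW a0] := leP 1 a; [rewrite S1|rewrite -(S1 1)// ndS].
  have := S01 (k n * (t - x)); have := S01 (k n * (t - y)).
  by rewrite ler_norml /phi => /andP[? ?] /andP[? ?]; apply/andP; split; lra.
have large t z : z < t -> \forall n \near \oo, S (k n * (t - z)) = 1.
  move=> zt; near=> n; apply: S1; rewrite -ler_pdivrMr ?subr_gt0// div1r.
  apply: ltW; near: n; have := nbhs_infty_gtr (t - z)^-1.
  by apply: filterS => n /lt_trans; apply; rewrite ltr_nat.
have rhs : (fun n => \int[mu]_t (g t * phi n t)) @ \oo -->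
    \int[mu]_(t in `[x, y + 1]) (g t * ind t).
  under eq_fun => n.
    rewrite (int_support _ x (y + 1)); last by move=> t /out ->; rewrite mulr0.
    over.
  apply: (int_dominated _ _ (fun t => `|g t|)) => //.
  - by move=> n; apply: measurable_funM; [exact: lg.1|exact: leb_measurable_cont].
  - exact: integrable_norm (lg.2 x (y + 1)).
  - apply: aeT => t _; apply: cvgM; first exact: cvg_cst.
    apply: cvg_near_cst; rewrite indE; have [tx|xt] := leP t x.
      near=> n; rewrite /phi !S0 ?subrr// pmulr_rle0// subr_le0//.
      by rewrite (le_trans tx)// ltW.
    have [ty|yt] := leP t y.
      near=> n; rewrite /phi (S0 (k n * (t - y))) ?pmulr_rle0 ?subr_le0// subr0.
      by near: n; exact: large.
    near=> n; rewrite /phi; apply/eqP; rewrite subr_eq0; apply/eqP.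
    transitivity (1 : R); first by near: n; exact: large (lt_trans xy yt).
    by apply/esym; near: n; exact: large.
  - by move=> n t _; rewrite normrM ler_piMr.
have nrhs : (fun n => \int[mu]_t (u t * derive1 (phi n) t)) @ \oo -->
    - \int[mu]_(t in `[x, y + 1]) (g t * ind t).
  by under eq_fun => n do rewrite H//; exact: cvgN.
have E : u x - u y = - \int[mu]_(t in `[x, y + 1]) (g t * ind t) :=
  seq_cvg_unique _ _ _ lhs nrhs.
rewrite -opprB E opprK.
have lgi : locint (fun t => g t * ind t).
  apply: locint_dom mgi lg _ => t; rewrite normrM ler_piMr// indE.
  by case: (_ < _ <= _); rewrite ?normr1 ?normr0.
rewrite (int_add _ x y (y + 1))//; [|exact: ltW|by rewrite lerDl].
have -> : \int[mu]_(t in `[y, y + 1]) (g t * ind t) = 0.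
  rewrite (int_ae _ (fun=> 0)) ?int_cst ?mul0r ?lerDl//; last exact: leb_measurable_cst.
  apply: (aeS _ _ (ae_neq y)) => t ty /andP[yt _].
  have {}yt : y < t by rewrite lt_neqAle eq_sym ty.
  by rewrite indE [t <= y]leNgt yt andbF mulr0.
rewrite addr0; apply: int_ae => //; last exact: lg.1.
apply: (aeS _ _ (ae_neq x)) => t tx /andP[xt ty].
have {}xt : x < t by rewrite lt_neqAle eq_sym tx.
by rewrite indE xt ty mulr1.
Unshelve. all: by end_near. Qed.

Lemma mu_setT_gt0 : (0 < mu [set: R])%E.
Proof.
apply: (@lt_le_trans _ _ (mu `[(0:R), 1]%classic)).
  by rewrite [X in (_ < X)%E]mu_itv// lte_fin subr0.
by apply: le_measure; rewrite ?inE//; exact: leb_measurable_itv.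
Qed.

Lemma Linfty_normP f (M : R) :
  (Linfty_norm f <= M%:E)%E <-> {ae mu, forall t, `|f t| <= M}.
Proof.
rewrite /Linfty_norm unlock mu_setT_gt0; split.
  by move=> /ess_supP H; apply: (aeS _ _ H) => t; rewrite lee_fin.
by move=> H; apply/ess_supP; apply: (aeS _ _ H) => t; rewrite lee_fin.
Qed.

Lemma Lp_oo_bounded f (M : R) : lebesgue_measurable f ->
  {ae mu, forall t, `|f t| <= M} -> Lp +oo%E f.
Proof.
move=> mf /Linfty_normP fM; rewrite /Lp inE /Lfun; apply/andP.
split; first by rewrite inE.
by rewrite inE /= /finite_norm (le_lt_trans fM)// ltry.
Qed.

Lemma weakD_is_weak_derivative u g : is_weak_derivative u g ->
  is_weak_derivative u (weakD u).
Proof.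
by move=> ug; apply: (@xgetPex _ _ [set g | is_weak_derivative u g]); exists g.
Qed.

(** By [weak_derivative_int], a continuous function is a primitive of each of its weak
    derivatives, which therefore coincide almost everywhere with its derivative. *)
Lemma weakD_der L u : lip L u -> {ae mu, forall t, weakD u t = der u t}.
Proof.
move=> Lu; have cu := lip_continuous _ _ Lu.
have /weakD_is_weak_derivative wu : is_weak_derivative u (der u).
  by apply: lip_weak_derivative Lu _; exact: aeT.
have [lw uE] := weak_derivative_int _ _ cu wu.
by apply: (aeS _ _ (ae_derive_primitive _ _ lw uE)) => t /derE.
Qed.

End weak_derivatives.

(** * The kinetic term and its convex conjugate *)

Section lagrangian.
Context {R : realType}.
Implicit Types (p q r s : R).

Definition lagr q : R := 1 - Num.sqrt (1 - q ^+ 2).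

(** The derivative of [p |-> sqrt (1 + p ^ 2)], and the inverse of the derivative
    [q |-> q / sqrt (1 - q ^ 2)] of [lagr]. *)
Definition psi p : R := p / Num.sqrt (1 + p ^+ 2).

Lemma sq_le1 q : `|q| <= 1 -> 0 <= 1 - q ^+ 2.
Proof. by rewrite ler_norml => /andP[? ?]; nra. Qed.

Lemma lagr_ge0 q : 0 <= lagr q.
Proof.
rewrite subr_ge0 -[leRHS]sqrtr1 ler_wsqrtr// gerBl.
exact: sqr_ge0.
Qed.

Lemma lagr_le1 q : lagr q <= 1.
Proof. by rewrite gerBl sqrtr_ge0. Qed.

Lemma lagr0 : lagr 0 = 0.
Proof. by rewrite /lagr expr0n/= subr0 sqrtr1 subrr. Qed.

Lemma lagr_gt0 (q : R) : q != 0 -> 0 < lagr q.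
Proof.
move=> q0; rewrite /lagr subr_gt0 -[ltRHS]sqrtr1 ltr_sqrt// gtrBl.
by rewrite exprn_even_gt0.
Qed.

Lemma le_lagr q r : `|q| <= `|r| -> lagr q <= lagr r.
Proof.
move=> qr; rewrite lerB// ler_wsqrtr// lerB//.
by rewrite -[q ^+ 2]real_normK ?num_real// -[r ^+ 2]real_normK ?num_real// ler_pXn2r ?nnegrE.
Qed.

Lemma lagr_continuous : continuous lagr.
Proof.
move=> q; apply: cvgB; first exact: cvg_cst.
apply: (@continuous_comp _ _ _ (fun q => 1 - q ^+ 2) Num.sqrt); last exact: sqrt_continuous.
by apply: cvgB; [exact: cvg_cst|apply: exprn_continuous].
Qed.

(** The graph of [lagr] is a half-circle; its convexity amounts to the Cauchy-Schwarz
    inequality for the unit vectors [(q, sqrt (1 - q ^ 2))] and [(r, sqrt (1 - r ^ 2))]. *)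
Lemma lagr_convex q r s : `|q| <= 1 -> `|r| <= 1 -> 0 <= s <= 1 ->
  lagr (q + s * (r - q)) <= lagr q + s * (lagr r - lagr q).
Proof.
move=> q1 r1 /andP[s0 s1]; rewrite /lagr.
have A0 := sqrtr_ge0 (1 - q ^+ 2); have A2 := sqr_sqrtr (sq_le1 _ q1).
have B0 := sqrtr_ge0 (1 - r ^+ 2); have B2 := sqr_sqrtr (sq_le1 _ r1).
move: (Num.sqrt (1 - q ^+ 2)) (Num.sqrt (1 - r ^+ 2)) A0 A2 B0 B2 => A B A0 A2 B0 B2.
suff : A + s * (B - A) <= Num.sqrt (1 - (q + s * (r - q)) ^+ 2) by lra.
have AB0 : 0 <= A + s * (B - A) by nra.
rewrite -(ger0_norm AB0) -sqrtr_sqr ler_wsqrtr//.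
have ABqr : A * B + q * r <= 1.
  have := sqr_ge0 (A - B); have := sqr_ge0 (q - r); nra.
have -> : (A + s * (B - A)) ^+ 2 = (1 - s) ^+ 2 * A ^+ 2 + s ^+ 2 * B ^+ 2 +
  2 * (s * (1 - s)) * (A * B) by ring.
have -> : (q + s * (r - q)) ^+ 2 = (1 - s) ^+ 2 * q ^+ 2 + s ^+ 2 * r ^+ 2 +
  2 * (s * (1 - s)) * (q * r) by ring.
have w0 : 0 <= s * (1 - s) by rewrite mulr_ge0// subr_ge0.
have : s * (1 - s) * (A * B + q * r) <= s * (1 - s) by rewrite ler_piMr.
by rewrite A2 B2; lra.
Qed.

Lemma sqrt1D_gt0 p : 0 < Num.sqrt (1 + p ^+ 2).
Proof. by rewrite sqrtr_gt0 ltr_pwDl// sqr_ge0. Qed.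

Lemma sqr_sqrt1D p : Num.sqrt (1 + p ^+ 2) ^+ 2 = 1 + p ^+ 2.
Proof. by rewrite sqr_sqrtr// addr_ge0// sqr_ge0. Qed.

Lemma psi_lt1 p : `|psi p| < 1.
Proof.
have S0 := sqrt1D_gt0 p; have S2 := sqr_sqrt1D p.
rewrite /psi normrM normfV (gtr0_norm S0) ltr_pdivrMr// mul1r.
have := real_normK (num_real p); have := normr_ge0 p.
move: (Num.sqrt _) S0 S2 `|p| => S S0 S2 P P0 P2.
rewrite -P2 in S2; nra.
Qed.

Lemma sqrt1B_psi p : Num.sqrt (1 - psi p ^+ 2) = (Num.sqrt (1 + p ^+ 2))^-1.
Proof.
have S0 := sqrt1D_gt0 p; have S2 := sqr_sqrt1D p.
rewrite /psi expr_div_n S2.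
have p20 : 1 + p ^+ 2 != 0 by rewrite -S2 expf_neq0// gt_eqF.
have -> : 1 - p ^+ 2 / (1 + p ^+ 2) = (Num.sqrt (1 + p ^+ 2))^-1 ^+ 2.
  by rewrite exprVn S2; field.
by rewrite sqrtr_sqr ger0_norm// invr_ge0 ltW.
Qed.

Lemma psiK p : psi p / Num.sqrt (1 - psi p ^+ 2) = p.
Proof. by rewrite sqrt1B_psi /psi invrK divfK// gt_eqF// sqrt1D_gt0. Qed.

Lemma psi_inj : injective psi.
Proof. by move=> p q pq; rewrite -(psiK p) pq psiK. Qed.

Lemma psi_surj q : `|q| < 1 -> psi (q / Num.sqrt (1 - q ^+ 2)) = q.
Proof.
move=> q1; have q0 : 0 < 1 - q ^+ 2 by move: q1; rewrite ltr_norml => /andP[? ?]; nra.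
have S0 : 0 < Num.sqrt (1 - q ^+ 2) by rewrite sqrtr_gt0.
have S2 : Num.sqrt (1 - q ^+ 2) ^+ 2 = 1 - q ^+ 2 by rewrite sqr_sqrtr// ltW.
rewrite /psi expr_div_n S2.
have -> : 1 + q ^+ 2 / (1 - q ^+ 2) = (Num.sqrt (1 - q ^+ 2))^-1 ^+ 2.
  by rewrite exprVn S2; field; rewrite gt_eqF.
by rewrite sqrtr_sqr ger0_norm ?invr_ge0 ?(ltW S0)// invrK divfK// gt_eqF.
Qed.

(** The Fenchel-Young inequality for [lagr], whose conjugate function is
    [p |-> sqrt (1 + p ^ 2) - 1]: Cauchy-Schwarz for the vectors [(p, 1)] and
    [(q, sqrt (1 - q ^ 2))], the latter being a unit vector. *)
Lemma fenchel p q : `|q| <= 1 -> p * q + (1 - Num.sqrt (1 + p ^+ 2)) <= lagr q.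
Proof.
move=> q1; rewrite /lagr.
have A0 := sqrtr_ge0 (1 - q ^+ 2); have A2 := sqr_sqrtr (sq_le1 _ q1).
have S0 := sqrt1D_gt0 p; have S2 := sqr_sqrt1D p.
move: (Num.sqrt (1 - q ^+ 2)) (Num.sqrt (1 + p ^+ 2)) A0 A2 S0 S2 => A S A0 A2 S0 S2.
suff : p * q + A <= S by lra.
have : (p * q + A) ^+ 2 <= S ^+ 2 by have := sqr_ge0 (q - p * A); nra.
by rewrite leNgt => SS; rewrite leNgt; apply: contra SS => SpA; nra.
Qed.

(** The case of equality in the Cauchy-Schwarz inequality of [fenchel]. *)
Lemma fenchel_eq p q : `|q| <= 1 ->
  lagr q <= p * q + (1 - Num.sqrt (1 + p ^+ 2)) -> q = psi p.
Proof.
move=> q1; rewrite /lagr /psi.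
have A0 := sqrtr_ge0 (1 - q ^+ 2); have A2 := sqr_sqrtr (sq_le1 _ q1).
have S0 := sqrt1D_gt0 p; have S2 := sqr_sqrt1D p.
move: (Num.sqrt (1 - q ^+ 2)) (Num.sqrt (1 + p ^+ 2)) A0 A2 S0 S2 => A S A0 A2 S0 S2 H.
have H2 : S <= p * q + A by lra.
have E : (q - p * A) ^+ 2 <= 0.
  have -> : (q - p * A) ^+ 2 = S ^+ 2 - (p * q + A) ^+ 2 by rewrite S2; nra.
  by nra.
have {}E : q = p * A.
  by apply/eqP; rewrite -subr_eq0 -sqrf_eq0 eq_le E sqr_ge0.
have AS : A * S = 1.
  have : (A * S) ^+ 2 = 1 by rewrite exprMn S2; move: A2; rewrite E exprMn; lra.
  by move=> AS2; have := mulr_ge0 A0 (ltW S0); nra.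
by rewrite E -[in RHS](mulr1 p) -AS mulrA mulfK// gt_eqF.
Qed.

Lemma lagr_psi p : lagr (psi p) = p * psi p + (1 - Num.sqrt (1 + p ^+ 2)).
Proof.
rewrite /lagr sqrt1B_psi /psi.
have S0 := sqrt1D_gt0 p; have S2 := sqr_sqrt1D p.
move: (Num.sqrt (1 + p ^+ 2)) S0 S2 => S S0 S2.
have -> : p * (p / S) = (S ^+ 2 - 1) / S by rewrite S2; field; rewrite gt_eqF.
by field; rewrite gt_eqF.
Qed.

(** The supremum in the Fenchel-Young inequality is attained at [p] with [psi p = q] if
    [|q| < 1], and is only approached, as [p] tends to infinity, if [|q| = 1]. *)
Lemma lagr_le_sup q (K : R) : `|q| <= 1 ->
  (forall p, p * q + (1 - Num.sqrt (1 + p ^+ 2)) <= K) -> lagr q <= K.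
Proof.
move=> q1 H; move: (q1); rewrite le_eqVlt => /predU1P[q1'|q1']; last first.
  have [p pq] : exists p, psi p = q by eexists; exact: psi_surj q1'.
  by have := H p; rewrite -pq -lagr_psi.
have -> : lagr q = 1.
  have : q ^+ 2 = 1 by rewrite -[LHS]real_normK ?num_real// q1' expr1n.
  by rewrite /lagr => ->; rewrite subrr sqrtr0 subr0.
apply/ler_addgt0Pr => e e0.
have qq : q * q = 1 by rewrite -expr2 -[LHS]real_normK ?num_real// q1' expr1n.
have := H (q / e); move: (sqrt1D_gt0 (q / e)) (sqr_sqrt1D (q / e)).
move: (Num.sqrt (1 + (q / e) ^+ 2)) => S S0 S2.
have -> : q / e * q = e^-1 by rewrite mulrAC qq mul1r.
have ei : 0 < e^-1 by rewrite invr_gt0.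
have ee : e * e^-1 = 1 by rewrite divff// gt_eqF.
have {}S2 : S ^+ 2 = 1 + (e^-1) ^+ 2.
  by rewrite S2 exprMn [q ^+ 2]expr2 qq mul1r.
have : S <= e^-1 + e by move: (e^-1) ei ee S2 => d; nra.
by lra.
Qed.

(** Adding up two Fenchel-Young inequalities shows that the derivative of a convex
    function is monotone. *)
Lemma le_psi p q : p <= q -> psi p <= psi q.
Proof.
move=> pq; rewrite leNgt; apply/negP => qp.
have := fenchel p (psi q) (ltW (psi_lt1 q)); have := fenchel q (psi p) (ltW (psi_lt1 p)).
rewrite !lagr_psi => H1 H2.
have [E|] := eqVneq p q; first by rewrite E ltxx in qp.
by move=> pq'; have {}pq : p < q by [rewrite lt_neqAle pq'|]; nra.
Qed.

Lemma psi_lip : lip 1 psi.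
Proof.
suff H p q : p <= q -> psi q - psi p <= q - p.
  move=> p q; rewrite mul1r; have [pq|/ltW pq] := leP p q.
    by rewrite !ler0_norm ?subr_le0 ?le_psi// !opprB H.
  by rewrite !ger0_norm ?subr_ge0 ?le_psi// H.
move=> pq; have Mp : psi p = p / Num.sqrt (1 + p ^+ 2) by [].
have mono a b : a <= b -> a - psi a <= b - psi b.
  wlog ab0 : a b / 0 <= a.
    move=> W ab; have [a0|/ltW a0] := leP 0 a; first exact: W.
    have psiN x : psi (- x) = - psi x by rewrite /psi sqrrN mulNr.
    have [b0|/ltW b0] := leP 0 b.
      have := W 0 b (lexx _) b0; have := W 0 (- a); rewrite lexx oppr_ge0 => /(_ isT a0).
      by rewrite psiN /psi mul0r; lra.
    have := W (- b) (- a); rewrite oppr_ge0 lerN2 !psiN => /(_ b0 ab); lra.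
  move=> ab; have b0 := le_trans ab0 ab.
  rewrite /psi; have Sa0 := sqrt1D_gt0 a; have Sb0 := sqrt1D_gt0 b.
  have Sab : Num.sqrt (1 + a ^+ 2) <= Num.sqrt (1 + b ^+ 2).
    by rewrite ler_wsqrtr// lerD2l ler_pXn2r.
  have Sa1 : 1 <= Num.sqrt (1 + a ^+ 2).
    by rewrite -[leLHS]sqrtr1 ler_wsqrtr// lerDl sqr_ge0.
  have F x y : x - x / y = x * (1 - y^-1) by rewrite mulrBr mulr1.
  rewrite !F ler_pM//; first by rewrite subr_ge0 invf_le1.
  by rewrite lerB// lef_pV2.
by have := mono p q pq; lra.
Qed.

End lagrangian.

(** * Admissible functions and their energy density *)

Section admissible_functions.
Context {R : realType}.
Local Notation mu := (@completed_lebesgue_measure R).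
Implicit Types (f g u e c W : R -> R) (x y t s : R).

Definition admissible u : Prop :=
  [/\ lip 1 u, u t @[t --> +oo] --> (1 : R) & u t @[t --> -oo] --> (-1 : R)].

Lemma admissible_bounded u : admissible u -> exists2 M : R, 0 < M & forall t, `|u t| <= M.
Proof.
move=> [Lu up un].
have [A [Ar HA]] : \forall t \near +oo, `|u t| <= 2.
  move/cvgrPdist_le : up => /(_ 1 ltr01).
  apply: filterS => t ut; have -> : u t = 1 - (1 - u t) by ring.
  by rewrite (le_trans (ler_normB _ _))// normr1; lra.
have [B [Br HB]] : \forall t \near -oo, `|u t| <= 2.
  move/cvgrPdist_le : un => /(_ 1 ltr01).
  apply: filterS => t ut; have -> : u t = - 1 - (- 1 - u t) by ring.
  by rewrite (le_trans (ler_normB _ _))// normrN1; lra.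
exists (`|u 0| + 2 + `|A| + `|B|).
  by have := normr_ge0 A; have := normr_ge0 B; have := normr_ge0 (u 0); lra.
move=> t; have := normr_ge0 A; have := normr_ge0 B; have := normr_ge0 (u 0) => u0 B0 A0.
have [At|tA] := ltP A t; first by have := HA t At; lra.
have [tB|Bt] := ltP t B; first by have := HB t tB; lra.
have -> : u t = u 0 - (u 0 - u t) by ring.
rewrite (le_trans (ler_normB _ _))//.
have := Lu 0 t; rewrite mul1r sub0r normrN.
have : `|t| <= `|A| + `|B|.
  have := ler_norm A; have := ler_norm (- B); rewrite normrN => ? ?.
  by rewrite ler_norml; apply/andP; split; lra.
lra.
Qed.

(** A function of [X1] is the integral of its weak derivative ([weak_derivative_int]);
    conversely, the derivative of a Lipschitz function is a weak derivative
    ([lip_weak_derivative]). *)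
Lemma X1P u : X1 u <-> admissible u.
Proof.
split.
  move=> [cu [_ [g ug _]] /Linfty_normP wu1 up un]; split => //.
  have [lw uE] := weak_derivative_int _ _ cu (weakD_is_weak_derivative _ _ ug).
  have H x y : x <= y -> `|u y - u x| <= y - x.
    move=> xy; rewrite uE//.
    have l1 := @locint_cst R 1; have l2 := @locint_cst R (-1).
    rewrite ler_norml -(mul1r (y - x)) -mulNr -!int_cst//; apply/andP; split.
      apply: (int_le_ae _ _ _ _ l2 lw); apply: (aeS _ _ wu1) => t.
      by rewrite ler_norml => /andP[].
    apply: (int_le_ae _ _ _ _ lw l1); apply: (aeS _ _ wu1) => t.
    by rewrite ler_norml => /andP[].
  move=> x y; rewrite mul1r; have [xy|/ltW xy] := leP x y.
    by rewrite distrC [`|x - y|]distrC [X in _ <= X]ger0_norm ?subr_ge0// H.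
  by rewrite [X in _ <= X]ger0_norm ?subr_ge0// H.
move=> au; have [Lu up un] := au; have cu := lip_continuous _ _ Lu.
have [M M0 uM] := admissible_bounded u au.
split => //.
  split; first by apply: (Lp_oo_bounded _ M (leb_measurable_cont _ cu)); exact: aeT.
  exists (der u); first by apply: lip_weak_derivative Lu _; exact: aeT.
  apply: (Lp_oo_bounded _ 1 (leb_measurable_der _ _ Lu)); apply: aeT => t.
  exact: (le_norm_der_lip _ _ _ Lu).
apply/Linfty_normP; apply: (aeS _ _ (weakD_der _ _ Lu)) => t ->.
exact: (le_norm_der_lip _ _ _ Lu).
Qed.

Lemma locint_lagr_der u : lip 1 u -> locint (fun t => lagr (der u t)).
Proof.
move=> Lu; apply: locint_bd.
  apply: (measurableT_comp (f := lagr)); last exact: leb_measurable_der Lu.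
  exact: continuous_measurable_fun lagr_continuous.
by move=> n; exists 1 => t _; rewrite ger0_norm ?lagr_ge0// lagr_le1.
Qed.

Lemma integral_ae f g : lebesgue_measurable f -> lebesgue_measurable g ->
  {ae mu, forall t, f t = g t} ->
  (\int[mu]_t (f t)%:E = \int[mu]_t (g t)%:E)%E.
Proof.
move=> mf mg fg.
apply: (@ae_eq_integral _ (Leb R) R mu setT (EFin \o g) (EFin \o f)).
- exact: measurableT.
- by apply/measurable_EFinP; exact: mf.
- by apply/measurable_EFinP; exact: mg.
- by apply: (aeS _ _ fg) => t /= -> _.
Qed.

(** With [der] instead of [weakD], the kinetic term makes sense at every point. *)
Definition density W c u t : R := lagr (der u t) + c t * W (u t).

Lemma leb_measurable_density L W c u : lip L u -> continuous W ->
  lebesgue_measurable c -> lebesgue_measurable (density W c u).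
Proof.
move=> Lu cW mc; apply: measurable_funD.
  apply: (measurableT_comp (f := lagr)); last exact: leb_measurable_der Lu.
  exact: continuous_measurable_fun lagr_continuous.
apply: measurable_funM; first exact: mc.
apply: leb_measurable_cont => t.
apply: (continuous_comp (lip_continuous _ _ Lu t)); exact: cW.
Qed.

Lemma energyE W c u : lip 1 u -> continuous W -> lebesgue_measurable c ->
  energy W c u = (\int[mu]_t (density W c u t)%:E)%E.
Proof.
move=> Lu cW mc; rewrite /energy.
have md := leb_measurable_density _ _ _ _ Lu cW mc.
have dE : {ae mu, forall t, density W c u t =
    1 - Num.sqrt (1 - `|weakD u t| ^+ 2) + c t * W (u t)}.
  apply: (aeS _ _ (weakD_der _ _ Lu)) => t ->.
  by rewrite /density /lagr real_normK// num_real.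
have md' := leb_measurable_ae _ _ md dE.
apply: (integral_ae _ _ md' md); apply: (aeS _ _ dE) => t E.
by rewrite E.
Qed.

Lemma ge0_integral_leP e (M : R) : locint e -> (forall t, 0 <= e t) ->
  (\int[mu]_t (e t)%:E <= M%:E)%E <->
  forall x y, x <= y -> \int[mu]_(t in `[x, y]) e t <= M.
Proof.
move=> [me ei] e0; split => [H x y xy|H].
  rewrite -lee_fin /Rintegral fineK; last first.
    exact: (integrable_fin_num (leb_measurable_itv _) (ei x y)).
  apply: le_trans H; apply: ge0_subset_integral.
  - exact: leb_measurable_itv.
  - exact: measurableT.
  - by apply/measurable_EFinP; exact: me.
  - by move=> t _; rewrite lee_fin.
  - by [].
pose f_ (n : nat) := (EFin \o e) \_ `[- n%:R, n%:R].
have mEe : measurable_fun [set: Leb R] (EFin \o e) by apply/measurable_EFinP.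
have mf n : measurable_fun [set: Leb R] (f_ n).
  apply/(measurable_restrictT _ (leb_measurable_itv _)).
  exact: measurable_funTS mEe.
have f0 n t : [set: Leb R] t -> (0 <= f_ n t)%E.
  by move=> _; rewrite /f_ patchE; case: ifP => // _; rewrite lee_fin.
have nf t : [set: Leb R] t -> nondecreasing_seq (f_ ^~ t).
  move=> _ m n mn; rewrite /f_ !patchE; case: ifPn => [tm|_]; last first.
    by case: ifP => // _; rewrite lee_fin.
  rewrite ifT//; move: tm; rewrite !inE /= !in_itv/= -!ler_norml => /le_trans.
  by apply; rewrite ler_nat.
have /(_ mu) := cvg_monotone_convergence measurableT mf f0 nf.
have -> : (fun t => limn (f_ ^~ t)) = EFin \o e.
  apply/funext => t; apply: cvg_lim => //; apply: cvg_near_cst; near=> n.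
  rewrite /f_ patchE ifT// inE /= in_itv/= -ler_norml; apply: ltW.
  by near: n; exact: nbhs_infty_gtr.
move=> cv; rewrite -(cvg_lim (@ereal_hausdorff R) cv); apply: lime_le.
  by apply/cvg_ex; eexists; exact: cv.
apply: nearW => n.
rewrite -integral_mkcond.
have fin := integrable_fin_num (leb_measurable_itv _) (ei (- n%:R) n%:R).
by rewrite -(fineK fin) lee_fin; apply: H; rewrite -subr_ge0 opprK -natrD.
Unshelve. all: by end_near. Qed.

End admissible_functions.

(** * Compactness of Lipschitz functions *)

Section compactness.
Context {R : realType}.
Implicit Types (x y t : R).

Lemma cvg_selection (a : nat -> R) (s : nat -> nat) (l : R) :
  (forall m, (m <= s m)%N) -> a n @[n --> \oo] --> l -> a (s m) @[m --> \oo] --> l.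
Proof.
move=> ms; apply: cvg_comp => A [N _ HN].
by exists N => // m /= Nm; apply: HN; exact: leq_trans (ms m).
Qed.

Lemma cvg_le_cst (a : nat -> R) (l M : R) : a n @[n --> \oo] --> l ->
  (forall n, a n <= M) -> l <= M.
Proof.
move=> al aM; rewrite -(cvg_lim _ al)//; apply: limr_le; first exact/cvg_ex/(ex_intro _ l).
by apply: nearW.
Qed.

Lemma cvg_ge_cst (a : nat -> R) (l M : R) : a n @[n --> \oo] --> l ->
  (forall n, M <= a n) -> M <= l.
Proof.
move=> /cvgN al aM; rewrite -lerN2; apply: cvg_le_cst al _ => n; by rewrite lerN2.
Qed.

Lemma filter_seq {T : Type} {I : eqType} (F : set_system T) (FF : Filter F)
  (ts : seq I) (P : I -> set T) :
  (forall i, F (P i)) -> F [set h | forall i, i \in ts -> P i h].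
Proof.
move=> FP; elim: ts => [|t ts IH]; first by apply: filterS filterT => h _ t.
by apply: filterS2 (FP t) IH => h ht hts z; rewrite inE => /predU1P[->//|]; exact: hts.
Qed.

(** A cluster point of the sequence in the topology of pointwise convergence, in
    which the set of functions bounded by [B] is compact, can be approximated at
    finitely many points at once. *)
Lemma pointwise_cluster (f : nat -> R -> R) (B : R -> R) :
  (forall n t, `|f n t| <= B t) ->
  exists g : R -> R, forall (ts : seq R) (e : R) (m : nat), 0 < e ->
    exists2 n, (m <= n)%N & forall t, t \in ts -> `|f n t - g t| < e.
Proof.
move=> fB; pose PT := prod_topology (fun _ : R => R).
have cB : compact [set h : PT | forall t, `[- B t, B t]%classic (h t)].
  by apply: (@tychonoff _ (fun=> R) (fun t => `[- B t, B t]%classic)) => t; exact: segment_compact.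
have [|g [_ gf]] := cB ((f : nat -> PT) n @[n --> \oo]) _.
  by exists 0%N => // n _ t /=; rewrite in_itv/= -ler_norml.
exists g => ts e m e0.
have Hts : nbhs (g : PT)
    [set h : PT | forall t, t \in ts -> `|h t - g t| < e].
  suff H t : nbhs (g : PT) [set h : PT | `|h t - g t| < e].
    exact: (filter_seq _ (nbhs_filter (g : PT)) ts (fun t (h : PT) => `|h t - g t| < e) H).
  have ne : nbhs (g t) [set z : R | `|z - g t| < e].
    by apply/nbhs_ballP; exists e => //= z; rewrite /ball/= distrC.
  exact: (@proj_continuous R (fun=> R) t g _ ne).
have [|h [[n /= mn <-] nts]] := gf (f @` [set n | (m <= n)%N]) _ _ Hts.
  by exists m => // n /= mn; exists n.
by exists n.
Qed.

(** Equi-Lipschitz sequences are pointwise compact: convergence at the rationals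
    suffices. *)
Lemma lip_selection (K : R) (f : nat -> R -> R) (B : R -> R) :
  (forall n, lip K (f n)) -> (forall n t, `|f n t| <= B t) ->
  exists (s : nat -> nat) (g : R -> R), [/\ forall m, (m <= s m)%N, lip K g &
    forall t, f (s m) t @[m --> \oo] --> g t].
Proof.
move=> Lf fB; have [g gP] := pointwise_cluster f B fB.
(* an enumeration of the rationals; [f (s m)] is chosen close to [g] at the first [m] *)
pose q (i : nat) : R := ratr (odflt 0 (unpickle i)).
pose ts m := [seq q i | i <- iota 0 m].
have eps0 (m : nat) : 0 < m.+1%:R^-1 :> R by rewrite invr_gt0 ltr0n.
have /choice[s sP] : forall m, exists n, (m <= n)%N /\
    forall t, t \in ts m -> `|f n t - g t| < m.+1%:R^-1.
  by move=> m; have [n mn nP] := gP (ts m) _ m (eps0 m); exists n.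
have Lg : lip K g.
  move=> x y; apply/ler_addgt0Pr => e e0.
  have e20 : 0 < e / 2 by rewrite divr_gt0.
  have [n _ nP] := gP [:: x; y] _ 0%N e20.
  have := nP x; have := nP y; rewrite !inE !eqxx orbT => /(_ erefl) ny /(_ erefl) nx.
  have -> : g x - g y = (f n x - f n y) - (f n x - g x) + (f n y - g y) by ring.
  rewrite (le_trans (ler_normD _ _))// (le_trans (lerD (ler_normB _ _) (lexx _)))//.
  by have := Lf n x y; lra.
exists s, g; split => [m|//|t]; first exact: (sP m).1.
have K0 : 0 <= K by exact: lip_ge0 (Lf 0%N).
suff H (e : R) : 0 < e -> \forall m \near \oo, `|g t - f (s m) t| < e.
  by apply/cvgrPdist_lt => e; exact: H.
move=> e0; pose d : R := e / 3 / (K + 1).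
have K1 : 0 < K + 1 by rewrite ltr_wpDl.
have d0 : 0 < d by rewrite !divr_gt0.
have Kd : K * d <= e / 3.
  rewrite /d mulrA ler_pdivrMr// mulrC ler_wpM2l ?divr_ge0 ?ltW// ltrDl//.
have td : t < t + d by rewrite ltrDl.
have [r] := rat_in_itvoo td.
rewrite in_itv/= => /andP[tr rt].
have rts m : (pickle r < m)%N -> ratr r \in ts m.
  move=> rm; apply/mapP; exists (pickle r); first by rewrite mem_iota.
  by rewrite /q pickleK.
have Kr : K * `|t - ratr r| <= e / 3.
  by rewrite (le_trans _ Kd)// ler_wpM2l// ltr0_norm ?subr_lt0//; lra.
have e3 : 0 < e / 3 by rewrite divr_gt0.
have := near_infty_natSinv_lt (PosNum e3) => -[N _ HN].
exists (maxn N (pickle r).+1) => // m /=; rewrite geq_max => /andP[/HN /= me /rts rm].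
have := (sP m).2 _ rm.
have := Lg t (ratr r); have := Lf (s m) (ratr r) t; rewrite [`|ratr r - t|]distrC.
have -> : g t - f (s m) t = (g t - g (ratr r)) - (f (s m) (ratr r) - g (ratr r)) + (f (s m) (ratr r) - f (s m) t) by ring.
move=> A B' C; apply: (le_lt_trans (ler_normD _ _)); apply: (le_lt_trans (lerD (ler_normB _ _) (lexx _))).
apply: le_lt_trans (lerD (lerD B' (ltW C)) A) _.
apply: lt_le_trans (ltr_leD (ler_ltD Kr me) Kr) _; lra.
Qed.

End compactness.

(** * Behaviour at infinity *)

Section infinity.
Context {R : realType}.
Local Notation mu := (@completed_lebesgue_measure R).
Implicit Types (f g u v e : R -> R) (x y z t s : R).

(** Intervals disjoint from one that carries almost the supremum of the integrals have
    only a small integral. *)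
Lemma integral_tail e (m rho : R) : locint e -> (forall t, 0 <= e t) ->
  (forall x y, x <= y -> \int[mu]_(t in `[x, y]) e t <= m) -> 0 < rho ->
  exists x0 y0, x0 <= y0 /\ forall x y, x <= y -> y0 <= x \/ y <= x0 ->
    \int[mu]_(t in `[x, y]) e t < rho.
Proof.
move=> le e0 em rho0.
pose S := [set r : R | exists x y, x <= y /\ r = \int[mu]_(t in `[x, y]) e t].
have hS : has_sup S.
  split; first by exists (\int[mu]_(t in `[0, 0]) e t), 0, 0.
  by exists m => _ [x [y [xy ->]]]; exact: em.
have [_ [x0 [y0 [xy0 ->]]] H] := sup_adherent rho0 hS.
exists x0, y0; split => // x y xy xyo.
have subS x' y' : x' <= y' -> \int[mu]_(t in `[x', y']) e t <= sup S.
  by move=> xy'; apply: (ub_le_sup hS.2); exists x', y'.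
case: xyo => [yx|yx].
  have := subS x0 y (le_trans xy0 (le_trans yx xy)).
  rewrite (int_add _ x0 y0 y le xy0 (le_trans yx xy)) (int_add _ y0 x y le yx xy).
  by have := int_ge0 e y0 x (fun t _ => e0 t); lra.
have := subS x y0 (le_trans xy (le_trans yx xy0)).
rewrite (int_add _ x x0 y0 le (le_trans xy yx) xy0) (int_add _ x y x0 le xy yx).
by have := int_ge0 e y x0 (fun t _ => e0 t); lra.
Qed.

(** The argument of Barbalat: if a Lipschitz function were not small at some far away
    point, it would not be small on an interval of a fixed length, on which a fixed
    amount of the finite total integral of [e] would have to be found. *)
Lemma barbalat (g e : R -> R) (L m eps k : R) (D : set R) :
  lip L g -> locint e -> (forall t, 0 <= e t) ->
  (forall x y, x <= y -> \int[mu]_(t in `[x, y]) e t <= m) ->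
  0 < eps -> 0 < k -> (forall t, D t -> eps / 2 <= `|g t| -> k <= e t) ->
  exists A : R, forall t, A <= `|t| -> (forall s, t <= s <= t + 1 -> D s) -> `|g t| < eps.
Proof.
move=> Lg le e0 em eps0 k0 ge_k.
have L0 := lip_ge0 _ _ Lg; have L1 : 0 < L + 1 by rewrite ltr_wpDl.
(* if [g] is at least [eps] at [t], then it is at least [eps / 2] on [[t, t + d]] *)
pose d : R := Num.min 1 (eps / 2 / (L + 1)).
have d0 : 0 < d by rewrite lt_min ltr01 !divr_gt0.
have d1 : d <= 1 by rewrite ge_min lexx.
have Ld : L * d <= eps / 2.
  have : d <= eps / 2 / (L + 1) by rewrite ge_min lexx orbT.
  by rewrite ler_pdivlMr//; nra.
have [x0 [y0 [xy0 tail]]] := integral_tail _ _ _ le e0 em (mulr_gt0 k0 d0).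
exists (`|x0| + `|y0| + 1) => t At Dt; rewrite ltNge; apply/negP => gt.
have ttd : t <= t + d by rewrite lerDl ltW.
have out : y0 <= t \/ t + d <= x0.
  have := ler_norm y0; have := ler_norm (- x0); have := normr_ge0 x0; have := normr_ge0 y0.
  rewrite normrN; move: At; have [t0|t0] := leP 0 t.
    by rewrite (ger0_norm t0) => ? ? ? ? ?; left; lra.
  by rewrite (ltr0_norm t0) => ? ? ? ? ?; right; lra.
have := tail t (t + d) ttd out; rewrite ltNge => /negP; apply.
have -> : k * d = k * (t + d - t) by ring.
rewrite -(int_cst _ _ _ ttd); apply: (int_le _ _ _ _ (locint_cst _) le) => s /andP[ts sd].
apply: ge_k; first by apply: Dt; apply/andP; split; lra.
have := Lg t s; rewrite (ler0_norm (_ : t - s <= 0)) ?subr_le0//.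
have : `|g t| <= `|g t - g s| + `|g s|.
  by have := ler_normD (g t - g s) (g s); rewrite subrK.
have : L * - (t - s) <= L * d by rewrite ler_wpM2l//; lra.
lra.
Qed.

Lemma cvg_norm_infty (f : R -> R) (l : R) :
  (forall eps : R, 0 < eps -> exists A : R, forall t, A <= `|t| -> `|f t - l| < eps) <->
  f t @[t --> +oo] --> l /\ f t @[t --> -oo] --> l.
Proof.
split=> [H|[fp fn] eps eps0].
  have H' (eps : R) : 0 < eps -> (\forall t \near +oo, `|l - f t| < eps) /\
      \forall t \near -oo, `|l - f t| < eps.
    move=> /H[A HA]; split; near=> t; rewrite distrC; apply: HA.
      by rewrite (le_trans _ (ler_norm _))//; near: t; exact: nbhs_pinfty_ge (num_real _).
    rewrite -normrN (le_trans _ (ler_norm _))// lerNr.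
    by near: t; exact: nbhs_ninfty_le (num_real _).
  by split; apply/cvgrPdist_lt => eps /H'[].
have [A [Ar HA]] : \forall t \near +oo, `|l - f t| < eps by move/cvgrPdist_lt : fp; apply.
have [B [Br HB]] : \forall t \near -oo, `|l - f t| < eps by move/cvgrPdist_lt : fn; apply.
exists (`|A| + `|B| + 1) => t; rewrite distrC.
have := ler_norm A; have := ler_norm (- B); rewrite normrN.
have := normr_ge0 A; have := normr_ge0 B.
have [t0|t0] := leP 0 t; first by rewrite (ger0_norm t0) => *; apply: HA; lra.
by rewrite (ltr0_norm t0) => *; apply: HB; lra.
Unshelve. all: by end_near. Qed.

Lemma psi_sup_lt1 (p : R -> R) : continuous p ->
  (forall eps : R, 0 < eps -> exists A : R, forall t, A <= `|t| -> `|psi (p t)| < eps) ->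
  exists2 r : R, r < 1 & forall t, `|psi (p t)| <= r.
Proof.
move=> cp /(_ 2^-1)[|A HA]; first by rewrite invr_gt0.
have cn : continuous (fun t => `|psi (p t)|).
  move=> t; apply: cvg_norm; exact: (continuous_comp (cp t) (lip_continuous _ _ psi_lip _)).
have AA : - `|A| <= `|A| by rewrite ge0_cp.
have [z _ Hz] := EVT_max AA (continuous_subspaceT cn).
exists (Num.max 2^-1 `|psi (p z)|); first by rewrite gt_max psi_lt1 andbT; lra.
move=> t; rewrite le_max; have [At|tA] := leP A `|t|; first by rewrite ltW// HA.
apply/orP; right; apply: Hz; rewrite in_itv/= -ler_norml ltW//.
exact: lt_le_trans tA (ler_norm _).
Qed.

Lemma first_hitting u (l : R) : continuous u -> u t @[t --> +oo] --> (1 : R) ->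
  u t @[t --> -oo] --> (-1 : R) -> -1 < l < 1 ->
  exists2 tau, u tau = l & forall t, t <= tau -> u t <= l.
Proof.
move=> cu up un /andP[l1 l2].
have [A [Ar HA]] : \forall t \near +oo, l < u t.
  by apply: (cvgr_gt (1 : R)).
have [B [Br HB]] : \forall t \near -oo, u t < l.
  by apply: (cvgr_lt (-1 : R)).
pose S := [set t | forall s, s <= t -> u s <= l].
have SA : ubound S (A + 1).
  move=> t St; rewrite leNgt; apply/negP => At.
  have := St (A + 1) (ltW At); rewrite leNgt HA//; lra.
have SB : S (B - 1) by move=> s sB; apply/ltW/HB; lra.
have hS : has_sup S by split; [exists (B - 1)|exists (A + 1)].
pose tau := sup S.
have Slt t : t < tau -> u t <= l.
  rewrite -subr_gt0 => /sup_adherent/(_ hS)[s Ss]; rewrite opprB addrC subrK => ts.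
  by apply: Ss; exact: ltW.
have utl : u tau <= l.
  rewrite leNgt; apply/negP => lu.
  have /nbhs_ballP[r /= r0 Hr] : \forall t \near tau, l < u t.
    exact: (cvgr_gt (u tau) (cu tau)).
  have : l < u (tau - r / 2).
    apply: Hr; rewrite /ball/= opprB addrC subrK gtr0_norm ?divr_gt0//.
    lra.
  by rewrite ltNge Slt// gtrDl oppr_lt0 divr_gt0.
have le_tau t : t <= tau -> u t <= l.
  by rewrite le_eqVlt => /predU1P[->//|]; exact: Slt.
exists tau => //; apply/eqP; rewrite eq_le utl /= leNgt; apply/negP => ul.
have /nbhs_ballP[r /= r0 Hr] : \forall t \near tau, u t < l.
  exact: (cvgr_lt (u tau) (cu tau)).
have : S (tau + r / 2).
  move=> s sr; have [|ts] := leP s tau; first exact: le_tau.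
  apply/ltW/Hr; rewrite /ball/= ltr0_norm ?subr_lt0// opprB.
  by lra.
move=> /(ub_le_sup (proj2 hS)); rewrite leNgt ltrDl divr_gt0//.
Qed.

Lemma periodic_int (b : R -> R) (T : R) : periodic b T ->
  forall (k : int) t, b (t + k%:~R * T) = b t.
Proof.
move=> bT; have bn (n : nat) t : b (t + n%:R * T) = b t.
  elim: n => [|n IH]; first by rewrite mul0r addr0.
  by rewrite -natr1 mulrDl mul1r addrA bT.
move=> [n|n] t; first exact: bn.
by rewrite NegzE mulrNz mulNr -[LHS](bn n.+1) subrK.
Qed.

Definition ramp (tau l t : R) : R := clamp l 1 (t + (l - tau)).

Lemma ramp1 (tau l t : R) : l <= 1 -> tau + (1 - l) <= t -> ramp tau l t = 1.
Proof.
move=> l1 tt; rewrite /ramp /clamp (min_idPl _) ?(max_idPr l1)//; lra.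
Qed.

(** Before [tau] the function stays away from the well [1], and after [tau] from the well
    [-1]. This survives in pointwise limits, if [tau] stays bounded, and prevents the
    limit from having the wrong behaviour at infinity. *)
Definition normalized (eta : R) u (tau : R) : Prop := [/\ admissible u, forall t, `|u t| <= 1,
  forall t, t <= tau -> u t <= 1 - eta & forall t, tau <= t -> 0 <= u t].

End infinity.

(** * Energies on bounded intervals *)

Section potential.
Context {R : realType}.
Variable (W : R -> R).
Hypotheses (cW : continuous W) (W_N1 : W (-1) = 0) (W_1 : W 1 = 0)
  (W_gt0 : forall s, s != -1 -> s != 1 -> 0 < W s).
Variables (a1 a2 : R).
Hypothesis a1_gt0 : 0 < a1.
Local Notation mu := (@completed_lebesgue_measure R).
Implicit Types (u v c e : R -> R) (x y t s : R).

Lemma W_ge0 s : 0 <= W s.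
Proof.
have [->|sN1] := eqVneq s (-1); first by rewrite W_N1.
have [->|s1] := eqVneq s 1; first by rewrite W_1.
by rewrite ltW// W_gt0.
Qed.

Lemma W_bounded (M : R) : exists2 K : R, 0 <= K & forall s, `|s| <= M -> W s <= K.
Proof.
have [K K0 HK] := continuous_bounded W M cW; exists K => // s sM.
by rewrite (le_trans (ler_norm _))// HK.
Qed.

Lemma W_bounded_below (p q : R) : -1 < p -> q < 1 ->
  exists2 k : R, 0 < k & forall s, p <= s <= q -> k <= W s.
Proof.
move=> p1 q1; have [pq|qp] := leP p q; last first.
  by exists 1 => // s /andP[ps sq]; have := le_trans ps sq; rewrite leNgt qp.
have [c cpq cmin] := EVT_min pq (continuous_subspaceT cW).
exists (W c) => [|s spq]; last by apply: cmin; rewrite in_itv.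
move: cpq; rewrite in_itv/= => /andP[pc cq].
by apply: W_gt0; [rewrite gt_eqF//; lra|rewrite lt_eqF//; lra].
Qed.

Definition weight c := lebesgue_measurable c /\ forall t, a1 <= c t <= a2.

Lemma weight_ge0 c t : weight c -> 0 <= c t.
Proof. by move=> [_ /(_ t)/andP[+ _]]; apply: le_trans; exact: ltW. Qed.

Lemma density_ge0 c u t : weight c -> 0 <= density W c u t.
Proof.
by move=> wc; rewrite addr_ge0 ?lagr_ge0// mulr_ge0 ?W_ge0// weight_ge0.
Qed.

Lemma density_bounded (M : R) : exists2 K : R, 0 <= K &
  forall c u t, weight c -> `|u t| <= M -> `|density W c u t| <= K.
Proof.
have [K K0 HK] := W_bounded M.
exists (1 + `|a2| * K); first by rewrite addr_ge0// mulr_ge0.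
move=> c u t wc uM; rewrite ger0_norm ?density_ge0// lerD ?lagr_le1//.
apply: ler_pM; rewrite ?W_ge0 ?weight_ge0//; last exact: HK.
by have [_ /(_ t)/andP[_ /le_trans]] := wc; apply; exact: ler_norm.
Qed.

Lemma locint_density c u (M : R) : weight c -> lip 1 u -> (forall t, `|u t| <= M) ->
  locint (density W c u).
Proof.
move=> wc Lu uM; have [K K0 HK] := density_bounded M.
apply: locint_bd; first exact: leb_measurable_density Lu cW wc.1.
by move=> n; exists K => t _; exact: HK.
Qed.

Lemma weight_locint c : weight c -> locint c.
Proof.
move=> [mc cb]; apply: locint_bd => // n; exists a2 => t _.
by have /andP[c1 c2] := cb t; rewrite ger0_norm// (le_trans (ltW a1_gt0)).
Qed.

Lemma locint_weight_comp c f u : weight c -> continuous f -> continuous u ->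
  locint (fun t => c t * f (u t)).
Proof.
move=> wc cf cu; apply: (locintM_cont c (f \o u)); first exact: weight_locint.
by move=> t; apply: continuous_comp; [exact: cu|exact: cf].
Qed.

Lemma weight_shift c z : weight c -> weight (fun t => c (t + z)).
Proof. by move=> [mc cb]; split => //; exact: leb_measurable_shift. Qed.

(** Finite energies are expressed by integrals on bounded intervals, which are real
    numbers and pass to limits by dominated convergence. *)
Definition energy_le c u (m : R) :=
  forall x y, x <= y -> \int[mu]_(t in `[x, y]) density W c u t <= m.

Lemma energy_leP c u (m : R) : weight c -> admissible u ->
  (energy W c u <= m%:E)%E <-> energy_le c u m.
Proof.
move=> wc au; have [Lu _ _] := au; have [M _ uM] := admissible_bounded _ au.
rewrite energyE//; last exact: wc.1.
apply: ge0_integral_leP; first exact: locint_density wc Lu uM.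
by move=> t; exact: density_ge0.
Qed.

Lemma energy_le_shift c v (m z : R) : weight c -> lip 1 v -> (forall t, `|v t| <= 1) ->
  energy_le c v m -> energy_le (fun t => c (t + z)) (fun t => v (t + z)) m.
Proof.
move=> wc Lv v1 Em x y xy.
have [K _ dK] := density_bounded 1.
have -> : density W (fun t => c (t + z)) (fun t => v (t + z)) =
    (fun t => density W c v (t + z)).
  by apply/funext => t; rewrite /density der_shift.
rewrite (int_shift z _ K)//; first by apply: Em; rewrite lerD2r.
  by have [] := locint_density _ _ _ wc Lv v1.
by move=> t; exact: dK.
Qed.

Lemma energy_le_weight c c' u (m : R) : weight c -> weight c' -> (forall t, c t <= c' t) ->
  admissible u -> energy_le c' u m -> energy_le c u m.
Proof.
move=> wc wc' cc' au Em x y xy; apply: le_trans (Em x y xy).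
have [M _ uM] := admissible_bounded _ au; have [Lu _ _] := au.
apply: (int_le _ _ _ _ (locint_density _ _ _ wc Lu uM) (locint_density _ _ _ wc' Lu uM)).
by move=> t _; rewrite lerD2l ler_wpM2r// W_ge0.
Qed.

(** * Normalized minimizing sequences *)

(** Truncation lowers the slope, and the potential vanishes where it acts. *)
Lemma truncation u : admissible u -> let v := clamp (-1) 1 \o u in
  [/\ admissible v, forall t, `|v t| <= 1 &
      forall c m, weight c -> energy_le c u m -> energy_le c v m].
Proof.
move=> au v; have [Lu up un] := au; have [M _ uM] := admissible_bounded _ au.
have cc := lip_continuous _ _ (lip_clamp (-1 : R) 1).
have v1 t : `|v t| <= 1.
  by rewrite ler_norml; apply: clamp_itv; rewrite -subr_ge0 opprK addr_ge0.
have Lv : lip 1 v by have := lip_comp _ _ _ _ (lip_clamp (-1) 1) Lu; rewrite mulr1.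
have av : admissible v.
  split => //.
    have := cvg_comp _ _ up (cc 1).
    by rewrite clampE// lexx -subr_ge0 opprK addr_ge0.
  have := cvg_comp _ _ un (cc (-1)).
  by rewrite clampE// lexx -subr_ge0 opprK addr_ge0.
split => // c m wc um x y xy; apply: le_trans (um x y xy).
apply: int_le_ae; [exact: locint_density wc Lv v1|exact: locint_density wc Lu uM|].
apply: (aeS _ _ (aeI _ _ (lip_ae_der _ _ Lu) (lip_ae_der _ _ Lv))) => t [du dv] _.
apply: lerD.
  apply/le_lagr/(le_norm_is_derive _ _ _ _ _ dv du) => z.
  by have := lip_clamp (-1) 1 (u z) (u t); rewrite mul1r.
rewrite ler_wpM2l ?weight_ge0//.
have [u1|u1] := leP (`|u t|) 1; first by rewrite /v /= clampE// -ler_norml.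
suff -> : W (v t) = 0 by exact: W_ge0.
rewrite /v /= /clamp.
have [u0|u0] := leP 0 (u t).
  by rewrite ger0_norm// in u1; rewrite (min_idPl (ltW u1)) (max_idPr _)//; lra.
rewrite ltr0_norm// in u1; rewrite (min_idPr _) ?(max_idPl _)//; lra.
Qed.

(** If [u], having reached [1 - eta], becomes negative later, then it spends a time at
    least [1/4] in [[0, 1/2]], where [W] is bounded below. It is cheaper to replace it by
    a ramp from [1 - eta] to [1] of length [eta], if [eta] is small. *)
Lemma normalization : exists2 eta : R, 0 < eta < 1 & forall c u (m : R),
  weight c -> admissible u -> energy_le c u m ->
  exists v tau, normalized eta v tau /\ energy_le c v m.
Proof.
have [k k0 Wk] := W_bounded_below 0 (1/2) ltac:(lra) ltac:(lra).
have [K K0 dK] := density_bounded 1.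
(* the cost [K eta] of the ramp must not exceed the cost [a1 k / 4] of spending a time
   [1/4] where [W] is at least [k] *)
pose eta : R := Num.min (4^-1) (a1 * k / 4 / (K + 1)).
have K10 : 0 < K + 1 by rewrite ltr_wpDl.
have q0 : 0 < a1 * k / 4 by rewrite divr_gt0// mulr_gt0.
have eta0 : 0 < eta by rewrite lt_min invr_gt0 ltr0n/= divr_gt0.
have eta4 : eta <= 4^-1 by rewrite ge_min lexx.
have etaK : K * eta <= a1 * k / 4.
  have : eta <= a1 * k / 4 / (K + 1) by rewrite ge_min lexx orbT.
  by rewrite ler_pdivlMr//; nra.
have eta1 : eta < 1 by lra.
exists eta; first by rewrite eta0.
move=> c u0 m wc au0 um0; have [au u1 /(_ c m wc um0) um] := truncation u0 au0.
move: (clamp (-1) 1 \o u0) au u1 um => {u0 au0 um0} u au u1 um.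
have [Lu up un] := au; have cu := lip_continuous _ _ Lu.
have [tau utau utl] := first_hitting u (1 - eta) cu up un ltac:(lra).
have [pos|/existsNP[s /not_implyP[ts /negP]]] := pselect (forall t, tau <= t -> 0 <= u t).
  by exists u, tau.
rewrite -ltNge => us.
pose v := glue tau u (ramp tau (1 - eta)).
have Lr : lip 1 (ramp tau (1 - eta)).
  have := lip_comp _ _ _ _ (lip_clamp (1 - eta) 1) (lip_shift 1 (1 - eta - tau) id _).
  by rewrite mulr1; apply => x y; rewrite mul1r.
have Lv : lip 1 v.
  apply: lip_glue => //; rewrite utau /ramp clampE; first by ring.
  by apply/andP; split; lra.
have vt t : tau + eta <= t -> v t = 1.
  move=> tt; rewrite /v /glue ifF; last by apply/negbTE; rewrite -ltNge; lra.
  by apply: ramp1; lra.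
have vr t : tau < t -> 1 - eta <= v t <= 1.
  move=> tt; rewrite /v /glue ifF; last by apply/negbTE; rewrite -ltNge.
  by apply: clamp_itv; lra.
have v1 t : `|v t| <= 1.
  have [tt|tt] := leP t tau; first by rewrite /v /glue tt.
  by have /andP[? ?] := vr t tt; rewrite ger0_norm//; lra.
have av : admissible v.
  split => //.
    apply: cvg_near_cst; near=> t; apply: vt; near: t.
    exact: nbhs_pinfty_ge (num_real _).
  apply: cvg_trans un; apply: near_eq_cvg; near=> t.
  rewrite /v /glue ifT//; near: t; exact: nbhs_ninfty_le (num_real _).
exists v, tau; split.
  split => // t tt; first by rewrite /v /glue tt; exact: utl.
  move: tt; rewrite le_eqVlt => /predU1P[<-|/vr/andP[? _]]; last by lra.
  by rewrite /v /glue lexx utau; lra.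
have lu := locint_density _ _ _ wc Lu u1; have lv := locint_density _ _ _ wc Lv v1.
have du0 t := density_ge0 _ u t wc; have dv0 t := density_ge0 _ v t wc.
(* at [s0] the function is halfway between the bounds of [[0, 1/2]] *)
have [s0 /[!in_itv]/= /andP[ts0 s0s] us0] : exists2 s0, s0 \in `[tau, s] & u s0 = 4^-1.
  apply: IVT => //; first exact: continuous_subspaceT.
  by rewrite utau minC /Num.min /Num.max ifT ?ifF; [apply/andP; split; lra|apply/negbTE; rewrite -leNgt; lra|lra].
have us0t : 2^-1 <= s0 - tau.
  have := Lu tau s0; rewrite mul1r utau us0.
  by rewrite (ler0_norm (_ : tau - s0 <= 0)) ?subr_le0// ler_norml => /andP[]; lra.
have cost : a1 * k / 4 <= \int[mu]_(t in `[tau, s0]) density W c u t.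
  have -> : a1 * k / 4 = a1 * k * (s0 - (s0 - 4^-1)) by lra.
  rewrite -int_cst; last by lra.
  apply: (@le_trans _ _ (\int[mu]_(t in `[s0 - 4^-1, s0]) density W c u t)); last first.
    by apply: int_subset => //; lra.
  apply: (int_le _ _ _ _ (locint_cst _) lu) => t /andP[t1 t2].
  have : 0 <= u t <= 1 / 2.
    have := Lu t s0; rewrite mul1r us0 (ler0_norm (_ : t - s0 <= 0)) ?subr_le0//.
    by rewrite ler_norml => /andP[? ?]; apply/andP; split; lra.
  move=> /Wk kW; have [_ /(_ t)/andP[ac _]] := wc.
  have akW := ler_pM (ltW a1_gt0) (ltW k0) ac kW.
  by rewrite (le_trans akW)// lerDr lagr_ge0.
move=> x y xy; pose x' := Num.min x tau; pose y' := Num.max y (tau + eta).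
have xx : x' <= x by rewrite ge_min lexx.
have xt : x' <= tau by rewrite ge_min lexx orbT.
have yy : y <= y' by rewrite le_max lexx.
have yt : tau + eta <= y' by rewrite le_max lexx orbT.
apply: (le_trans (int_subset _ _ _ _ _ lv dv0 xx xy yy)).
rewrite (int_add _ x' tau y' lv xt); last by lra.
rewrite (int_add _ tau (tau + eta) y' lv)//; last by rewrite lerDl ltW.
have -> : \int[mu]_(t in `[x', tau]) density W c v t =
    \int[mu]_(t in `[x', tau]) density W c u t.
  apply: int_ae => //; last exact: lu.1.
  apply: (aeS _ _ (ae_neq tau)) => t tt /andP[_ tt'].
  by rewrite /density der_glue_l ?lt_neqAle ?tt// /v /glue tt'.
have -> : \int[mu]_(t in `[tau + eta, y']) density W c v t = 0.
  rewrite (int_ae _ (fun=> 0)) ?int_cst ?mul0r//; last exact: leb_measurable_cst.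
  apply: (aeS _ _ (ae_neq (tau + eta))) => t tt /andP[tt' _].
  have {}tt : tau + eta < t by rewrite lt_neqAle eq_sym tt.
  rewrite /density vt// W_1 mulr0 addr0 (near_der _ (cst 1)); last first.
    near=> z; apply/vt/ltW; near: z; exact: lt_nbhsr.
  by rewrite (derE _ _ _ (is_derive_cst (1 : R) t (1 : R))) lagr0.
have ramp_le : \int[mu]_(t in `[tau, tau + eta]) density W c v t <= K * eta.
  have -> : K * eta = K * (tau + eta - tau) by ring.
  rewrite -int_cst; last by lra.
  apply: (int_le _ _ _ _ lv (locint_cst _)) => t _.
  by rewrite (le_trans (ler_norm _))// dK.
have := um x' s0 (le_trans xt ts0); rewrite (int_add _ x' tau s0 lu xt ts0); lra.
Unshelve. all: by end_near. Qed.

(** * Lower semicontinuity *)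

(** The increments of the energy dominate, by convexity of [lagr], quantities that are
    affine in [u]; these pass to pointwise limits, unlike the energy density. *)
Lemma energy_affine c u (p : R) x y : weight c -> lip 1 u -> (forall t, `|u t| <= 1) ->
  x <= y ->
  p * (u y - u x) + (1 - Num.sqrt (1 + p ^+ 2)) * (y - x) +
    \int[mu]_(t in `[x, y]) (c t * W (u t)) <=
  \int[mu]_(t in `[x, y]) density W c u t.
Proof.
move=> wc Lu u1 xy; have cu := lip_continuous _ _ Lu.
have lW := locint_weight_comp _ _ _ wc cW cu.
have ld := locint_der _ _ Lu; have lpd := locintZ p _ ld.
have lk := locint_cst (1 - Num.sqrt (1 + p ^+ 2)).
rewrite -(int_der _ _ _ _ Lu xy) -(intZ _ _ _ _ ld) -(int_cst _ _ _ xy).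
rewrite -(intD _ _ _ _ lpd lk) -(intD _ _ _ _ (locintD _ _ lpd lk) lW).
apply: (int_le _ _ _ _ (locintD _ _ (locintD _ _ lpd lk) lW) (locint_density _ _ _ wc Lu u1)) => t _.
rewrite /density /= lerD2r; apply: fenchel.
by exact: (le_norm_der_lip _ _ _ Lu).
Qed.

(** Along a subsequence, the primitives of the energy densities also converge, to some
    Lipschitz [Q]. The inequalities [energy_affine] pass to the limit, and show that the
    derivative of [Q] dominates all the functions of which the limit density is the
    supremum by [lagr_le_sup]. *)
Lemma energy_limit (c_ : nat -> R -> R) c (w_ : nat -> R -> R) (m : R) :
  (forall n, weight (c_ n)) -> weight c -> (forall t, c_ n t @[n --> \oo] --> c t) ->
  (forall n, lip 1 (w_ n)) -> (forall n t, `|w_ n t| <= 1) ->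
  (forall n, energy_le (c_ n) (w_ n) (m + n.+1%:R^-1)) ->
  exists w (s : nat -> nat), [/\ forall n, (n <= s n)%N, lip 1 w,
    forall t, w_ (s n) t @[n --> \oo] --> w t & energy_le c w m].
Proof.
move=> wc_ wc cc_ Lw_ w1_ Em.
have [K K0 dK] := density_bounded 1.
pose e n := density W (c_ n) (w_ n).
have le n : locint (e n) := locint_density _ _ _ (wc_ n) (Lw_ n) (w1_ n).
have [P HP] := choice (fun n => ex_primitive _ (le n)).
have LP n : lip K (P n).
  by apply: lip_primitive (le n) _ (HP n) => t; exact: dK.
have [s1 [w [ms1 Lw ww]]] := lip_selection 1 w_ (fun=> 1) Lw_ w1_.
pose P0 m t := P (s1 m) t - P (s1 m) 0.
have LP0 k : lip K (P0 k).
  by move=> x y; rewrite /P0 opprB addrA subrK; exact: LP.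
have P0B k t : `|P0 k t| <= K * `|t|.
  by have := LP (s1 k) t 0; rewrite subr0.
have [s2 [Q [ms2 LQ QQ]]] := lip_selection K P0 (fun t => K * `|t|) LP0 P0B.
pose s k := s1 (s2 k).
have ms k : (k <= s k)%N by exact: leq_trans (ms2 k) (ms1 _).
have {}ww t : w_ (s n) t @[n --> \oo] --> w t by exact: (cvg_selection (fun k => w_ (s1 k) t) s2).
have cw := lip_continuous _ _ Lw.
have w1 t : `|w t| <= 1 by apply: (cvg_le_cst _ _ _ (cvg_norm (ww t))) => n.
have QP x y : P (s n) y - P (s n) x @[n --> \oo] --> Q y - Q x.
  have -> : (fun n => P (s n) y - P (s n) x) = (fun n => P0 (s2 n) y - P0 (s2 n) x).
    by apply/funext => n; rewrite /P0 /s; ring.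
  exact: cvgB (QQ y) (QQ x).
exists w, s; split => //.
have lg := locint_weight_comp _ _ _ wc cW cw.
have [V HV] := ex_primitive _ lg.
have lim_int x y : \int[mu]_(t in `[x, y]) (c_ (s n) t * W (w_ (s n) t)) @[n --> \oo]
    --> \int[mu]_(t in `[x, y]) (c t * W (w t)).
  apply: (int_dominated _ _ (fun=> K)).
  - by move=> n; have [] := locint_weight_comp _ _ _ (wc_ (s n)) cW (lip_continuous _ _ (Lw_ (s n))).
  - by case: lg.
  - by case: (locint_cst K).
  - apply: aeT => t _; apply: cvgM; first exact: (cvg_selection _ _ _ ms (cc_ t)).
    by apply: continuous_cvg; [exact: cW|exact: ww].
  - move=> n t _; have := dK _ _ t (wc_ (s n)) (w1_ (s n) t); apply: le_trans.
    rewrite !ger0_norm ?density_ge0// ?mulr_ge0 ?W_ge0 ?weight_ge0//.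
    by rewrite /density lerDr lagr_ge0.
have Qge (p : R) x y : x <= y ->
    p * w x + (1 - Num.sqrt (1 + p ^+ 2)) * x + V x - Q x >=
    p * w y + (1 - Num.sqrt (1 + p ^+ 2)) * y + V y - Q y.
  move=> xy; rewrite -subr_ge0.
  set k := 1 - _.
  have -> : (p * w x + k * x + V x - Q x) - (p * w y + k * y + V y - Q y) =
    Q y - Q x - (p * (w y - w x) + k * (y - x) + (V y - V x)) by ring.
  have Hlim : P (s n) y - P (s n) x - (p * (w_ (s n) y - w_ (s n) x) + k * (y - x) +
      \int[mu]_(t in `[x, y]) (c_ (s n) t * W (w_ (s n) t))) @[n --> \oo] -->
      Q y - Q x - (p * (w y - w x) + k * (y - x) + (V y - V x)).
    rewrite HV//; apply: (cvgB (QP x y)); apply: cvgD (lim_int x y).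
    apply: cvgD (cvg_cst _); apply: cvgM (cvg_cst _) _; exact: cvgB (ww y) (ww x).
  apply: (cvg_ge_cst _ _ _ Hlim) => n; rewrite subr_ge0 HP//; exact: energy_affine.
have dens : {ae mu, forall t, density W c w t <= der Q t}.
  apply: (aeS _ _ (aeI _ _ (lip_ae_der _ _ Lw) (aeI _ _ (lip_ae_der _ _ LQ) (ae_derive_primitive _ _ lg HV)))).
  move=> t [dw [dQ dV]]; rewrite /density -lerBrDr.
  apply: lagr_le_sup; first by exact: (le_norm_der_lip _ _ _ Lw).
  move=> p; set k := 1 - _.
  suff : 0 <= der Q t - (p * der w t + k + c t * W (w t)) by lra.
  apply: (nondecreasing_is_derive (fun z => Q z - (p * w z + k * z + V z)) t).
    by move=> x y xy; have := Qge p x y xy; rewrite -/k; lra.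
  have dk := is_derive_scale id k t 1 (is_derive_id t (1 : R)).
  rewrite mulr1 in dk.
  exact: (is_derive_sub _ _ _ _ _ dQ (is_derive_add _ _ _ _ _
    (is_derive_add _ _ _ _ _ (is_derive_scale w p t _ dw) dk) dV)).
move=> x y xy; apply: (@le_trans _ _ (Q y - Q x)).
  rewrite -(int_der _ _ _ _ LQ xy); apply: int_le_ae.
  - exact: locint_density wc Lw w1.
  - exact: locint_der LQ.
  - by apply: (aeS _ _ dens) => t + _.
have : m + n.+1%:R^-1 - (P (s n) y - P (s n) x) @[n --> \oo] --> m + 0 - (Q y - Q x).
  apply: cvgB (QP x y); apply: cvgD; first exact: cvg_cst.
  exact: cvg_harmonic.
rewrite addr0 => Hlim; rewrite -subr_ge0; apply: (cvg_ge_cst _ _ _ Hlim) => n.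
rewrite subr_ge0 HP// (le_trans (Em (s n) x y xy))// lerD2l lef_pV2 ?posrE ?ltr0n// ler_nat ltnS.
exact: ms.
Qed.

(** The density is bounded below where [w] is away from the wells, so that [barbalat]
    applies to [w - 1] near [+oo] and to [w + 1] near [-oo]. *)
Lemma admissible_of_energy c w (m eta T0 : R) : weight c -> lip 1 w ->
  (forall t, `|w t| <= 1) -> energy_le c w m -> 0 < eta < 1 ->
  (forall t, T0 <= t -> 0 <= w t) -> (forall t, t <= - T0 -> w t <= 1 - eta) ->
  admissible w.
Proof.
move=> wc Lw w1 Em /andP[eta0 eta1] wp wn.
have ld := locint_density _ _ _ wc Lw w1.
have d0 t := density_ge0 _ w t wc.
have Lwk (k : R) : lip 1 (fun t => w t - k).
  by move=> x y; rewrite opprB addrA subrK; exact: Lw.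
have dW (k : R) t : 0 <= k -> k <= W (w t) -> a1 * k <= density W c w t.
  move=> k0 kW; have [_ /(_ t)/andP[ac _]] := wc.
  by rewrite (le_trans (ler_pM (ltW a1_gt0) k0 ac kW))// lerDr lagr_ge0.
split => //.
  suff H (eps : R) : 0 < eps -> \forall t \near +oo, `|1 - w t| < eps.
    by apply/cvgrPdist_lt => eps; exact: H.
  move=> eps0; have [k k0 Hk] := W_bounded_below 0 (1 - eps / 2) ltac:(lra) ltac:(lra).
  have [||A HA] := barbalat (fun t => w t - 1) _ _ _ eps (a1 * k) [set t | T0 <= t]
      (Lwk 1) ld d0 Em eps0.
  - exact: mulr_gt0.
  - move=> t /wp w0 /=; have := w1 t; rewrite ger0_norm// => w1' we.
    apply: dW; first exact: ltW.
    apply: Hk; rewrite w0 /=; move: we; rewrite ler0_norm ?subr_le0//; lra.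
  near=> t; rewrite distrC; apply: HA.
    have : Num.max A 0 <= t by near: t; exact: nbhs_pinfty_ge (num_real _).
    by rewrite ge_max => /andP[At t0]; rewrite ger0_norm.
  move=> s /andP[ts _] /=; apply: le_trans ts.
  by near: t; exact: nbhs_pinfty_ge (num_real _).
suff H (eps : R) : 0 < eps -> \forall t \near -oo, `|(-1) - w t| < eps.
  by apply/cvgrPdist_lt => eps; exact: H.
move=> eps0; have [k k0 Hk] := W_bounded_below (-1 + eps / 2) (1 - eta) ltac:(lra) ltac:(lra).
have [||A HA] := barbalat (fun t => w t - (-1)) _ _ _ eps (a1 * k) [set t | t <= - T0]
    (Lwk (-1)) ld d0 Em eps0.
- exact: mulr_gt0.
- move=> t /wn wt /=; have := w1 t; rewrite ler_norml => /andP[wN1 _].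
  rewrite ger0_norm; last by lra.
  by move=> we; apply: dW; [exact: ltW|apply: Hk; apply/andP; split; lra].
near=> t; rewrite distrC; apply: HA.
  have : t <= Num.min (- A) 0 by near: t; exact: nbhs_ninfty_le (num_real _).
  by rewrite le_min => /andP[At t0]; rewrite ler0_norm// lerNr.
move=> s /andP[_ st] /=; apply: (le_trans st); rewrite -lerBrDr.
by near: t; exact: nbhs_ninfty_le (num_real _).
Unshelve. all: by end_near. Qed.

(** * Existence of a minimizer *)

Definition minimizer c u := admissible u /\
  forall v m, admissible v -> energy_le c v m -> energy_le c u m.

Lemma minimizerP c u : weight c -> minimizer c u <-> attains_inf (energy W c) X1 u.
Proof.
move=> wc; have N1 v : admissible v -> energy_le c v (-1) -> False.
  move=> av /(_ 0 0 (lexx _)).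
  have := int_ge0 (density W c v) 0 0 (fun t _ => density_ge0 _ v t wc); lra.
split=> [[au umin]|[/X1P au uinf]].
  split; first exact/X1P.
  apply/eqP; rewrite eq_le; apply/andP; split; last first.
    by apply: ereal_inf_lbound; exists u => //; exact/X1P.
  apply: le_ereal_inf_tmp => _ [v /X1P av <-].
  case E : (energy W c v) => [m| |]; last 2 first.
  - by rewrite leey.
  - by exfalso; apply: (N1 v av); apply/(energy_leP _ _ _ wc av); rewrite E leNye.
  apply/(energy_leP _ _ _ wc au)/(umin v m av)/(energy_leP _ _ _ wc av).
  by rewrite E.
split => // v m av /(energy_leP _ _ _ wc av) Ev.
apply/(energy_leP _ _ _ wc au); rewrite uinf; apply: le_trans Ev.
by apply: ereal_inf_lbound; exists v => //; exact/X1P.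
Qed.

Lemma finite_energy_competitor c : weight c ->
  exists v (m : R), admissible v /\ energy_le c v m.
Proof.
move=> wc; pose v : R -> R := clamp (-1) 1.
have v1 t : `|v t| <= 1 by rewrite ler_norml; apply: clamp_itv; lra.
have vp t : 1 <= t -> v t = 1.
  by move=> t1; rewrite /v /clamp (min_idPl t1) (max_idPr _)//; lra.
have vn t : t <= -1 -> v t = -1.
  by move=> t1; rewrite /v /clamp (min_idPr _) ?(max_idPl t1)//; lra.
have Lv : lip 1 v := lip_clamp (-1) 1.
have av : admissible v.
  split => //; apply: cvg_near_cst; near=> t.
    by apply: vp; near: t; exact: nbhs_pinfty_ge (num_real _).
  by apply: vn; near: t; exact: nbhs_ninfty_le (num_real _).
have [K K0 dK] := density_bounded 1.
have lv := locint_density _ _ _ wc Lv v1.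
have d0 t := density_ge0 _ v t wc.
have out x y : (forall t, x < t < y -> density W c v t = 0) ->
    \int[mu]_(t in `[x, y]) density W c v t = 0.
  move=> v0; have [xy|yx] := leP x y; last first.
    by rewrite set_itv_ge ?Rintegral_set0// bnd_simp -ltNge.
  rewrite (int_ae _ (fun=> 0) _ _ lv) ?int_cst ?mul0r//; last exact: leb_measurable_cst.
  apply: (aeS _ _ (aeI _ _ (ae_neq x) (ae_neq y))) => t [tx ty] /andP[xt ty'].
  by apply: v0; rewrite !lt_neqAle xt ty' ty eq_sym tx.
have v_out (k : R) t : W k = 0 -> (\forall z \near t, v z = k) -> density W c v t = 0.
  move=> Wk vk; rewrite /density (near_der _ (cst k))//.
  rewrite (derE _ _ _ (is_derive_cst (k : R) t (1 : R))) lagr0.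
  by rewrite (nbhs_singleton vk) Wk mulr0 addr0.
exists v, (K * 2); split => // x y xy.
have x1 : Num.min x (-1) <= -1 by rewrite ge_min lexx orbT.
have y1 : 1 <= Num.max y 1 by rewrite le_max lexx orbT.
apply: (@le_trans _ _ (\int[mu]_(t in `[Num.min x (-1), Num.max y 1]) density W c v t)).
  by apply: int_subset => //; rewrite ?ge_min ?le_max lexx.
have N11 : -1 <= 1 :> R by lra.
rewrite (int_add _ _ (-1) _ lv x1 (le_trans N11 y1)) (int_add _ _ 1 _ lv N11 y1).
rewrite (out _ (-1)) ?(out 1) ?add0r ?addr0.
- have := int_norm_le _ _ _ K lv N11 (fun t _ => dK c v t wc (v1 t)).
  by move=> /(le_trans (ler_norm _)); rewrite (_ : 1 - -1 = 2)//; ring.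
- move=> t /andP[t1 _]; apply: (v_out 1) => //; near=> z; apply/vp/ltW.
  by near: z; exact: lt_nbhsr.
- move=> t /andP[_ t1]; apply: (v_out (-1)) => //; near=> z; apply/vn/ltW.
  by near: z; exact: lt_nbhsl.
Unshelve. all: by end_near. Qed.

(** A minimizing sequence either has a minimizer as a limit, or escapes to infinity, where
    it only sees the weight [b]; in the latter case the energy for [a] cannot be made
    smaller than the energy of [u_b] for [b], which is at least that for [a]. *)
Lemma exists_minimizer a b (T : R) u_b : weight a -> weight b -> 0 < T ->
  (forall (k : int) t, b (t + k%:~R * T) = b t) -> (forall t, a t <= b t) ->
  (forall eps : R, 0 < eps -> exists A : R, forall t, A <= `|t| -> `|b t - a t| < eps) ->
  minimizer b u_b -> exists u, minimizer a u.
Proof.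
move=> wa wb T0 bT ab b_a [aub ubmin].
pose S := [set m : R | exists v, admissible v /\ energy_le a v m].
have hS : has_inf S.
  split; first by have [v [m ?]] := finite_energy_competitor _ wa; exists m, v.
  exists 0 => m [v [av Em]]; apply: le_trans (Em 0 0 (lexx _)).
  by apply: int_ge0 => t _; exact: density_ge0.
have infS v m : admissible v -> energy_le a v m -> inf S <= m.
  by move=> av Em; apply: (ge_inf hS.2); exists v.
have [eta eta01 norm] := normalization.
have /choice[vt vtP] : forall n : nat, exists vt : (R -> R) * R,
    normalized eta vt.1 vt.2 /\ energy_le a vt.1 (inf S + n.+1%:R^-1).
  move=> n; have n0 : 0 < n.+1%:R^-1 :> R by rewrite invr_gt0 ltr0n.
  have [m [v [av Em]] mn] := inf_adherent n0 hS.
  have [|v' [tau [gv Ev']]] := norm a v (inf S + n.+1%:R^-1) wa av.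
    by move=> x y xy; rewrite (le_trans (Em x y xy))// ltW.
  by exists (v', tau).
pose v n := (vt n).1; pose tau n := (vt n).2.
have gv n : normalized eta (v n) (tau n) by have [] := vtP n.
have Ev n : energy_le a (v n) (inf S + n.+1%:R^-1) by have [] := vtP n.
have Lv n : lip 1 (v n) by have [[]] := gv n.
have v1 n t : `|v n t| <= 1 by have [] := gv n.
have tauP n t : t <= tau n -> v n t <= 1 - eta by have [_ _ + _] := gv n; apply.
have tauN n t : tau n <= t -> 0 <= v n t by have [_ _ _] := gv n; apply.
(* it suffices to find translations after which the times [tau] are bounded along a
   subsequence and the weights converge *)
have attained c (z_ : nat -> R) (s : nat -> nat) (r : R) : weight c ->
    (forall n, (n <= s n)%N) -> (forall t, a (t + z_ n) @[n --> \oo] --> c t) ->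
    (forall n, `|tau (s n) - z_ n| <= r) ->
    exists w, admissible w /\ energy_le c w (inf S).
  move=> wc ns ac taur.
  have [||||||w [s' [ss' Lw ww Ew]]] := energy_limit (fun n t => a (t + z_ n)) c
      (fun n t => v (s n) (t + z_ n)) (inf S).
  - by move=> n; exact: weight_shift.
  - by [].
  - exact: ac.
  - by move=> n; apply: lip_shift.
  - by move=> n t; exact: v1.
  - move=> n; apply: (energy_le_shift a (v (s n))) => // x y xy.
    rewrite (le_trans (Ev (s n) x y xy))// lerD2l lef_pV2 ?posrE ?ltr0n// ler_nat ltnS.
    exact: ns.
  exists w; split => //.
  have w1 t : `|w t| <= 1 by apply: (cvg_le_cst _ _ _ (cvg_norm (ww t))) => n; exact: v1.
  apply: (admissible_of_energy c w (inf S) eta r) => // t tr.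
    apply: (cvg_ge_cst _ _ _ (ww t)) => n; apply: tauN.
    by have := taur (s' n); rewrite ler_norml => /andP[_]; lra.
  apply: (cvg_le_cst _ _ _ (ww t)) => n; apply: tauP.
  by have := taur (s' n); rewrite ler_norml => /andP[+ _]; lra.
have [[r Hr]|escape] := pselect (exists r : R, forall N, exists n, (N <= n)%N /\ `|tau n| <= r).
  have [s sP] := choice Hr.
  have [||||w [aw Ew]] := attained a (fun=> 0) s r.
  - by [].
  - by move=> n; have [] := sP n.
  - by move=> t; apply: cvg_near_cst; apply: nearW => n; rewrite addr0.
  - by move=> n; rewrite subr0; have [] := sP n.
  exists w; split => // u m au /(infS _ _ au) Sm x y xy.
  exact: le_trans (Ew x y xy) Sm.
have {}escape r : exists N, forall n, (N <= n)%N -> r < `|tau n|.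
  apply: contrapT => H; apply: escape; exists r => N.
  apply: contrapT => H'; apply: H; exists N => n Nn.
  by rewrite ltNge; apply/negP => tr; apply: H'; exists n.
(* translated by multiples of the period, the times [tau] lie in [[0, T]] *)
pose k n : int := Num.floor (tau n / T).
have kP n : 0 <= tau n - (k n)%:~R * T < T.
  have := floor_itv (tau n / T); rewrite -/(k n) => /andP[].
  rewrite ler_pdivlMr// ltr_pdivrMr// intrD mulrDl mul1r => ? ?.
  by apply/andP; split; lra.
have [||||w [aw Ew]] := attained b (fun n => (k n)%:~R * T) id T.
- by [].
- by [].
- move=> t.
  suff H (eps : R) : 0 < eps -> \forall n \near \oo, `|b t - a (t + (k n)%:~R * T)| < eps.
    by apply/cvgrPdist_lt => eps; exact: H.
  move=> eps0; have [A HA] := b_a eps eps0.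
  have [N HN] := escape (A + `|t| + T).
  exists N => // n /= /HN tn; rewrite -(bT (k n) t); apply: HA.
  have /andP[k0 kT] := kP n.
  have : `|tau n| <= `|t + (k n)%:~R * T| + `|t| + T; last by lra.
  have -> : tau n = (t + (k n)%:~R * T) - t + (tau n - (k n)%:~R * T) by ring.
  rewrite (le_trans (ler_normD _ _))// lerD ?ler_normB//.
  by rewrite ger0_norm// ltW.
- by move=> n; have /andP[? ?] := kP n; rewrite ger0_norm// ltW.
exists u_b; split => // u m au /(infS _ _ au) Sm.
apply: (energy_le_weight a b) => // x y xy.
exact: le_trans (ubmin _ _ aw Ew x y xy) Sm.
Qed.

(** The value of [b] at [t] is also taken far away, where [b] is close to [a]. *)
Lemma periodic_bounded (a b : R -> R) (T : R) : 0 < T ->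
  (forall (k : int) t, b (t + k%:~R * T) = b t) -> (forall t, a t <= a2) ->
  (forall eps : R, 0 < eps -> exists A : R, forall t, A <= `|t| -> `|b t - a t| < eps) ->
  forall t, b t <= a2.
Proof.
move=> T0 bT aa2 b_a t; apply/ler_addgt0Pr => eps /b_a[A HA].
pose k : int := Num.floor ((`|A| + `|t|) / T) + 1.
have kT : `|A| + `|t| <= k%:~R * T.
  by rewrite -ler_pdivrMr// ltW// /k; exact: floorD1_gt.
rewrite -(bT k t); have := HA (t + k%:~R * T); have := aa2 (t + k%:~R * T).
have : A <= `|t + k%:~R * T|.
  have := ler_norm A; have := ler_norm (t + k%:~R * T); have := ler_norm (- t).
  by rewrite normrN; lra.
move=> -> + /(_ isT); rewrite ltr_norml => + /andP[_]; lra.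
Qed.

(** * The Euler-Lagrange equation *)

(** Otherwise the total energy of [w] would be less than that of [u]. *)
Lemma minimizer_local c u w x y : weight c -> minimizer c u -> admissible w -> x <= y ->
  (forall t, t <= x -> w t = u t) -> (forall t, y <= t -> w t = u t) ->
  \int[mu]_(t in `[x, y]) density W c u t <= \int[mu]_(t in `[x, y]) density W c w t.
Proof.
move=> wc [au umin] aw xy wx wy.
have [Lu _ _] := au; have [Lw _ _] := aw.
have [M _ uM] := admissible_bounded _ au; have [M' _ wM] := admissible_bounded _ aw.
have lu := locint_density _ _ _ wc Lu uM; have lw := locint_density _ _ _ wc Lw wM.
have u0 t := density_ge0 _ u t wc; have w0 t := density_ge0 _ w t wc.
have [v [m [av Ev]]] := finite_energy_competitor _ wc.
have Eu := umin _ _ av Ev.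
pose S := [set r : R | exists x' y', x' <= y' /\ r = \int[mu]_(t in `[x', y']) density W c u t].
have hS : has_sup S.
  split; first by exists (\int[mu]_(t in `[0, 0]) density W c u t), 0, 0.
  by exists m => _ [x' [y' [xy' ->]]]; exact: Eu.
rewrite leNgt; apply/negP; set Iw := Rintegral _ _ _; set Iu := Rintegral _ _ _ => lt_wu.
have d0 : 0 < Iu - Iw by rewrite subr_gt0.
(* the supremum of the integrals for [u] could be lowered by [Iu - Iw] *)
suff /(umin _ _ aw) Eu' : energy_le c w (sup S - (Iu - Iw)).
  have : sup S <= sup S - (Iu - Iw).
    by apply: (ge_sup hS.1) => _ [x' [y' [xy' ->]]]; exact: Eu'.
  by rewrite lerBrDl gerDr leNgt d0.
move=> x' y' xy'.
pose X := Num.min x x'; pose Y := Num.max y y'.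
have Xx : X <= x by rewrite ge_min lexx.
have yY : y <= Y by rewrite le_max lexx.
have eq_out p q : p <= q -> q <= x \/ y <= p ->
    \int[mu]_(t in `[p, q]) density W c w t = \int[mu]_(t in `[p, q]) density W c u t.
  move=> pq out; apply: int_ae => //; last by case: lu.
  apply: (aeS _ _ (aeI _ _ (ae_neq p) (ae_neq q))) => t [tp tq] /andP[pt qt].
  have {}pt : p < t by rewrite lt_neqAle eq_sym tp.
  have {}qt : t < q by rewrite lt_neqAle tq.
  have wu : \forall s \near t, w s = u s.
    near=> s; case: out => [qx|yp].
      by apply/wx/(le_trans _ qx)/ltW; near: s; exact: lt_nbhsl.
    by apply/wy/(le_trans yp)/ltW; near: s; exact: lt_nbhsr.
  by rewrite /density (near_der _ _ _ wu) (nbhs_singleton wu).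
apply: (@le_trans _ _ (\int[mu]_(t in `[X, Y]) density W c w t)).
  by apply: int_subset => //; rewrite ?ge_min ?le_max lexx orbT.
have SXY : \int[mu]_(t in `[X, Y]) density W c u t <= sup S.
  by apply: (ub_le_sup hS.2); exists X, Y; split => //; rewrite (le_trans Xx)// (le_trans xy).
move: SXY; rewrite (int_add _ X x Y lu Xx (le_trans xy yY)) (int_add _ x y Y lu xy yY).
rewrite (int_add _ X x Y lw Xx (le_trans xy yY)) (int_add _ x y Y lw xy yY).
rewrite (eq_out X x Xx (or_introl (lexx _))) (eq_out y Y yY (or_intror (lexx _))).
by rewrite -/Iu -/Iw; lra.
Unshelve. all: by end_near. Qed.

(** The first variation of the energy along [u + s (v - u)] as [s] decreases to 0. The
    kinetic term need not be differentiable in this direction; it is bounded by means of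
    its convexity, and only the potential term is differentiated. *)
Lemma variational_inequality c (W' : R -> R) u v x y : weight c ->
  (forall t, is_derive t 1 W (W' t)) -> continuous W' ->
  minimizer c u -> admissible v -> x <= y ->
  (forall t, t <= x -> v t = u t) -> (forall t, y <= t -> v t = u t) ->
  0 <= \int[mu]_(t in `[x, y])
    (lagr (der v t) - lagr (der u t) + c t * (W' (u t)) * (v t - u t)).
Proof.
move=> wc dW cW' mu_ av xy vx vy; have [au _] := mu_.
have [Lu up un] := au; have [Lv vp vn] := av.
have [M1 M10 uM1] := admissible_bounded _ au; have [M2 M20 vM2] := admissible_bounded _ av.
pose M := M1 + M2.
pose us (s : R) t := u t + s * (v t - u t).
have usE s t : us s t = (1 - s) * u t + s * v t by rewrite /us; ring.
have usM s t : 0 <= s <= 1 -> `|us s t| <= M.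
  move=> /andP[s0 s1]; rewrite usE (le_trans (ler_normD _ _))// !normrM.
  rewrite (ger0_norm s0) (ger0_norm (_ : 0 <= 1 - s)) ?subr_ge0//.
  by have := uM1 t; have := vM2 t; rewrite /M; nra.
have usp s : us s t @[t --> +oo] --> (1 : R).
  apply: cvg_trans up; apply: near_eq_cvg; near=> t.
  have yt : y <= t by near: t; exact: nbhs_pinfty_ge (num_real _).
  by rewrite /us vy// subrr mulr0 addr0.
have usn s : us s t @[t --> -oo] --> (-1 : R).
  apply: cvg_trans un; apply: near_eq_cvg; near=> t.
  have tx : t <= x by near: t; exact: nbhs_ninfty_le (num_real _).
  by rewrite /us vx// subrr mulr0 addr0.
have Lus s : 0 <= s <= 1 -> lip 1 (us s).
  move=> /andP[s0 s1] p q; rewrite !usE mul1r.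
  have -> : (1 - s) * u p + s * v p - ((1 - s) * u q + s * v q) =
    (1 - s) * (u p - u q) + s * (v p - v q) by ring.
  rewrite (le_trans (ler_normD _ _))// !normrM.
  rewrite (ger0_norm s0) (ger0_norm (_ : 0 <= 1 - s)) ?subr_ge0//.
  by have := Lu p q; have := Lv p q; rewrite !mul1r; nra.
have cu := lip_continuous _ _ Lu; have cv := lip_continuous _ _ Lv.
have cvu : continuous (fun t => v t - u t) by move=> t; apply: cvgB; [exact: cv|exact: cu].
have du1 t : `|der u t| <= 1 by exact: (le_norm_der_lip _ _ _ Lu).
have dv1 t : `|der v t| <= 1 by exact: (le_norm_der_lip _ _ _ Lv).
have lA := locintB _ _ (locint_lagr_der _ Lv) (locint_lagr_der _ Lu).
pose e_ (n : nat) : R := n.+1%:R^-1.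
have e0 n : 0 < e_ n by rewrite invr_gt0 ltr0n.
have e01 n : 0 <= e_ n <= 1 by rewrite ltW//= invf_le1 ?ler1n// ltr0n.
pose D n t := c t * ((W (us (e_ n) t) - W (u t)) / e_ n).
have lD n : locint (D n).
  apply: (locintM_cont c (fun t => (W (us (e_ n) t) - W (u t)) / e_ n)).
    exact: weight_locint.
  move=> t; apply: cvgM; last exact: cvg_cst.
  apply: cvgB; last exact: (continuous_comp (cu t) (@cW _)).
  exact: (continuous_comp (lip_continuous _ _ (Lus _ (e01 n)) t) (@cW _)).
have u1 : forall t, `|u t| <= M by move=> t; rewrite (le_trans (uM1 t))// lerDl ltW.
have ldu := locint_density _ _ _ wc Lu u1.
have int_ge0' n : 0 <= \int[mu]_(t in `[x, y]) (lagr (der v t) - lagr (der u t)) +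
    \int[mu]_(t in `[x, y]) D n t.
  have au_n : admissible (us (e_ n)) by split; [exact: Lus|exact: usp|exact: usn].
  have := minimizer_local c u (us (e_ n)) x y wc mu_ au_n xy.
  have H1 t : t <= x -> us (e_ n) t = u t by move=> tx; rewrite /us vx// subrr mulr0 addr0.
  have H2 t : y <= t -> us (e_ n) t = u t by move=> tx; rewrite /us vy// subrr mulr0 addr0.
  move=> /(_ H1 H2).
  have lAD := locintD _ _ lA (lD n).
  have le_us : \int[mu]_(t in `[x, y]) density W c (us (e_ n)) t <=
     \int[mu]_(t in `[x, y]) (density W c u t + e_ n * (lagr (der v t) - lagr (der u t) + D n t)).
    apply: int_le_ae.
    - exact: locint_density wc (Lus _ (e01 n)) (fun t => usM _ t (e01 n)).
    - exact: (locintD _ _ ldu (locintZ (e_ n) _ lAD)).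
    - apply: (aeS _ _ (aeI _ _ (lip_ae_der _ _ Lu) (lip_ae_der _ _ Lv))) => t [du dv] _.
      rewrite /density.
      have -> : der (us (e_ n)) t = der u t + e_ n * (der v t - der u t).
        exact: (derE _ _ _ (is_derive_add _ _ _ _ _ du
          (is_derive_scale _ (e_ n) _ _ (is_derive_sub _ _ _ _ _ dv du)))).
      have := lagr_convex _ _ _ (du1 t) (dv1 t) (e01 n).
      have -> : e_ n * (lagr (der v t) - lagr (der u t) + D n t) =
          e_ n * (lagr (der v t) - lagr (der u t)) + c t * (W (us (e_ n) t) - W (u t)).
        rewrite mulrDr; congr (_ + _); rewrite /D mulrCA; congr (_ * _).
        by rewrite mulrC divfK// gt_eqF.
      by lra.
  move=> /le_trans/(_ le_us).
  rewrite (intD _ _ _ _ ldu (locintZ (e_ n) _ lAD)) lerDl (intZ _ _ _ _ lAD).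
  by rewrite pmulr_rge0// (intD _ _ _ _ lA (lD n)).
have [C C0 HC] := C1_local_lip W W' M dW cW'.
have lh : locint (fun t => c t * W' (u t) * (v t - u t)).
  apply: locintM_cont cvu; exact: locint_weight_comp.
have limD : \int[mu]_(t in `[x, y]) D n t @[n --> \oo] -->
    \int[mu]_(t in `[x, y]) (c t * W' (u t) * (v t - u t)).
  apply: (int_dominated _ _ (fun=> a2 * (C * M))).
  - by move=> n; case: (lD n).
  - by case: lh.
  - by case: (locint_cst (a2 * (C * M))).
  - apply: aeT => t _; rewrite -mulrA; apply: cvgM; first exact: cvg_cst.
    exact: difference_quotient.
  - move=> n t _; rewrite /D normrM; apply: ler_pM => //.
      by have [_ /(_ t)/andP[ac ca]] := wc; rewrite ger0_norm// (le_trans (ltW a1_gt0)).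
    rewrite normrM normfV (gtr0_norm (e0 n)) ler_pdivrMr//.
    rewrite (le_trans (HC _ _ (usM _ t (e01 n)) (u1 t)))// -mulrA ler_wpM2l//.
    rewrite /us addrAC subrr add0r normrM (gtr0_norm (e0 n)) mulrC ler_wpM2r ?(ltW (e0 n))//.
    by rewrite (le_trans (ler_normB _ _))// addrC lerD.
rewrite (intD _ _ _ _ lA lh).
by apply: (cvg_ge_cst _ _ _ (cvgD (cvg_cst _) limD)) => n; exact: int_ge0'.
Unshelve. all: by end_near. Qed.

(** The left-hand side is continuous and nondecreasing in [k], and covers by [psi_surj]
    all the values between [- (y - x)] and [y - x]. *)
Lemma prescribed_flux (H : R -> R) (x y q : R) : continuous H -> x < y ->
  `|q| < y - x -> exists k : R, \int[mu]_(t in `[x, y]) psi (k + H t) = q.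
Proof.
move=> cH xy qxy.
have yx0 : 0 < y - x by rewrite subr_gt0.
have lpsi (k : R) : locint (fun t => psi (k + H t)).
  apply: locint_cont => t.
  apply: (@continuous_comp _ _ _ (fun t => k + H t) psi).
    by apply: cvgD; [exact: cvg_cst|exact: cH].
  exact: (lip_continuous _ _ psi_lip).
pose F (k : R) : R := \int[mu]_(t in `[x, y]) psi (k + H t).
have LF : lip (y - x) F.
  move=> k k'; rewrite /F -(intB _ _ _ _ (lpsi k) (lpsi k')) mulrC.
  apply: (int_norm_le _ _ _ _ (locintB _ _ (lpsi k) (lpsi k')) (ltW xy)) => t _.
  have := psi_lip (k + H t) (k' + H t).
  by rewrite mul1r opprD addrACA subrr addr0.
have [B B0 HB] := continuous_bounded H (`|x| + `|y|) cH.
have {}HB t : x <= t <= y -> `|H t| <= B.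
  move=> /andP[xt ty]; apply: HB; rewrite ler_norml; apply/andP; split.
    by have := ler_norm (- x); rewrite normrN; have := normr_ge0 y; lra.
  by have := ler_norm y; have := normr_ge0 x; lra.
have q1 : `|q / (y - x)| < 1 by rewrite normrM normfV (gtr0_norm yx0) ltr_pdivrMr// mul1r.
(* [k0] is the constant flux for which the mean slope is [q / (y - x)] *)
pose k0 := q / (y - x) / Num.sqrt (1 - (q / (y - x)) ^+ 2).
have k0q : psi k0 = q / (y - x) by exact: psi_surj.
have qE : q = psi k0 * (y - x) by rewrite k0q divfK// gt_eqF.
have BB : k0 - B <= k0 + B by lra.
have Fl : F (k0 - B) <= q.
  rewrite qE -(int_cst _ _ _ (ltW xy)); apply: (int_le _ _ _ _ (lpsi _) (locint_cst _)) => t xty.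
  by apply: le_psi; have := HB t xty; rewrite ler_norml => /andP[_]; lra.
have Fr : q <= F (k0 + B).
  rewrite qE -(int_cst _ _ _ (ltW xy)); apply: (int_le _ _ _ _ (locint_cst _) (lpsi _)) => t xty.
  by apply: le_psi; have := HB t xty; rewrite ler_norml => /andP[+ _]; lra.
have Fq : Num.min (F (k0 - B)) (F (k0 + B)) <= q <= Num.max (F (k0 - B)) (F (k0 + B)).
  by rewrite ge_min Fl le_max Fr orbT.
have [k _ Fk] := IVT BB (continuous_subspaceT (lip_continuous _ _ LF)) Fq.
by exists k.
Qed.

(** [variational_inequality] for the competitor [v] of slope [psi (k + H)]. Integrated by
    parts, it says that the integral of the gap in the Fenchel-Young inequality for [u']
    and [k + H] is at most 0; the gap then vanishes, and [fenchel_eq] applies. *)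
Lemma euler_lagrange_local c (W' : R -> R) u (H : R -> R) (C x y : R) : weight c ->
  (forall t, is_derive t 1 W (W' t)) -> continuous W' -> minimizer c u ->
  lip C H -> (forall p q, p <= q -> H q - H p = \int[mu]_(t in `[p, q]) (c t * W' (u t))) ->
  x < y -> `|u y - u x| < y - x ->
  exists k : R, forall t, x < t < y -> is_derive t 1 u (psi (k + H t)).
Proof.
move=> wc dW cW' min_u LH HH xy uxy.
have [au _] := min_u; have [Lu up un] := au.
have cu := lip_continuous _ _ Lu; have cH := lip_continuous _ _ LH.
have [k Ik] := prescribed_flux H x y (u y - u x) cH xy uxy.
exists k; pose p t := k + H t.
have Lp : lip C p by move=> s t; rewrite /p opprD addrACA subrr add0r.
have cp := lip_continuous _ _ Lp.
have cpsi : continuous (fun t => psi (p t)).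
  move=> t; exact: (continuous_comp (cp t) (lip_continuous _ _ psi_lip _)).
have lpsi := locint_cont _ cpsi.
have [G HG] := ex_primitive _ lpsi.
have dG := is_derive_primitive _ _ cpsi HG.
have LG : lip 1 G.
  by apply: (C1_lip _ _ _ dG) => t; exact/ltW/psi_lt1.
pose v0 t := u x + (G t - G x).
have Lv0 : lip 1 v0.
  by move=> s t; rewrite /v0 opprD addrACA subrr add0r opprB addrA subrK; exact: LG.
have v0x : v0 x = u x by rewrite /v0 subrr addr0.
have v0y : v0 y = u y by rewrite /v0 HG ?(ltW xy)// Ik; ring.
pose v := glue x u (glue y v0 u).
have vx t : t <= x -> v t = u t by move=> tx; rewrite /v /glue tx.
have vy t : y <= t -> v t = u t.
  move=> yt; rewrite /v /glue ifF; last by apply/negbTE; rewrite -ltNge (lt_le_trans xy).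
  case: ifP => // ty; have -> : t = y by apply/le_anti; rewrite ty yt.
  exact: v0y.
have Lv : lip 1 v.
  apply: lip_glue => //; first exact: lip_glue.
  by rewrite /glue (ltW xy) v0x.
have av : admissible v.
  split => //.
    apply: cvg_trans up; apply: near_eq_cvg; near=> t.
    by apply/esym/vy; near: t; exact: nbhs_pinfty_ge (num_real _).
  apply: cvg_trans un; apply: near_eq_cvg; near=> t.
  by apply/esym/vx; near: t; exact: nbhs_ninfty_le (num_real _).
have dv t : x < t < y -> der v t = psi (p t).
  move=> /andP[xt ty]; rewrite /v der_glue_r// der_glue_l//.
  have := is_derive_add _ _ _ _ _ (is_derive_cst (u x : R) t (1 : R))
    (is_derive_sub _ _ _ _ _ (dG t) (is_derive_cst (G x : R) t (1 : R))).
  by rewrite add0r subr0 => /derE.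
have ineq := variational_inequality _ _ _ _ _ _ wc dW cW' min_u av (ltW xy) vx vy.
have Lg : lip (1 + `|-1| * 1) (fun t => v t + -1 * u t) := lipD _ _ _ _ Lv (lipZ _ (-1) _ Lu).
pose g t := v t + -1 * u t.
have gE t : g t = v t - u t by rewrite /g mulN1r.
have dp : {ae mu, forall t, der p t = c t * W' (u t)}.
  have lh := locint_weight_comp _ _ _ wc cW' cu.
  apply: (aeS _ _ (ae_derive_primitive _ _ lh HH)) => t dHt.
  have := is_derive_add _ _ _ _ _ (is_derive_cst (k : R) t (1 : R)) dHt.
  by rewrite add0r => /derE.
have parts := int_by_parts C _ p g x y Lp Lg (ltW xy).
rewrite !gE (vx x (lexx x)) (vy y (lexx y)) !subrr !mulr0 subrr in parts.
(* by [lagr_psi], the gap in the Fenchel-Young inequality for [der u t] and [p t] *)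
pose gap t := (lagr (der u t) - der u t * p t) - (lagr (psi (p t)) - p t * psi (p t)).
have du1 t : `|der u t| <= 1 by exact: (le_norm_der_lip _ _ _ Lu).
have gapE t : gap t = lagr (der u t) - (p t * der u t + (1 - Num.sqrt (1 + p t ^+ 2))).
  by rewrite /gap lagr_psi; ring.
have gap0 t : 0 <= gap t by rewrite gapE subr_ge0 fenchel.
have lgap : locint gap.
  apply: (locintB _ _ (locintB _ _ (locint_lagr_der _ Lu) (locintM_cont _ _ (locint_der _ _ Lu) cp))).
  apply: locint_cont => t; apply: cvgB; last by apply: cvgM; [exact: cp|exact: cpsi].
  exact: (continuous_comp (cpsi t) (lagr_continuous _)).
have lparts : locint (fun t => der p t * g t + p t * der g t).
  have lpg : locint (fun t => p t * der g t).
    have -> : (fun t => p t * der g t) = (fun t => der g t * p t).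
      by apply/funext => t; rewrite mulrC.
    exact: locintM_cont (locint_der _ _ Lg) cp.
  exact: (locintD _ _ (locintM_cont _ _ (locint_der _ _ Lp) (lip_continuous _ _ Lg)) lpg).
have igap : \int[mu]_(t in `[x, y]) gap t <= 0.
  have := ineq.
  rewrite (int_ae _ (fun t => (der p t * g t + p t * der g t) - gap t)).
  - by rewrite (intB _ _ _ _ lparts lgap) parts sub0r oppr_ge0.
  - apply: (locintD _ _ (locintB _ _ (locint_lagr_der _ Lv) (locint_lagr_der _ Lu))).
    apply: locintM_cont; first exact: locint_weight_comp.
    by move=> t; apply: cvgB; [exact: (lip_continuous _ _ Lv)|exact: cu].
  - apply: (aeS _ _ (aeI _ _ (aeI _ _ (ae_neq x) (ae_neq y)) (aeI _ _ dp
      (aeI _ _ (lip_ae_der _ _ Lu) (lip_ae_der _ _ Lv))))) => t [[tx ty] [dpt [dut dvt]]].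
    move=> /andP[xt ty'].
    have xty : x < t < y by rewrite !lt_neqAle xt ty' ty eq_sym tx.
    have -> : der g t = der v t - der u t.
      have := is_derive_add _ _ _ _ _ dvt (is_derive_scale _ (-1) _ _ dut).
      by rewrite mulN1r => /derE.
    by rewrite dpt gE (dv t xty) /gap; ring.
  - by case: (locintB _ _ lparts lgap).
have ae_u := int_ge0_le0_ae _ _ _ lgap (fun t _ => gap0 t) igap.
have uG s : x <= s <= y -> u s = v0 s.
  move=> /andP[xs sy]; rewrite /v0 HG// -(int_ae (der u)).
  - by rewrite (int_der _ _ _ _ Lu xs) addrC subrK.
  - exact: locint_der Lu.
  - apply: (aeS _ _ ae_u) => t Ht /andP[xt ts].
    apply: (fenchel_eq _ _ (du1 t)); rewrite -subr_le0 -gapE Ht// xt.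
    exact: le_trans ts sy.
  - by case: lpsi.
move=> t /andP[xt ty].
have uv0 : \forall s \near t, v0 s = u s.
  near=> s; apply/esym/uG/andP; split.
    by apply: ltW; near: s; exact: lt_nbhsr.
  by apply: ltW; near: s; exact: lt_nbhsl.
apply: near_eq_is_derive uv0 _.
have := is_derive_add _ _ _ _ _ (is_derive_cst (u x : R) t (1 : R))
  (is_derive_sub _ _ _ _ _ (dG t) (is_derive_cst (G x : R) t (1 : R))).
by rewrite add0r subr0.
Unshelve. all: by end_near. Qed.

(** On large symmetric intervals the mean slope of [u] is less than 1. The constants
    obtained on two of them agree, because [psi] is injective and [u' 0] is given. *)
Lemma euler_lagrange c (W' : R -> R) u : weight c ->
  (forall t, is_derive t 1 W (W' t)) -> continuous W' -> minimizer c u ->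
  exists (C : R) (p : R -> R), [/\ lip C p,
    forall x y, x <= y -> p y - p x = \int[mu]_(t in `[x, y]) (c t * W' (u t)) &
    forall t, is_derive t 1 u (psi (p t))].
Proof.
move=> wc dW cW' min_u; have [au _] := min_u; have [Lu _ _] := au.
have cu := lip_continuous _ _ Lu.
have [M M0 uM] := admissible_bounded _ au.
have lh := locint_weight_comp _ _ _ wc cW' cu.
have [H HH] := ex_primitive _ lh.
have [K K0 HK] := continuous_bounded W' M cW'.
have LH : lip (a2 * K) H.
  apply: lip_primitive lh _ HH => t; rewrite normrM ler_pM ?HK//.
  by have [_ /(_ t)/andP[ac ca]] := wc; rewrite ger0_norm// (le_trans (ltW a1_gt0)).
have loc (r : R) : M < r -> exists k, forall t, - r < t < r -> is_derive t 1 u (psi (k + H t)).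
  move=> Mr; apply: (euler_lagrange_local _ _ _ _ _ _ _ wc dW cW' min_u LH HH); first by lra.
  by rewrite (le_lt_trans (ler_normB _ _))//; have := uM r; have := uM (- r); lra.
have [|k Hk] := loc (M + 1); first by lra.
exists (a2 * K), (fun t => k + H t); split.
- by move=> s t; rewrite opprD addrACA subrr add0r.
- by move=> x y xy; rewrite opprD addrACA subrr add0r HH.
- move=> t; pose r := M + 1 + `|t|; have t0 := normr_ge0 t.
  have [|k' Hk'] := loc r; first by rewrite /r; lra.
  suff -> : k = k'.
    apply: Hk'; have := ler_norm t; have := ler_norm (- t); rewrite normrN /r.
    by move=> ? ?; apply/andP; split; lra.
  have /derE d0 := Hk 0 ltac:(apply/andP; split; lra).
  have /derE := Hk' 0 ltac:(rewrite /r; apply/andP; split; lra).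
  by rewrite d0 => /psi_inj/addIr.
Qed.

(** Once the Euler-Lagrange equation holds, [u' = psi p] is Lipschitz and its kinetic
    energy is integrable, whence [u'] vanishes at infinity. *)
Lemma derivative_vanishes c u (p : R -> R) (C m : R) : weight c -> admissible u ->
  energy_le c u m -> lip C p -> (forall t, is_derive t 1 u (psi (p t))) ->
  forall eps : R, 0 < eps -> exists A : R, forall t, A <= `|t| -> `|psi (p t)| < eps.
Proof.
move=> wc au Em Lp du eps eps0; have [Lu _ _] := au.
have [M _ uM] := admissible_bounded _ au.
have [|t _ et|A HA] := barbalat (psi \o p) (density W c u) (1 * C) m eps (lagr (eps / 2)) setT
  (lip_comp _ _ _ _ psi_lip Lp) (locint_density _ _ _ wc Lu uM) (fun t => density_ge0 _ u t wc)
  Em eps0.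
- by apply: lagr_gt0; rewrite gt_eqF// divr_gt0.
- rewrite /density (derE _ _ _ (du t)) (@le_trans _ _ (lagr (psi (p t))))//.
    by apply: le_lagr; rewrite gtr0_norm ?divr_gt0.
  by rewrite lerDl mulr_ge0 ?W_ge0// (weight_ge0 c).
by exists A => t At; exact: (HA t At (fun _ _ => I)).
Qed.

End potential.

(** * Existence and regularity for the weight a *)

Theorem corollary1p5 (R : realType) (W a b : R -> R) (a1 a2 T : R)
    (W_C1 : C1 W) (W_N1 : W (-1) = 0) (W_1 : W 1 = 0)
    (W_gt0 : forall s, s != -1 -> s != 1 -> 0 < W s)
    (a_meas : lebesgue_measurable a)
    (a1_gt0 : 0 < a1) (a_bnd : forall t, a1 <= a t <= a2)
    (b_Linfty : Lp +oo%E b)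
    (T_gt0 : 0 < T) (b_periodic : periodic b T)
    (le_ab : forall t, a t <= b t)
    (b_a_pinfty : b t - a t @[t --> +oo] --> (0 : R))
    (b_a_ninfty : b t - a t @[t --> -oo] --> (0 : R))
    (b_attained : exists u, attains_inf (energy W b) X1 u) :
  exists u,
    [/\ attains_inf (energy W a) X1 u,
        C1 u /\ W22loc u,
        solves_equation a W u,
        [/\ u t @[t --> +oo] --> (1 : R), u t @[t --> -oo] --> (-1 : R),
            derive1 u t @[t --> +oo] --> (0 : R) &
            derive1 u t @[t --> -oo] --> (0 : R)] &
        (Linfty_norm (weakD u) < 1)%E].
Proof.
have [W_derivable cW'] := W_C1.
have cW := derivable_continuous _ W_derivable.
have dW (t : R) : is_derive t 1 W (derive1 W t).
  by apply: DeriveDef; [exact: W_derivable|rewrite derive1E].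
have b_int := periodic_int _ _ b_periodic.
have b_a (eps : R) : 0 < eps -> exists A : R, forall t, A <= `|t| -> `|b t - a t| < eps.
  have /cvg_norm_infty H := conj b_a_pinfty b_a_ninfty.
  by move=> /H[A HA]; exists A => t /HA; rewrite subr0.
have wa : weight a1 a2 a by [].
have wb : weight a1 a2 b.
  split.
    by move: b_Linfty; rewrite /Lp inE /Lfun => /andP[]; rewrite inE.
  move=> t; have /andP[a1a _] := a_bnd t; rewrite (le_trans a1a)//=.
  by apply: (periodic_bounded _ a b T T_gt0 b_int _ b_a) => s; have /andP[] := a_bnd s.
have minP := minimizerP W cW W_N1 W_1 W_gt0 a1 a2 a1_gt0.
have [u_b /(minP _ _ wb) min_b] := b_attained.
have [u min_u] := exists_minimizer W cW W_N1 W_1 W_gt0 a1 a2 a1_gt0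
  a b T u_b wa wb T_gt0 b_int le_ab b_a min_b.
exists u; have [au umin] := min_u; have [Lu up un] := au.
have [C [p [Lp Hp du]]] := euler_lagrange W cW W_N1 W_1 W_gt0 a1 a2 a1_gt0
  a (derive1 W) u wa dW cW' min_u.
have cp := lip_continuous _ _ Lp.
have cu := lip_continuous _ _ Lu.
have u'E : derive1 u = psi \o p.
  by apply/funext => t; rewrite derive1E; have [_ ->] := du t.
have Lu' : lip (1 * C) (psi \o p) := lip_comp _ _ _ _ psi_lip Lp.
have cu' := lip_continuous _ _ Lu'.
have [v [m [av Ev]]] := finite_energy_competitor W cW W_N1 W_1 W_gt0 a1 a2 a1_gt0 a wa.
have Em := umin v m av Ev.
have u'0 := derivative_vanishes W cW W_N1 W_1 W_gt0 a1 a2 a1_gt0 a u p C m wa au Em Lp du.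
have [M _ uM] := admissible_bounded _ au.
split.
- exact/(minP _ _ wa).
- split; first by split; [move=> t; have [] := du t|rewrite u'E].
  have bd_cont (f : R -> R) : continuous f -> Lploc 2%:E f.
    move=> cf; apply: Lploc2_bd; first exact: leb_measurable_cont.
    by move=> n; have [K _ HK] := continuous_bounded f n%:R cf; exists K.
  split; first exact: bd_cont.
  exists (psi \o p), (der (psi \o p)); split.
  + by apply: (lip_weak_derivative _ _ _ Lu); apply: aeT => t; exact: derE (du t).
  + exact: bd_cont.
  + by apply: (lip_weak_derivative _ _ _ Lu'); exact: aeT.
  + apply: Lploc2_bd; first exact: leb_measurable_der Lu'.
    by move=> n; exists (1 * C) => t _; exact: le_norm_der_lip.
- have lh := locint_weight_comp a1 a2 a1_gt0 a (derive1 W) u wa cW' cu.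
  rewrite /solves_equation u'E.
  have -> : (fun t => (psi \o p) t / Num.sqrt (1 - `|(psi \o p) t| ^+ 2)) = p.
    by apply/funext => t; rewrite real_normK ?num_real// psiK.
  apply: (lip_weak_derivative _ _ _ Lp).
  by apply: (aeS _ _ (ae_derive_primitive _ _ lh Hp)) => t /derE.
- have [|u'p u'n] := (cvg_norm_infty (derive1 u) 0).1.
    by move=> eps /u'0[A HA]; exists A => t /HA; rewrite subr0 u'E.
  by split.
- have [r r1 Hr] := psi_sup_lt1 p cp u'0.
  apply: (@le_lt_trans _ _ r%:E); last by rewrite lte_fin.
  apply/Linfty_normP; apply: (aeS _ _ (weakD_der _ _ Lu)) => t ->.
  by rewrite (derE _ _ _ (du t)).
Qed.
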